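(* Let $p$ be a prime and let $G$ be a non-abelian $p$-group of order $p^n$. If the derived subgroup $G'$ has order $|G'|=p^m$, then \[|\pi_3 SK(G,1)|\leq p^{n(n-m-1)+2}.\] In particular, when $m=1$, \[|\pi_3 SK(G,1)|\leq p^{n(n-2)+2},\] and (in this case $m=1$) equality holds if and only if $G$ is isomorphic to $H\times E$, where $H$ is extra-special of order $p^3$ and exponent $p$ or $H\cong Q_8$, and $E$ is an elementary abelian $p$-group.
   Context: For a group $G$, write ${}^g g'=gg'g^{-1}$. The non-abelian tensor square $G\otimes G$ is the group generated by the symbols $g\otimes h$ ($g,h\in G$) subject to the relations \[gg'\otimes h=({}^g g'\otimes {}^g h)(g\otimes h),\qquad g\otimes hh'=(g\otimes h)({}^h g\otimes {}^h h')\] for all $g,g',h,h'\in G$. There is a homomorphism $\kappa:G\otimes G\to G'$ onto the derived subgroup $G'$, sending $g\otimes h$ to $[g,h]=ghg^{-1}h^{-1}$; its kernel is denoted $J_2(G)$. $SK(G,1)$ is the suspension of the Eilenberg–MacLane space $K(G,1)$, and $\pi_3SK(G,1)$ is its third homotopy group; by a known result of Brown and Loday, $\pi_3SK(G,1)\cong J_2(G)$. $Q_8$ is the quaternion group of order $8$ (relevant only for $p=2$). An extra-special group of order $p^3$ and exponent $p$ exists only for $p$ odd. The elementary abelian group $E$ is allowed to be trivial. *)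

(* Defs.v *)
From HB Require Import structures.
From mathcomp Require Import all_boot all_fingroup all_solvable.
From mathcomp Require Import boolp classical_sets functions cardinality.

Set Implicit Arguments.
Unset Strict Implicit.
Unset Printing Implicit Defensive.

Local Open Scope group_scope.
Local Open Scope quotient_scope.

(* The letter (false, a) stands for a, and (true, a) for its inverse. *)
Notation word A := (seq (bool * A)).

Section Words.
Variables (A : choiceType) (R : word A -> Prop).

Definition word_inv (w : word A) : word A := rev [seq (~~ l.1, l.2) | l <- w].

Inductive word_equiv : word A -> word A -> Prop :=
| WordRefl w : word_equiv w w
| WordSym w1 w2 : word_equiv w1 w2 -> word_equiv w2 w1
| WordTrans w1 w2 w3 :
    word_equiv w1 w2 -> word_equiv w2 w3 -> word_equiv w1 w3
| WordCat w1 w2 w3 w4 :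
    word_equiv w1 w2 -> word_equiv w3 w4 -> word_equiv (w1 ++ w3) (w2 ++ w4)
| WordCancel b a : word_equiv [:: (b, a); (~~ b, a)] [::]
| WordRelator w : R w -> word_equiv w [::].

Definition word_equivb (w1 w2 : word A) : bool := `[< word_equiv w1 w2 >].

Lemma word_equivb_refl : reflexive word_equivb.
Proof. by move=> w; apply/asboolP/WordRefl. Qed.

Lemma word_equivb_sym : symmetric word_equivb.
Proof. by move=> w1 w2; apply/asboolP/asboolP; apply: WordSym. Qed.

Lemma word_equivb_trans : transitive word_equivb.
Proof.
move=> w2 w1 w3 /asboolP e12 /asboolP e23; apply/asboolP.
exact: WordTrans e12 e23.
Qed.

Canonical word_equiv_rel :=
  EquivRel word_equivb word_equivb_refl word_equivb_sym word_equivb_trans.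

Definition presented := {eq_quot word_equiv_rel}.

HB.instance Definition _ := Choice.on presented.

Definition word_class (w : word A) : presented := \pi_presented w.
Definition word_repr (u : presented) : word A := generic_quotient.repr u.

Lemma word_reprK u : word_class (word_repr u) = u.
Proof. exact: reprK. Qed.

Lemma word_classP w1 w2 : word_class w1 = word_class w2 <-> word_equiv w1 w2.
Proof.
split=> [/eqquotP/asboolP//|e12].
by apply/eqquotP/asboolP.
Qed.

Lemma word_class_ind (P : presented -> Prop) :
  (forall w, P (word_class w)) -> forall u, P u.
Proof. by move=> Pw u; rewrite -(word_reprK u). Qed.

Lemma word_repr_class w : word_equiv (word_repr (word_class w)) w.
Proof. by apply/word_classP; rewrite word_reprK. Qed.

Lemma word_mulV w : word_equiv (w ++ word_inv w) [::].
Proof.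
elim: w => [|[b a] w IHw]; first exact: WordRefl.
rewrite /word_inv /= rev_cons -rcons_cat -cats1 -cat1s.
apply: WordTrans (WordCancel b a); rewrite -[[:: (b, a); _]]cat1s.
apply: WordCat; first exact: WordRefl.
by rewrite -[X in word_equiv _ X]cat0s; apply: WordCat IHw (WordRefl _).
Qed.

Lemma word_invK : involutive word_inv.
Proof.
move=> w; rewrite /word_inv map_rev revK -map_comp -[RHS]map_id.
by apply: eq_map => -[b a] /=; rewrite negbK.
Qed.

Lemma word_mulVw w : word_equiv (word_inv w ++ w) [::].
Proof. by rewrite -{2}[w]word_invK; apply: word_mulV. Qed.

Definition presented_one : presented := word_class [::].
Definition presented_mul (u v : presented) : presented :=
  word_class (word_repr u ++ word_repr v).
Definition presented_inv (u : presented) : presented :=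
  word_class (word_inv (word_repr u)).

Lemma presented_mulE w1 w2 :
  presented_mul (word_class w1) (word_class w2) = word_class (w1 ++ w2).
Proof. by apply/word_classP; apply: WordCat; apply: word_repr_class. Qed.

Lemma presented_mulA : associative presented_mul.
Proof.
elim/word_class_ind=> w1; elim/word_class_ind=> w2; elim/word_class_ind=> w3.
by rewrite !presented_mulE catA.
Qed.

Lemma presented_mul1 : left_id presented_one presented_mul.
Proof. by elim/word_class_ind=> w; rewrite presented_mulE. Qed.

Lemma presented_mulr1 : right_id presented_one presented_mul.
Proof. by elim/word_class_ind=> w; rewrite presented_mulE cats0. Qed.

Lemma presented_mulV : left_inverse presented_one presented_inv presented_mul.
Proof.
move=> u; rewrite -{2}(word_reprK u) presented_mulE.
exact/word_classP/word_mulVw.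
Qed.

Lemma presented_mulrV : right_inverse presented_one presented_inv presented_mul.
Proof.
move=> u; rewrite -{1}(word_reprK u) presented_mulE.
exact/word_classP/word_mulV.
Qed.

HB.instance Definition _ := isGroup.Build presented
  presented_mulA presented_mul1 presented_mulr1 presented_mulV presented_mulrV.

Definition presented_gen (a : A) : presented := word_class [:: (false, a)].

Lemma presented_mul_class w1 w2 :
  word_class (w1 ++ w2) = word_class w1 * word_class w2 :> presented.
Proof. by rewrite -presented_mulE. Qed.

Lemma presented_gen_ind (P : presented -> Prop) : P 1 ->
  (forall a u, P u -> P (presented_gen a * u)) ->
  (forall a u, P u -> P ((presented_gen a)^-1 * u)) -> forall u, P u.
Proof.
move=> P1 Pgen PgenV; elim/word_class_ind; elim=> [|[b a] w Pw] //.
rewrite -cat1s presented_mul_class; case: b; last exact: Pgen.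
suff -> : word_class [:: (true, a)] = (presented_gen a)^-1 by exact: PgenV.
apply: (mulgI (presented_gen a)); rewrite mulgV -presented_mul_class.
exact/word_classP/(WordCancel false).
Qed.

Variables (H : groupType) (f : A -> H).

Definition word_eval (w : word A) : H :=
  \prod_(l <- w) (if l.1 then (f l.2)^-1 else f l.2).

Definition respects_relators := forall w, R w -> word_eval w = 1.

Definition presented_lift of respects_relators :=
  fun u : presented => word_eval (word_repr u).

Hypothesis fR : respects_relators.

Lemma word_eval_equiv w1 w2 : word_equiv w1 w2 -> word_eval w1 = word_eval w2.
Proof.
elim=> //.
- by move=> ? ? ? _ -> _ ->.
- by move=> u1 u2 u3 u4 _ e12 _ e34; rewrite /word_eval !big_cat; congr (_ * _).
- by case=> a; rewrite /word_eval !big_cons big_nil mulg1 ?mulVg ?mulgV.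
- by move=> w /fR ->; rewrite /word_eval big_nil.
Qed.

Lemma presented_lift_class w : presented_lift fR (word_class w) = word_eval w.
Proof. exact/word_eval_equiv/word_repr_class. Qed.

Lemma presented_lift_gen a : presented_lift fR (presented_gen a) = f a.
Proof. by rewrite presented_lift_class /word_eval big_seq1. Qed.

Lemma presented_lift_morphism : monoid_morphism (presented_lift fR).
Proof.
split=> [|u v].
  by rewrite [LHS]presented_lift_class /word_eval big_nil.
by rewrite [LHS]presented_lift_class /word_eval big_cat.
Qed.

HB.instance Definition _ := isUMagmaMorphism.Build presented H
  (presented_lift fR) presented_lift_morphism.

End Words.

Record pointed_map (A B : pointedType) := PointedMap {
  pointed_fun :> A -> B;
  pointed_funP : pointed_fun point = point }.

Definition pointed_const (A B : pointedType) : pointed_map A B :=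
  @PointedMap A B (fun=> point) erefl.

Definition pointed_id (A : pointedType) : pointed_map A A :=
  @PointedMap A A id erefl.

Lemma pointed_comp_pt (A B C : pointedType)
    (g : pointed_map B C) (f : pointed_map A B) : g (f point) = point.
Proof. by rewrite !pointed_funP. Qed.

Definition pointed_comp (A B C : pointedType)
    (g : pointed_map B C) (f : pointed_map A B) : pointed_map A C :=
  @PointedMap A C (fun x => g (f x)) (pointed_comp_pt g f).

(* Only the faces d_0, ..., d_n.+1 of simplices of dimension n.+1 and the
   degeneracies s_0, ..., s_n of simplices of dimension n are meaningful; the
   values of face and degen at larger indices are irrelevant. *)
Record sset := Sset {
  simplex :> nat -> pointedType;
  face : forall n, nat -> pointed_map (simplex n.+1) (simplex n);
  degen : forall n, nat -> pointed_map (simplex n) (simplex n.+1);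
  face_face : forall n i j (x : simplex n.+2), i < j <= n.+2 ->
    face n i (face n.+1 j x) = face n j.-1 (face n.+1 i x);
  face_degen_lt : forall n i j (x : simplex n.+1), i < j <= n.+1 ->
    face n.+1 i (degen n.+1 j x) = degen n j.-1 (face n i x);
  face_degen_id : forall n j (x : simplex n), j <= n ->
    face n j (degen n j x) = x;
  face_degen_succ : forall n j (x : simplex n), j <= n ->
    face n j.+1 (degen n j x) = x;
  face_degen_gt : forall n i j (x : simplex n.+1), j.+1 < i <= n.+2 ->
    face n.+1 i (degen n.+1 j x) = degen n j (face n i.-1 x);
  degen_degen : forall n i j (x : simplex n), i <= j <= n ->
    degen n.+1 i (degen n j x) = degen n.+1 j.+1 (degen n i x) }.

Section Nerve.
Variable T : groupType.

(* The nerve of T, a model of K(T, 1) pointed at the degenerate simplices of its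
   unique vertex: the n-simplices are the tuples [g_1 | ... | g_n] of the bar construction;
   d_0 and d_n drop the first and the last entry, the inner faces multiply two
   consecutive entries, the degeneracies insert the unit. *)
Definition nerve_simplex (n : nat) := n.-tuple T.

HB.instance Definition _ n := Choice.on (nerve_simplex n).
HB.instance Definition _ n :=
  isPointed.Build (nerve_simplex n) [tuple of nseq n (1 : T)].

Fixpoint bar_face (i : nat) (s : seq T) : seq T :=
  match i, s with
  | O, _ :: s' => s'
  | O.+1, g :: h :: s' => g * h :: s'
  | i'.+1, g :: (_ :: _) as s' => g :: bar_face i' s'
  | _, _ => [::]
  end.

Fixpoint bar_degen (i : nat) (s : seq T) : seq T :=
  match i, s with
  | i'.+1, g :: s' => g :: bar_degen i' s'
  | _, _ => 1 :: s
  end.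

Lemma size_bar_face i s : size (bar_face i s) = (size s).-1.
Proof.
elim: s i => [|g [|h s] IHs] [|[|i]] //=.
by have := IHs i.+1; rewrite /= => ->.
Qed.

Lemma size_bar_degen i s : size (bar_degen i s) = (size s).+1.
Proof. by elim: s i => [|g s IHs] [|i] //=; rewrite IHs. Qed.

Lemma bar_face_nseq i n : bar_face i (nseq n.+1 1) = nseq n 1.
Proof.
elim: n i => [|n IHn] [|[|i]] //=; first by rewrite mulg1.
by have := IHn i.+1; rewrite /= => ->.
Qed.

Lemma bar_degen_nseq i n : bar_degen i (nseq n 1) = nseq n.+1 1.
Proof. by elim: n i => [|n IHn] [|i] //=; rewrite IHn. Qed.

Lemma bar_faceP n i (x : n.+1.-tuple T) : size (bar_face i x) == n.
Proof. by rewrite size_bar_face size_tuple. Qed.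

Lemma bar_degenP n i (x : n.-tuple T) : size (bar_degen i x) == n.+1.
Proof. by rewrite size_bar_degen size_tuple. Qed.

Lemma nerve_face_pt n i :
  Tuple (bar_faceP i (point : nerve_simplex n.+1)) = point :> nerve_simplex n.
Proof. by apply: val_inj; apply: bar_face_nseq. Qed.

Lemma nerve_degen_pt n i :
  Tuple (bar_degenP i (point : nerve_simplex n)) = point :> nerve_simplex n.+1.
Proof. by apply: val_inj; apply: bar_degen_nseq. Qed.

Definition nerve_face n i :
    pointed_map (nerve_simplex n.+1) (nerve_simplex n) :=
  @PointedMap _ _ (fun x : nerve_simplex n.+1 =>
    Tuple (bar_faceP i x) : nerve_simplex n) (nerve_face_pt n i).

Definition nerve_degen n i :
    pointed_map (nerve_simplex n) (nerve_simplex n.+1) :=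
  @PointedMap _ _ (fun x : nerve_simplex n =>
    Tuple (bar_degenP i x) : nerve_simplex n.+1) (nerve_degen_pt n i).

Lemma bar_faceSS i g s : 0 < size s ->
  bar_face i.+2 (g :: s) = g :: bar_face i.+1 s.
Proof. by case: s. Qed.

Lemma bar_degenS i g s : bar_degen i.+1 (g :: s) = g :: bar_degen i s.
Proof. by []. Qed.

Lemma bar_face_face i j s : 1 < size s -> i < j <= size s ->
  bar_face i (bar_face j s) = bar_face j.-1 (bar_face i s).
Proof.
elim: s i j => [|g [|h s] IHs] // [|i] [|j] // _.
  by case: j => [|j] // _; rewrite bar_faceSS.
case: i => [|i].
  case: j => [|j] //; case: s {IHs} => [|k s]; first by case: j => [|[|j]].
  by case: j => [_ /=|j _]; rewrite ?mulgA // !bar_faceSS.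
case: j => [|j] // lij; case: s IHs lij => [|k s] IHs lij.
  by case/andP: lij => lij lj; have := leq_trans lij lj.
rewrite [bar_face j.+2 _]bar_faceSS // [bar_face i.+2 (g :: _)]bar_faceSS;
  last by rewrite size_bar_face.
rewrite bar_faceSS ?size_bar_face // IHs //.
by case: j lij => [|j] // lij; rewrite [RHS]bar_faceSS ?size_bar_face.
Qed.

Lemma bar_face_degen_lt i j s : 0 < size s -> i < j <= size s ->
  bar_face i (bar_degen j s) = bar_degen j.-1 (bar_face i s).
Proof.
elim: s i j => [|g s IHs] // [|i] [|j] // _ lij.
case: j lij => [|j] //; case: s IHs => [|h s] IHs lij.
  by case/andP: lij => lij lj; have := leq_trans lij lj.
case: i lij => [|i] lij; first by [].
by rewrite bar_degenS bar_faceSS ?size_bar_degen // IHs.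
Qed.

Lemma bar_face_degen_id j s : j <= size s -> bar_face j (bar_degen j s) = s.
Proof.
elim: s j => [|g s IHs] [|j] //.
case: j => [_|j lj]; first by case: s {IHs} => [|h s] /=; rewrite mulg1.
by rewrite bar_degenS bar_faceSS ?size_bar_degen // IHs.
Qed.

Lemma bar_face_degen_succ j s :
  j <= size s -> bar_face j.+1 (bar_degen j s) = s.
Proof.
elim: s j => [|g s IHs] [|j] // lj; first by rewrite /= mul1g.
by rewrite bar_degenS bar_faceSS ?size_bar_degen // IHs.
Qed.

Lemma bar_face_degen_gt i j s : 0 < size s -> j.+1 < i <= (size s).+1 ->
  bar_face i (bar_degen j s) = bar_degen j (bar_face i.-1 s).
Proof.
elim: s i j => [|g s IHs] // [|[|i]] [|j] // _ lij.
case: i lij => [|i] // lij.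
case: s IHs lij => [|h s] IHs lij.
  by case/andP: lij => lij li; have := leq_trans lij li.
by rewrite bar_degenS bar_faceSS ?size_bar_degen // IHs.
Qed.

Lemma bar_degen_degen i j s : i <= j <= size s ->
  bar_degen i (bar_degen j s) = bar_degen j.+1 (bar_degen i s).
Proof.
elim: s i j => [|g s IHs] [|i] [|j] //=; rewrite ?andbF // => lij.
by rewrite IHs.
Qed.

Program Definition nerve : sset := {|
  simplex := nerve_simplex; face := nerve_face; degen := nerve_degen |}.
Next Obligation.
by apply: val_inj; apply: bar_face_face; rewrite size_tuple.
Qed.
Next Obligation.
by apply: val_inj; apply: bar_face_degen_lt; rewrite size_tuple.
Qed.
Next Obligation.
by apply: val_inj; apply: bar_face_degen_id; rewrite size_tuple.
Qed.
Next Obligation.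
by apply: val_inj; apply: bar_face_degen_succ; rewrite size_tuple.
Qed.
Next Obligation.
by apply: val_inj; apply: bar_face_degen_gt; rewrite size_tuple.
Qed.
Next Obligation.
by apply: val_inj; apply: bar_degen_degen; rewrite size_tuple.
Qed.

End Nerve.

Definition wedge (A B : pointedType) :=
  {ab : A * B | (ab.1 == point) || (ab.2 == point)}.

Definition wedge_pair (A B : pointedType) (a : A) (b : B)
    (ab : (a == point) || (b == point)) : wedge A B :=
  exist (fun ab : A * B => (ab.1 == point) || (ab.2 == point)) (a, b) ab.

Lemma wedge_ptl (A B : pointedType) (b : B) :
  ((point : A) == point) || (b == point).
Proof. by rewrite eqxx. Qed.

HB.instance Definition _ A B := Choice.on (wedge A B).
HB.instance Definition _ A B :=
  isPointed.Build (wedge A B) (wedge_pair (wedge_ptl A (point : B))).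

Definition wedge_inr (A B : pointedType) : pointed_map B (wedge A B) :=
  @PointedMap B (wedge A B) (fun b => wedge_pair (wedge_ptl A b)) erefl.

Lemma wedge_ptr (A B : pointedType) (a : A) :
  (a == point) || ((point : B) == point).
Proof. by rewrite eqxx orbT. Qed.

Lemma wedge_inl_pt (A B : pointedType) :
  wedge_pair (wedge_ptr B (point : A)) = point.
Proof. exact: val_inj. Qed.

Definition wedge_inl (A B : pointedType) : pointed_map A (wedge A B) :=
  @PointedMap A (wedge A B) (fun a => wedge_pair (wedge_ptr B a))
    (wedge_inl_pt A B).

Lemma wedgeP (A B : pointedType) (u : wedge A B) :
  (exists a, u = wedge_inl A B a) \/ (exists b, u = wedge_inr A B b).
Proof.
case: u => -[a b] ab; case/orP: (ab) => /= /eqP e.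
- by right; exists b; apply: val_inj; rewrite /= e.
- by left; exists a; apply: val_inj; rewrite /= e.
Qed.

Definition wedge_fold_fun (A B C : pointedType)
    (f : pointed_map A C) (g : pointed_map B C) (u : wedge A B) : C :=
  if (val u).2 == point then f (val u).1 else g (val u).2.

Lemma wedge_fold_pt (A B C : pointedType)
    (f : pointed_map A C) (g : pointed_map B C) :
  wedge_fold_fun f g point = point.
Proof. by rewrite /wedge_fold_fun eqxx pointed_funP. Qed.

Definition wedge_fold (A B C : pointedType)
    (f : pointed_map A C) (g : pointed_map B C) :
    pointed_map (wedge A B) C :=
  PointedMap (wedge_fold_pt f g).

Lemma wedge_fold_inl (A B C : pointedType)
    (f : pointed_map A C) (g : pointed_map B C) a :
  wedge_fold f g (wedge_inl A B a) = f a.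
Proof. by rewrite /= /wedge_fold_fun eqxx. Qed.

Lemma wedge_fold_inr (A B C : pointedType)
    (f : pointed_map A C) (g : pointed_map B C) b :
  wedge_fold f g (wedge_inr A B b) = g b.
Proof.
rewrite /= /wedge_fold_fun /=.
by case: eqP => [->|//]; rewrite !pointed_funP.
Qed.

(* Kan's suspension of X: the quotient by the base X of the reduced cone on X,
   with the vertex of the cone coming before the base.  An n-simplex of the cone
   lying neither in X nor on the vertex is the join of k > 0 copies of the
   vertex with a simplex of X of dimension n - k, so
     (susp X)_n = X_(n-1) \/ X_(n-2) \/ ... \/ X_0;
   an element of the first summand has exactly one copy of the vertex, and the
   inclusion of the other summands (susp X)_(n-1) adds a copy.  A face or
   degeneracy with index less than k deletes or repeats a copy of the vertex,
   the others act on the simplex of X; a simplex falling into the base, onto the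
   vertex or onto the line joining it to the basepoint of X is the basepoint.
   The realization of susp X is the reduced suspension of that of X. *)
Section Suspension.
Variable X : sset.

Fixpoint susp_simplex (n : nat) : pointedType :=
  if n is n'.+1 then wedge (X n') (susp_simplex n') else unit.

(* One copy of the vertex followed by a simplex of X. *)
Definition susp_cell n : pointed_map (X n) (susp_simplex n.+1) :=
  wedge_inl (X n) (susp_simplex n).

(* One more copy of the vertex. *)
Definition susp_up n : pointed_map (susp_simplex n) (susp_simplex n.+1) :=
  wedge_inr (X n) (susp_simplex n).

Definition susp_case n (C : pointedType) (f : pointed_map (X n) C)
    (g : pointed_map (susp_simplex n) C) : pointed_map (susp_simplex n.+1) C :=
  wedge_fold f g.

Fixpoint susp_face (n i : nat) :
    pointed_map (susp_simplex n.+1) (susp_simplex n) :=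
  match i, n with
  | O, _ => susp_case (pointed_const _ _) (pointed_id _)
  | _, O => pointed_const _ _
  | O.+1, n'.+1 =>
      susp_case (pointed_comp (susp_cell n') (face X n' 0)) (pointed_id _)
  | i'.+1, n'.+1 =>
      susp_case (pointed_comp (susp_cell n') (face X n' i'))
                (pointed_comp (susp_up n') (susp_face n' i'))
  end.

Fixpoint susp_degen (n i : nat) :
    pointed_map (susp_simplex n) (susp_simplex n.+1) :=
  match i, n with
  | O, _ => susp_up _
  | _, O => pointed_const _ _
  | i'.+1, n'.+1 =>
      susp_case (pointed_comp (susp_cell n'.+1) (degen X n' i'))
                (pointed_comp (susp_up n'.+1) (susp_degen n' i'))
  end.

Lemma suspP n (x : susp_simplex n.+1) :
  (exists y, x = susp_cell n y) \/ (exists z, x = susp_up n z).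
Proof. exact: wedgeP. Qed.

Lemma susp_face0c n y : susp_face n 0 (susp_cell n y) = point.
Proof. by case: n y => [|n] y; exact: wedge_fold_inl. Qed.

Lemma susp_face0u n z : susp_face n 0 (susp_up n z) = z.
Proof. by case: n z => [|n] z; exact: wedge_fold_inr. Qed.

Lemma susp_faceSc n i y :
  susp_face n.+1 i.+1 (susp_cell n.+1 y) = susp_cell n (face X n i y).
Proof. by case: i => [|i]; exact: wedge_fold_inl. Qed.

Lemma susp_face1u n z : susp_face n.+1 1 (susp_up n.+1 z) = z.
Proof. exact: wedge_fold_inr. Qed.

Lemma susp_faceSu n i z :
  susp_face n.+1 i.+2 (susp_up n.+1 z) = susp_up n (susp_face n i.+1 z).
Proof. exact: wedge_fold_inr. Qed.

Lemma susp_degen0 n x : susp_degen n 0 x = susp_up n x.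
Proof. by case: n x. Qed.

Lemma susp_degenSc n i y :
  susp_degen n.+1 i.+1 (susp_cell n y) = susp_cell n.+1 (degen X n i y).
Proof. exact: wedge_fold_inl. Qed.

Lemma susp_degenSu n i z :
  susp_degen n.+1 i.+1 (susp_up n z) = susp_up n.+1 (susp_degen n i z).
Proof. exact: wedge_fold_inr. Qed.

Lemma susp_vertex (x y : susp_simplex 0) : x = y.
Proof. by case: x y => -[]. Qed.

Local Opaque susp_simplex susp_cell susp_up susp_face susp_degen.

Lemma susp_face_face n i j (x : susp_simplex n.+2) : i < j <= n.+2 ->
  susp_face n i (susp_face n.+1 j x) = susp_face n j.-1 (susp_face n.+1 i x).
Proof.
elim: n i j x => [|n IHn] i j x; first by move=> _; exact: susp_vertex.
case: i j => [|i] [|j] // lij; rewrite succnK; case: (suspP x) => -[y ->{x}].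
- by rewrite susp_faceSc !susp_face0c pointed_funP.
- case: j lij => [|j] lij; first by rewrite susp_face1u susp_face0u.
  by rewrite susp_faceSu !susp_face0u.
- case: j lij => [|j] // lij.
  by rewrite !susp_faceSc (@face_face X n i j.+1).
- case: j lij => [|j] // lij; rewrite susp_faceSu.
  case: i lij => [|i] lij; first by rewrite !susp_face1u.
  case: j lij => [|j] // lij; rewrite !susp_faceSu.
  by rewrite (IHn i.+1 j.+2).
Qed.

Lemma susp_face_degen_lt n i j (x : susp_simplex n.+1) : i < j <= n.+1 ->
  susp_face n.+1 i (susp_degen n.+1 j x) =
  susp_degen n j.-1 (susp_face n i x).
Proof.
elim: n i j x => [|n IHn] [|i] [|j] x // lij; rewrite succnK.
- case: j lij => [|j] // _; case: (suspP x) => -[y ->{x}].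
    by rewrite susp_degenSc !susp_face0c pointed_funP.
  by rewrite susp_degenSu !susp_face0u.
- by case/andP: lij => lij lj; have := leq_trans lij lj.
- case: (suspP x) => -[y ->{x}].
    by rewrite susp_degenSc !susp_face0c pointed_funP.
  by rewrite susp_degenSu !susp_face0u.
- case: j lij => [|j] // lij; case: (suspP x) => -[y ->{x}].
    by rewrite susp_degenSc !susp_faceSc susp_degenSc
               (@face_degen_lt X n i j.+1).
  rewrite susp_degenSu; case: i lij => [|i] lij; first by rewrite !susp_face1u.
  by rewrite !susp_faceSu susp_degenSu (IHn i.+1 j.+1).
Qed.

Lemma susp_face_degen_id n j (x : susp_simplex n) : j <= n ->
  susp_face n j (susp_degen n j x) = x.
Proof.
elim: n j x => [|n IHn] [|j] x // lj; rewrite ?susp_degen0 ?susp_face0u //.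
case: (suspP x) => -[y ->{x}].
  by rewrite susp_degenSc susp_faceSc face_degen_id.
rewrite susp_degenSu; case: j lj => [|j] lj.
  by rewrite susp_face1u susp_degen0.
by rewrite susp_faceSu IHn.
Qed.

Lemma susp_face_degen_succ n j (x : susp_simplex n) : j <= n ->
  susp_face n j.+1 (susp_degen n j x) = x.
Proof.
elim: n j x => [|n IHn] [|j] x // lj; first exact: susp_vertex.
  by rewrite susp_degen0 susp_face1u.
case: (suspP x) => -[y ->{x}].
  by rewrite susp_degenSc susp_faceSc face_degen_succ.
by rewrite susp_degenSu susp_faceSu IHn.
Qed.

Lemma susp_face_degen_gt n i j (x : susp_simplex n.+1) : j.+1 < i <= n.+2 ->
  susp_face n.+1 i (susp_degen n.+1 j x) =
  susp_degen n j (susp_face n i.-1 x).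
Proof.
elim: n i j x => [|n IHn] [|[|i]] [|j] x // lij; rewrite succnK.
- by rewrite !susp_degen0 susp_faceSu.
- by case/andP: lij => lij li; have := leq_trans lij li.
- by rewrite !susp_degen0 susp_faceSu.
case: i lij => [|i] // lij; case: (suspP x) => -[y ->{x}].
  by rewrite susp_degenSc !susp_faceSc susp_degenSc (@face_degen_gt X n i.+2 j).
by rewrite susp_degenSu !susp_faceSu susp_degenSu (IHn i.+2 j).
Qed.

Lemma susp_degen_degen n i j (x : susp_simplex n) : i <= j <= n ->
  susp_degen n.+1 i (susp_degen n j x) =
  susp_degen n.+1 j.+1 (susp_degen n i x).
Proof.
elim: n i j x => [|n IHn] [|i] [|j] x // lij.
- by rewrite !susp_degen0 susp_degenSu susp_degen0.
- by case/andP: lij.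
- by rewrite !susp_degen0 susp_degenSu susp_degen0.
- by rewrite !susp_degen0 susp_degenSu.
case: (suspP x) => -[y ->{x}].
  by rewrite !susp_degenSc degen_degen.
by rewrite !susp_degenSu IHn.
Qed.

Definition susp : sset := @Sset susp_simplex susp_face susp_degen
  susp_face_face susp_face_degen_lt susp_face_degen_id susp_face_degen_succ
  susp_face_degen_gt susp_degen_degen.

End Suspension.

(* The loop group G X of Kan (A combinatorial definition of homotopy groups,
   Ann. of Math. 67 (1958)) of a simplicial set X with a single vertex: the
   group (G X)_n is generated by symbols <x>, for x an (n + 1)-simplex of X,
   subject to <s_0 y> = 1, and its faces are
     d_0 <x> = <d_1 x> <d_0 x>^-1   and   d_i <x> = <d_(i+1) x> for i > 0. *)
Section LoopGroup.
Variable X : sset.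

Definition loop_relator n (w : word (X n.+1)) : Prop :=
  exists y : X n, w = [:: (false, degen X n 0 y)].

Definition loop_group (n : nat) : groupType := presented (@loop_relator n).

Definition loop_gen n (x : X n.+1) : loop_group n :=
  presented_gen (@loop_relator n) x.

Definition loop_face_gen n i (x : X n.+2) : loop_group n :=
  if i is i'.+1 then loop_gen (face X n.+1 i'.+2 x)
  else loop_gen (face X n.+1 1 x) * (loop_gen (face X n.+1 0 x))^-1.

Lemma loop_gen_degen0 n (y : X n) : loop_gen (degen X n 0 y) = 1.
Proof. by apply/word_classP/WordRelator; exists y. Qed.

Lemma loop_face_respects n (i : 'I_n.+2) :
  respects_relators (@loop_relator n.+1) (@loop_face_gen n i).
Proof.
move=> w [y ->]; rewrite /word_eval big_seq1 /=.
case: i => -[|i] lin.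
  by rewrite /= face_degen_id // face_degen_succ // mulgV.
by rewrite /= face_degen_gt //= loop_gen_degen0.
Qed.

Definition loop_face n (i : 'I_n.+2) : loop_group n.+1 -> loop_group n :=
  presented_lift (@loop_face_respects n i).

HB.instance Definition _ n i := isUMagmaMorphism.Build _ _ (@loop_face n i)
  (presented_lift_morphism (@loop_face_respects n i)).

Lemma loop_faceE n (i : 'I_n.+2) x :
  loop_face i (loop_gen x) = loop_face_gen i x.
Proof. exact: presented_lift_gen. Qed.

Lemma loop_face_face n (i j' : 'I_n.+2) (i' j : 'I_n.+3) u :
  i < j -> i' = i :> nat -> j' = j.-1 :> nat ->
  loop_face i (loop_face j u) = loop_face j' (loop_face i' u).
Proof.
move=> lij ei ej.
suff Egen x : loop_face i (loop_face j (loop_gen x)) =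
              loop_face j' (loop_face i' (loop_gen x)).
  elim/presented_gen_ind: u => [|x u IHu|x u IHu].
  - by rewrite 2!gmulf1 /= 2!gmulf1.
  - by rewrite 2!gmulfM /= 2!gmulfM /= IHu Egen.
  - by rewrite 2!gmulfM /= 2!gmulfM /= IHu 2!gmulfV /= 2!gmulfV /= Egen.
case: i i' j j' lij ei ej => [i li] [i' li'] [[|j] lj] [j' lj'] //= lij ei ej.
subst i' j'; rewrite !loop_faceE /loop_face_gen.
have ff a b : a < b <= n.+3 -> face X n.+1 a (face X n.+2 b x) =
    face X n.+1 b.-1 (face X n.+2 a x) by exact: face_face.
case: i li li' lij => [|i] li li' lij; last first.
  case: j lj lj' lij => [|j] lj lj' lij //.
  by rewrite /= !loop_faceE /= (ff i.+2 j.+3) //; apply/andP.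
rewrite /= gmulfM /= gmulfV /= !loop_faceE /=.
case: j lj lj' lij => [|j] lj lj' lij /=.
  by rewrite invgM invgK mulgA (ff 1%N 2) // (ff 0 2) // (ff 0 1%N) //= mulgKV.
by rewrite (ff 1%N j.+3) // (ff 0 j.+3).
Qed.

Definition loop_cycles n : set (loop_group n) :=
  match n with
  | 0 => [set: loop_group 0]%classic
  | n'.+1 => [set u | forall i, @loop_face n' i u = 1]%classic
  end.

Definition loop_boundaries n : set (loop_group n) :=
  [set u | exists2 v : loop_group n.+1,
     (forall i : 'I_n.+2, 0 < i -> loop_face i v = 1) &
     u = loop_face ord0 v]%classic.

(* For n > 0, pi_n(X) = pi_(n-1)(G X) is the quotient of the Moore cycles of
   G X in dimension n - 1 by the boundaries; its elements are given here as
   cosets. *)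
Definition homotopy_group (n : nat) : set (set (loop_group n.-1)) :=
  [set [set u * b | b in @loop_boundaries n.-1] | u in @loop_cycles n.-1]%classic.

End LoopGroup.

Arguments homotopy_group : clear implicits.

Definition pi3SK (gT : finGroupType) (G : {group gT}) :=
  homotopy_group (susp (nerve (subg_of G))) 3.

Arguments pi3SK {gT} G.

(* Main.v *)
Require Import Defs.
From HB Require Import structures.
From mathcomp Require Import all_boot all_fingroup all_algebra all_solvable.
From mathcomp Require Import mxabelem ring.
From mathcomp Require Import boolp classical_sets functions cardinality.

Set Implicit Arguments.
Unset Strict Implicit.
Unset Printing Implicit Defensive.

(** The theorem of Brown and Loday identifies the third homotopy group with the
    kernel J of kappa on the tensor square, so that the statement becomes one
    about the order of the tensor square of a finite p-group.

    Homotopy.  Let S be a group.  Since every simplex of the Kan suspension of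
    the nerve X of S that starts with two copies of the vertex is degenerate, the
    loop group of the suspension is Milnor's construction: in dimension n it is
    free on the n-simplices of X other than the base point, and its faces and
    degeneracies are those of X on generators.  So pi_3 is Z / B with Z the
    elements of F_2 killed by all faces and B the boundaries from F_3.  The
    tensor square L of S gives rise to a group (L x S) x S of triples, a double
    semidirect product (sdp), which receives F_2 by e(g, h) |-> s_1(g) s_0(h);
    an induction over F_3 (filler) shows that B goes to 1, and Z goes into the
    kernel of kappa on L.  For the inverse, work in Q = F_2 / B.  Commutators of
    3-simplices with complementary trivial faces show that the Moore
    group of Q (the common kernel of d_1 and d_2) is a braided crossed module
    over F_1, so that
      s_1(b) s_0(a) s_1(b)^-1 s_0(b a b^-1)^-1
    obeys the relations of a (x) b for a, b in F_1.  Beyond the degenerate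
    elements Q is generated by elements tau(g, h) lying over the free generators
    <g> <h> <gh>^-1 of the kernel of F_1 -> S; they satisfy a cocycle identity,
    hence span a normal subgroup T, and T is mapped injectively to F_1 by
    Reidemeister-Schreier (span_inj).  Modulo T the pairing above only depends
    on the images of a and b in S, which yields L -> Q / T inverse to F_2 -> L
    on cycles (phi_classifies, brown_loday_simplicial, brown_loday).

    Upper bound.  As kappa maps L onto S', the order of L is |J| |S'|, and
    L is to be bounded.  If S is abelian and generated by k elements, L is an
    image of S^k.  If z is central in S of prime order p and lies in S', then
    tensors z (x) g are central, multiplicative in g and trivial on S', and the
    kernel of L(S) -> L(S / z) consists of them; its order is the index of
    tker z, the subgroup of the g with z (x) g = 1.  That index is at most
    |S : S'|, and if S' = <z> it is at most p^2, because [x, y] (x) a = 1 for a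
    centralising x and y, and centralisers have index at most p.  An induction
    on m gives |L| <= p^((n - m)(n - 1) + 2) (has_order_bound).

    Equality.  Let S' = <z> have order p.  Equality forces the abelian group
    S / S' of order p^(n - 1) to need n - 1 generators, so to be elementary, and
    tker z to have index p^2.  The latter makes tker z the intersection of the
    centralisers of any two noncommuting elements, hence the centre, which is
    then elementary of index p^2; computing with tensors of powers shows that
    x^p = 1 for p odd, and that x^2 = z off the centre for p = 2.  So S = H x E
    with H of order p^3 as required (structure_isog).  Conversely, for such a
    product, the outer product of S / S' with itself shows that L has order at
    least p^((n - 1)^2) times the index of tker z (has_order_ge_abelem), and
    explicit crossed pairings on the Heisenberg group and on the quaternion
    group separate z (x) g from 1 for g off the centre of H
    (index_tker_factor). *)

Local Open Scope group_scope.

(** * Morphisms and quotients of possibly infinite groups *)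

Notation "G '--->' H" := (UMagmaMorphism.type G H)
  (at level 99, H at level 200) : type_scope.

Lemma morphM_monoid_morphism (G H : groupType) (f : G -> H) :
  {morph f : x y / x * y} -> monoid_morphism f.
Proof.
move=> fM; split=> //.
by apply: (mulgI (f 1)); rewrite -fM !mulg1.
Qed.

Ltac grp := rewrite ?gnorm //.

(** With the morphism as an argument, a rewrite can be aimed at one of
    several composed morphisms. *)
Lemma homM (G H : groupType) (f : G ---> H) x y : f (x * y) = f x * f y.
Proof. exact: gmulfM. Qed.

Lemma homV (G H : groupType) (f : G ---> H) x : f x^-1 = (f x)^-1.
Proof. exact: gmulfV. Qed.

(** Normality is stated for predicates because the groups of interest are
    infinite. *)
Record normal_subgroup (T : groupType) := NormalSubgroup {
  in_normal :> T -> Prop;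
  normal1 : in_normal 1;
  normalM : forall x y, in_normal x -> in_normal y -> in_normal (x * y);
  normalV : forall x, in_normal x -> in_normal x^-1;
  normalJ : forall x y, in_normal x -> in_normal (y * x * y^-1) }.

Section Quotient.
Variables (T : groupType) (N : normal_subgroup T).

(** The quotient T / N is presented by all elements of T, with every word
    whose value lies in N as a relator; this reuses the presented groups. *)
Definition quo_relator (w : word T) : Prop := N (word_eval idfun w).
Definition quo : groupType := presented quo_relator.
Definition quo_pi (x : T) : quo := presented_gen quo_relator x.

Lemma word_eval_cat (A : choiceType) (H : groupType) (f : A -> H) w1 w2 :
  word_eval f (w1 ++ w2) = word_eval f w1 * word_eval f w2.
Proof. by rewrite /word_eval big_cat. Qed.

(** Equivalent words have values in the same coset of N, so the presentation
    identifies no more than N does. *)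
Lemma quo_word_equiv w1 w2 : word_equiv quo_relator w1 w2 ->
  N ((word_eval idfun w1)^-1 * word_eval idfun w2).
Proof.
elim=> {w1 w2}.
- by move=> w; rewrite mulVg; apply: normal1.
- by move=> w1 w2 _ /normalV; rewrite invgM invgK.
- by move=> w1 w2 w3 _ h12 _ h23; have := normalM h12 h23; rewrite mulgA mulgK.
- move=> w1 w2 w3 w4 _ h12 _ h34; rewrite !word_eval_cat invgM.
  have := normalM (normalJ (word_eval idfun w3)^-1 h12) h34.
  by rewrite invgK !mulgA mulgK.
- by move=> b a; case: b; rewrite /word_eval !big_cons big_nil /= ?gsimp; apply: normal1.
- by move=> w Rw; rewrite {2}/word_eval big_nil mulg1; apply: normalV.
Qed.

Lemma quo_piM : {morph quo_pi : x y / x * y}.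
Proof.
move=> x y; apply/esym; rewrite /quo_pi /presented_gen -presented_mul_class.
apply/word_classP.
set u := [:: (false, x); (false, y)].
have e1 : word_equiv quo_relator (u ++ [::])
    (u ++ [:: (true, x * y); (~~ true, x * y)]).
  by apply: WordCat (WordRefl _ _) (WordSym (WordCancel _ _ _)).
have e2 : word_equiv quo_relator
    ((u ++ [:: (true, x * y)]) ++ [:: (false, x * y)])
    ([::] ++ [:: (false, x * y)]).
  apply: WordCat (WordRefl _ _); apply: WordRelator.
  by rewrite /quo_relator /word_eval !big_cons big_nil /= mulg1 mulgA mulgV;
     apply: normal1.
exact: WordTrans e1 e2.
Qed.

HB.instance Definition _ := isUMagmaMorphism.Build T quo quo_pi
  (morphM_monoid_morphism quo_piM).

Lemma quo_pi_eq x y : quo_pi x = quo_pi y <-> N (x^-1 * y).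
Proof.
split=> [/word_classP/quo_word_equiv|Nxy].
  by rewrite /word_eval !big_seq1.
apply: (mulgI (quo_pi x)^-1); rewrite mulVg -gmulfV -gmulfM.
apply/esym/word_classP/WordRelator.
by rewrite /quo_relator /word_eval big_seq1.
Qed.

Lemma quo_pi_eq1 x : quo_pi x = 1 <-> N x.
Proof.
have := quo_pi_eq 1 x; rewrite invg1 mul1g gmulf1 => -[h1 h2].
by split=> [/esym/h1|/h2/esym].
Qed.

Lemma quo_ind (P : quo -> Prop) : (forall x, P (quo_pi x)) -> forall u, P u.
Proof.
move=> Ppi; have surj : forall u, exists x, u = quo_pi x.
  elim/presented_gen_ind=> [|a u [x ->]|a u [x ->]].
  - by exists 1; rewrite gmulf1.
  - by exists (a * x); rewrite gmulfM.
  - by exists (a^-1 * x); rewrite gmulfM gmulfV.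
by move=> u; have [x ->] := surj u.
Qed.

Arguments quo_pi : simpl never.

Section Lift.
Variables (H : groupType) (f : T ---> H).
Hypothesis fN : forall x, N x -> f x = 1.

Lemma word_eval_hom (w : word T) : word_eval f w = f (word_eval idfun w).
Proof.
rewrite /word_eval gmulf_prod; apply: eq_bigr => l _.
by case: l.1; rewrite ?gmulfV.
Qed.

Lemma quo_lift_respects : respects_relators quo_relator f.
Proof. by move=> w Rw; rewrite word_eval_hom fN. Qed.

Definition quo_lift : quo ---> H := presented_lift quo_lift_respects.

Lemma quo_liftE x : quo_lift (quo_pi x) = f x.
Proof. exact: presented_lift_gen. Qed.

End Lift.
End Quotient.

Lemma presented_ext (A : choiceType) (R : word A -> Prop) (H : groupType)
    (f g : presented R ---> H) :
  (forall a, f (presented_gen R a) = g (presented_gen R a)) -> f =1 g.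
Proof.
move=> fg; elim/presented_gen_ind=> [|a u IHu|a u IHu]; rewrite ?gmulf1 //.
- by rewrite !gmulfM fg IHu.
- by rewrite !gmulfM !gmulfV fg IHu.
Qed.

Lemma presented_gen_rind (A : choiceType) (R : word A -> Prop)
    (P : presented R -> Prop) : P 1 ->
  (forall a u, P u -> P (u * presented_gen R a)) ->
  (forall a u, P u -> P (u * (presented_gen R a)^-1)) -> forall u, P u.
Proof.
move=> P1 Pg PgV u; rewrite -[u]invgK.
elim/presented_gen_ind: u^-1 => [|a v Pv|a v Pv]; rewrite ?invg1 ?invgM ?invgK //.
- exact: PgV.
- exact: Pg.
Qed.

(** * The non-abelian tensor square *)

Section TensorSquare.
Variable S : groupType.

(** Both defining relations, written as u v^-1 w^-1 for a relation u = w v. *)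
Definition tsq_relator (w : word (S * S)%type) : Prop :=
  (exists g g' h, w = [:: (false, (g * g', h)); (true, (g, h));
                          (true, (g * g' * g^-1, g * h * g^-1))]) \/
  (exists g h h', w = [:: (false, (g, h * h'));
                          (true, (h * g * h^-1, h * h' * h^-1));
                          (true, (g, h))]).

Definition tsq : groupType := presented tsq_relator.
Definition tens (g h : S) : tsq := presented_gen tsq_relator (g, h).

(** The crossed pairings of Brown and Loday: the maps that extend to the
    tensor square (tsq_lift). *)
Definition crossed_pairing (H : groupType) (f : S -> S -> H) : Prop :=
  (forall g g' h, f (g * g') h = f (g * g' * g^-1) (g * h * g^-1) * f g h) /\
  (forall g h h', f g (h * h') = f g h * f (h * g * h^-1) (h * h' * h^-1)).

Lemma tens_crossed : crossed_pairing tens.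
Proof.
have word_class_true a : word_class tsq_relator [:: (true, a)] =
    (presented_gen tsq_relator a)^-1.
  apply: (mulgI (presented_gen tsq_relator a)); rewrite mulgV.
  rewrite -presented_mul_class; exact/word_classP/(WordCancel _ false).
have rel a b c :
    tsq_relator [:: (false, a); (true, b); (true, c)] ->
    presented_gen tsq_relator a =
    presented_gen tsq_relator c * presented_gen tsq_relator b.
  move=> R; have /word_classP := WordRelator R.
  rewrite -[[:: _; _; _]]/([:: (false, a)] ++ ([:: (true, b)] ++ [:: (true, c)])).
  rewrite !presented_mul_class !word_class_true => e.
  by apply/divg1_eq; rewrite invgM.
split=> [g g' h|g h h']; [apply: rel; left|apply: rel; right].
- by exists g, g', h.
- by exists g, h, h'.
Qed.

Lemma tensMl g g' h :
  tens (g * g') h = tens (g * g' * g^-1) (g * h * g^-1) * tens g h.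
Proof. by case: tens_crossed. Qed.

Lemma tensMr g h h' :
  tens g (h * h') = tens g h * tens (h * g * h^-1) (h * h' * h^-1).
Proof. by case: tens_crossed. Qed.

Section TensorLift.
Variables (H : groupType) (f : S -> S -> H).
Hypothesis fP : crossed_pairing f.

Lemma tsq_lift_respects :
  respects_relators tsq_relator (fun gh : S * S => f gh.1 gh.2).
Proof.
case: fP => fl fr w [[g [g' [h ->]]]|[g [h [h' ->]]]];
  rewrite /word_eval !big_cons big_nil /=.
- by rewrite fl; grp.
- by rewrite fr; grp.
Qed.

Definition tsq_lift : tsq ---> H := presented_lift tsq_lift_respects.

Lemma tsq_liftE g h : tsq_lift (tens g h) = f g h.
Proof. exact: presented_lift_gen. Qed.

End TensorLift.

Lemma tsq_ext (H : groupType) (f g : tsq ---> H) :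
  (forall a b, f (tens a b) = g (tens a b)) -> f =1 g.
Proof. by move=> fg; apply: presented_ext => -[a b]; apply: fg. Qed.

Lemma tsq_ind (P : tsq -> Prop) : P 1 ->
  (forall g h, P (tens g h)) -> (forall u v, P u -> P v -> P (u * v)) ->
  (forall u, P u -> P u^-1) -> forall u, P u.
Proof.
move=> P1 Pg PM PV; elim/presented_gen_ind=> // -[g h] u Pu; apply: PM => //.
  exact: Pg.
by apply: PV; apply: Pg.
Qed.

Lemma kappa_crossed :
  crossed_pairing (fun g h : S => g * h * g^-1 * h^-1).
Proof. by split=> *; grp. Qed.

Definition kappa : tsq ---> S := tsq_lift kappa_crossed.

Lemma kappaE g h : kappa (tens g h) = g * h * g^-1 * h^-1.
Proof. exact: tsq_liftE. Qed.

Lemma tact_crossed x :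
  crossed_pairing (fun g h => tens (x * g * x^-1) (x * h * x^-1)).
Proof.
split=> [g g' h|g h h'].
- transitivity (tens ((x * g * x^-1) * (x * g' * x^-1)) (x * h * x^-1)).
    by congr tens; grp.
  by rewrite tensMl; congr (tens _ _ * tens _ _); grp.
- transitivity (tens (x * g * x^-1) ((x * h * x^-1) * (x * h' * x^-1))).
    by congr tens; grp.
  by rewrite tensMr; congr (tens _ _ * tens _ _); grp.
Qed.

Definition tact (x : S) : tsq ---> tsq := tsq_lift (tact_crossed x).

Lemma tactE x g h : tact x (tens g h) = tens (x * g * x^-1) (x * h * x^-1).
Proof. exact: tsq_liftE. Qed.

Lemma tact1 u : tact 1 u = u.
Proof.
elim/tsq_ind: u => [|g h|u v IHu IHv|u IHu].
- by rewrite gmulf1.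
- by rewrite tactE; grp.
- by rewrite gmulfM IHu IHv.
- by rewrite gmulfV IHu.
Qed.

Lemma tactM x y u : tact (x * y) u = tact x (tact y u).
Proof.
elim/tsq_ind: u => [|g h|u v IHu IHv|u IHu].
- by rewrite !gmulf1.
- by rewrite !tactE; grp.
- by rewrite !gmulfM IHu IHv.
- by rewrite !gmulfV IHu.
Qed.

Lemma tactK x u : tact x^-1 (tact x u) = u.
Proof. by rewrite -tactM mulVg tact1. Qed.

Lemma tactKV x u : tact x (tact x^-1 u) = u.
Proof. by rewrite -tactM mulgV tact1. Qed.

Lemma kappa_tact x u : kappa (tact x u) = x * kappa u * x^-1.
Proof.
elim/tsq_ind: u => [|g h|u v IHu IHv|u IHu].
- by rewrite !gmulf1; grp.
- by rewrite tactE !kappaE; grp.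
- by rewrite !gmulfM IHu IHv; grp.
- by rewrite !gmulfV IHu; grp.
Qed.

Lemma tensDl g g' h : tens (g * g') h = tact g (tens g' h) * tens g h.
Proof. by rewrite tensMl tactE. Qed.

Lemma tensDr g h h' : tens g (h * h') = tens g h * tact h (tens g h').
Proof. by rewrite tensMr tactE. Qed.

Lemma tens1g h : tens 1 h = 1.
Proof.
by apply: (mulIg (tens 1 h)); rewrite mul1g -{3}[1]mulg1 tensDl tact1.
Qed.

Lemma tensg1 g : tens g 1 = 1.
Proof.
by apply: (mulIg (tens g 1)); rewrite mul1g -{3}[1]mulg1 tensDr tact1.
Qed.

Lemma tensVl g h : tens g^-1 h = (tact g^-1 (tens g h))^-1.
Proof.
by apply: (mulgI (tact g^-1 (tens g h))); rewrite mulgV -tensDl mulVg tens1g.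
Qed.

Lemma tensVr g h : tens g h^-1 = (tact h^-1 (tens g h))^-1.
Proof.
by apply: (mulIg (tact h^-1 (tens g h))); rewrite mulVg -tensDr mulVg tensg1.
Qed.

(** The Peiffer identity: expanding gh (x) ab first in gh and then in ab, or
    in the other order, compares the two ways in which g (x) h can be moved
    past a tensor. *)
Lemma tact_kappa u v : tact (kappa u) v = u * v * u^-1.
Proof.
elim/tsq_ind: u v => [|g h|u1 u2 IH1 IH2|u IHu] v.
- by rewrite gmulf1 tact1; grp.
(* The two expansions of the tensor of g a with h b. *)
- have gen a b : tact (g * h) (tens a b) * tens g h =
      tens g h * tact (h * g) (tens a b) :> tsq.
    have := tensDl g a (h * b); rewrite [LHS]tensDr !tensDr [tens (g * a) b]tensDl tensDl.
    rewrite !gmulfM -!tactM !mulgA => /mulIg e.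
    by apply: (mulgI (tact g (tens a h))); rewrite !mulgA -e.
  rewrite kappaE -!mulgA -invgM mulgA tactM.
  have [w ->] : exists w, v = tact (h * g) w by exists (tact (h * g)^-1 v); rewrite tactKV.
  rewrite tactK.
  elim/tsq_ind: w => [|a b|w1 w2 IH1 IH2|w IHw].
  + by rewrite !gmulf1; grp.
  + by rewrite mulgA -gen; grp.
  + by rewrite !gmulfM IH1 IH2; grp.
  + by rewrite !gmulfV IHw; grp.
- by rewrite gmulfM tactM IH2 IH1; grp.
- rewrite gmulfV; apply: (can_inj (tactK (kappa u))).
  by rewrite tactKV IHu; grp.
Qed.

(** Obtained by expanding g (x) hb', with b' the conjugate of b by h^-1, and
    noting that hb' = bh. *)
Lemma tens_conjl g h b :
  tens (h * g * h^-1) b = (tens g h)^-1 * tens g b * tact b (tens g h).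
Proof.
have -> : tens (h * g * h^-1) b = tact h (tens g (h^-1 * b * h)).
  by rewrite tactE; congr tens; grp.
apply: (mulgI (tens g h)); rewrite -tensDr.
have -> : h * (h^-1 * b * h) = b * h by grp.
by rewrite tensDr; grp.
Qed.

(** Both sides are crossed homomorphisms in u, and for u a tensor the
    identity is the expansion of g (hgh^-1)^-1 (x) b. *)
Lemma tens_kappal u b : tens (kappa u) b = u * (tact b u)^-1.
Proof.
elim/tsq_ind: u b => [|g h|u1 u2 IH1 IH2|u IHu] b.
- by rewrite !gmulf1 tens1g; grp.
- have -> : kappa (tens g h) = g * (h * g * h^-1)^-1 by rewrite kappaE; grp.
  rewrite tensDl tensVl gmulfV -tactM.
  have -> : g * (h * g * h^-1)^-1 = kappa (tens g h) by rewrite kappaE; grp.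
  by rewrite tact_kappa tens_conjl; grp.
- by rewrite !gmulfM tensDl tact_kappa IH1 IH2; grp.
- rewrite !gmulfV tensVl IHu (_ : (kappa u)^-1 = kappa u^-1) ?gmulfV //.
  by rewrite -(gmulfV kappa) tact_kappa; grp.
Qed.

Lemma tens_conjr a g h :
  tens a (g * h * g^-1) = tact a (tens g h) * tens a h * (tens g h)^-1.
Proof.
have -> : tens a (g * h * g^-1) = tact g (tens (g^-1 * a * g) h).
  by rewrite tactE; congr tens; grp.
apply: (mulIg (tens g h)); rewrite -[LHS]tensDl.
have -> : g * (g^-1 * a * g) = a * g by grp.
by rewrite tensDl; grp.
Qed.

Lemma tens_kappar a u : tens a (kappa u) = tact a u * u^-1.
Proof.
elim/tsq_ind: u a => [|g h|u1 u2 IH1 IH2|u IHu] a.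
- by rewrite !gmulf1 tensg1; grp.
- have -> : kappa (tens g h) = (g * h * g^-1) * h^-1 by rewrite kappaE; grp.
  rewrite tensDr tensVr gmulfV -tactM.
  have -> : (g * h * g^-1) * h^-1 = kappa (tens g h) by rewrite kappaE; grp.
  by rewrite tact_kappa tens_conjr; grp.
- by rewrite !gmulfM tensDr tact_kappa IH1 IH2; grp.
- rewrite !gmulfV tensVr IHu (_ : (kappa u)^-1 = kappa u^-1) ?gmulfV //.
  by rewrite -(gmulfV kappa) tact_kappa; grp.
Qed.

End TensorSquare.

Arguments kappa {S}.
Arguments tact : simpl never.
Arguments kappa : simpl never.

(** * A double semidirect product containing the tensor square *)

Section SemidirectModel.
Variable S : groupType.

(** The triple (l, x, y) stands for the product l s_0(x) s_1(y). The factor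
    s_0(S) acts on the tensor square by conjugation, s_1(S) acts trivially
    on it, and the two copies of S are braided by s_1(y) s_0(x) s_1(y)^-1 =
    (x (x) y) s_0(yxy^-1). *)
Definition sdp : Type := (tsq S * S * S)%type.
HB.instance Definition _ := Choice.on sdp.

Definition Sdp (l : tsq S) (x y : S) : sdp := (l, x, y).
Definition sdpl (a : sdp) : tsq S := a.1.1.
Definition sdpx (a : sdp) : S := a.1.2.
Definition sdpy (a : sdp) : S := a.2.

Lemma sdp_ind (P : sdp -> Prop) :
  (forall l x y, P (Sdp l x y)) -> forall a, P a.
Proof. by move=> PS [[l x] y]; apply: PS. Qed.

Definition sdp_one := Sdp 1 1 1.
Definition sdp_mul (a b : sdp) := Sdp
  (sdpl a * tact (sdpx a) (sdpl b * tens (sdpx b) (sdpy a)))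
  (sdpx a * (sdpy a * sdpx b * (sdpy a)^-1)) (sdpy a * sdpy b).
Definition sdp_inv (a : sdp) := Sdp
  (tact (sdpx a)^-1 (sdpl a)^-1 * tens (sdpx a)^-1 (sdpy a)^-1)
  ((sdpy a)^-1 * (sdpx a)^-1 * sdpy a) (sdpy a)^-1.

Lemma sdp_mulE l x y l' x' y' : sdp_mul (Sdp l x y) (Sdp l' x' y') =
  Sdp (l * tact x (l' * tens x' y)) (x * (y * x' * y^-1)) (y * y').
Proof. by []. Qed.

Lemma sdp_invE l x y : sdp_inv (Sdp l x y) =
  Sdp (tact x^-1 l^-1 * tens x^-1 y^-1) (y^-1 * x^-1 * y) y^-1.
Proof. by []. Qed.

Lemma tens_tact_swap (x y : S) (u : tsq S) :
  tens x y * tact (y * x * y^-1) u = tact x u * tens x y.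
Proof.
have -> : tact x u = tact (kappa (tens x y)) (tact (y * x * y^-1) u).
  by rewrite -tactM kappaE; grp.
by rewrite tact_kappa; grp.
Qed.

Lemma tensDr_swap (x y z : S) : tens x (y * z) = tens x z * tens (z * x * z^-1) y.
Proof. by rewrite tens_conjl tensDr; grp. Qed.

Lemma sdp_mulA : associative sdp_mul.
Proof.
elim/sdp_ind=> l x y; elim/sdp_ind=> l' x' y'; elim/sdp_ind=> l'' x'' y''.
rewrite !sdp_mulE; apply/esym; congr Sdp; try by grp.
rewrite tactM -[LHS]mulgA; congr (_ * _); rewrite -gmulfM; congr (tact _ _).
rewrite -[LHS]mulgA -[RHS]mulgA; congr (_ * _).
rewrite tens_tact_swap tensDl mulgA -gmulfM.
by congr (tact _ _ * _); rewrite -mulgA; congr (_ * _); apply: tensDr_swap.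
Qed.

Lemma sdp_mul1 : left_id sdp_one sdp_mul.
Proof.
by elim/sdp_ind=> l x y; rewrite sdp_mulE tensg1 tact1; congr Sdp; grp.
Qed.

Lemma sdp_mulr1 : right_id sdp_one sdp_mul.
Proof.
by elim/sdp_ind=> l x y; rewrite sdp_mulE tens1g !mulg1 gmulf1; congr Sdp; grp.
Qed.

Lemma sdp_mulV : left_inverse sdp_one sdp_inv sdp_mul.
Proof.
elim/sdp_ind=> l x y; rewrite sdp_invE sdp_mulE; congr Sdp; try by grp.
have -> : y^-1 * x^-1 * y = y^-1 * x^-1 * y^-1^-1 by rewrite invgK.
by rewrite -mulgA tens_tact_swap mulgA -gmulfM mulKg tensVl; grp.
Qed.

Lemma sdp_mulrV : right_inverse sdp_one sdp_inv sdp_mul.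
Proof.
elim/sdp_ind=> l x y; rewrite sdp_invE sdp_mulE; congr Sdp; try by grp.
have -> : y^-1 * x^-1 * y = y^-1 * x^-1 * y^-1^-1 by grp.
by rewrite -mulgA -tensDr_swap mulgV tensg1 mulg1 tactKV mulgV.
Qed.

HB.instance Definition _ := isGroup.Build sdp
  sdp_mulA sdp_mul1 sdp_mulr1 sdp_mulV sdp_mulrV.

Lemma sdpM l x y l' x' y' : Sdp l x y * Sdp l' x' y' =
  Sdp (l * tact x (l' * tens x' y)) (x * (y * x' * y^-1)) (y * y').
Proof. by []. Qed.

Definition sdp0 (x : S) : sdp := Sdp 1 x 1.
Definition sdp1 (y : S) : sdp := Sdp 1 1 y.

Lemma sdp0M : {morph sdp0 : x y / x * y}.
Proof.
by move=> x y; rewrite /sdp0 sdpM tensg1 !mulg1 gmulf1; congr Sdp; grp.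
Qed.

Lemma sdp1M : {morph sdp1 : x y / x * y}.
Proof.
by move=> x y; rewrite /sdp1 sdpM tens1g !mulg1 gmulf1; congr Sdp; grp.
Qed.

HB.instance Definition _ := isUMagmaMorphism.Build S sdp sdp0
  (morphM_monoid_morphism sdp0M).
HB.instance Definition _ := isUMagmaMorphism.Build S sdp sdp1
  (morphM_monoid_morphism sdp1M).

Lemma sdp_mulr0 l x y h :
  Sdp l x y * sdp0 h = Sdp (l * tact x (tens h y)) (x * (y * h * y^-1)) y.
Proof. by rewrite sdpM mul1g mulg1. Qed.

Lemma sdp_mulr1h l x y h : Sdp l x y * sdp1 h = Sdp l x (y * h).
Proof. by rewrite sdpM tens1g !mulg1 gmulf1; congr Sdp; grp. Qed.

Lemma sdp10 g h :
  sdp1 h * sdp0 g = Sdp (tens g h) 1 1 * sdp0 (h * g * h^-1) * sdp1 h.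
Proof.
rewrite {1}/sdp1 !sdp_mulr0 sdp_mulr1h tensg1 !tact1.
by congr Sdp; grp.
Qed.

(** The quadruples that occur as the faces d_0, ..., d_3 of a 3-simplex,
    when triples are regarded as 2-simplices with d_2(l, x, y) = y, d_1(l,
    x, y) = xy and d_0(l, x, y) = kappa(l) x. The simplicial identities
    leave a, b, y and the l_i free and determine d_0 up to its component in
    the tensor square, which the first equation prescribes. *)
Definition filler (c0 c1 c2 c3 : sdp) : Prop :=
  exists a b y l1 l2 l3,
    [/\ c0 = Sdp (l1 * tact a l3 * l2^-1)
                 (kappa l2 * a * b * (kappa l3 * b)^-1) (kappa l3 * b),
        c1 = Sdp l1 a (b * y), c2 = Sdp l2 (a * b) y & c3 = Sdp l3 b y].

Lemma filler1 : filler 1 1 1 1.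
Proof.
exists 1, 1, 1, 1, 1, 1; rewrite !gmulf1.
by split; congr Sdp; grp.
Qed.

(** Right multiplication by the three degenerate 3-simplices s_2 s_1 g, s_2
    s_0 h and s_1 s_0 k, which generate the 3-simplices; the faces of these
    are (1, s_1 g, s_1 g, s_1 g), (s_1 h, s_1 h, s_0 h, s_0 h) and (s_0 k,
    s_0 k, s_0 k, 1). *)
Lemma filler_s21 c0 c1 c2 c3 g : filler c0 c1 c2 c3 ->
  filler c0 (c1 * sdp1 g) (c2 * sdp1 g) (c3 * sdp1 g).
Proof.
case=> a [b [y [l1 [l2 [l3 [-> -> -> ->]]]]]].
exists a, b, (y * g), l1, l2, l3.
by split=> //; rewrite sdp_mulr1h // mulgA.
Qed.

Lemma filler_s20 c0 c1 c2 c3 h : filler c0 c1 c2 c3 ->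
  filler (c0 * sdp1 h) (c1 * sdp1 h) (c2 * sdp0 h) (c3 * sdp0 h).
Proof.
case=> a [b [y [l1 [l2 [l3 [-> -> -> ->]]]]]].
exists a, (b * (y * h * y^-1)), y, l1, (l2 * tact (a * b) (tens h y)),
  (l3 * tact b (tens h y)); split.
- rewrite sdp_mulr1h; congr Sdp.
  + by rewrite gmulfM -tactM; grp.
  + by rewrite !gmulfM !kappa_tact kappaE; grp.
  + by rewrite !gmulfM !kappa_tact kappaE; grp.
- by rewrite sdp_mulr1h; congr Sdp; grp.
- by rewrite sdp_mulr0; congr Sdp; grp.
- by rewrite sdp_mulr0; congr Sdp; grp.
Qed.

Lemma filler_s10 c0 c1 c2 c3 k : filler c0 c1 c2 c3 ->
  filler (c0 * sdp0 k) (c1 * sdp0 k) (c2 * sdp0 k) c3.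
Proof.
case=> a [b [y [l1 [l2 [l3 [-> -> -> ->]]]]]].
exists (a * ((b * y) * k * (b * y)^-1)), b, y,
  (l1 * tact a (tens k (b * y))), (l2 * tact (a * b) (tens k y)), l3; split.
- rewrite sdp_mulr0; congr Sdp; last first.
    by rewrite !gmulfM !kappa_tact kappaE; grp.
  rewrite [in LHS]invgM !mulgA.
  (* The tensor entering d_0 involves kappa l3, and is reduced to l3 itself. *)
  have E1 : tens k (kappa l3 * b) = tact k l3 * tens k b * l3^-1.
    by rewrite tensDr tens_kappar tact_kappa; grp.
  have E2 : tact (kappa l3)^-1 (tens k (kappa l3 * b)) =
      l3^-1 * tact k l3 * tens k b.
    by rewrite -(gmulfV kappa) tact_kappa E1; grp.
  have E3 : tens k b * tact b (tens k y) *
      tact ((b * y) * k * (b * y)^-1) l3 * (tact b (tens k y))^-1 =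
      tact k l3 * tens k b.
    rewrite -tens_tact_swap -!mulgA; congr (_ * _).
    rewrite mulgA -tact_kappa -tactM kappa_tact kappaE.
    by congr (tact _ _); grp.
  have -> : kappa l2 * a * b * b^-1 * (kappa l3)^-1 =
      kappa l2 * (a * (kappa l3)^-1) by grp.
  rewrite [tact (kappa l2 * _) _]tactM tact_kappa [tact (a * (kappa l3)^-1) _]tactM E2 tensDr.
  have -> : a * b * y * k * (b * y)^-1 = a * (b * y * k * (b * y)^-1) by grp.
  move: E3; set X := b * y * k * (b * y)^-1 => E3.
  rewrite [tact (a * X) _]tactM [tact (a * b) _]tactM.
  apply: (mulIg l2); rewrite invgM !mulgA !mulgVK -!mulgA; congr (_ * _).
  rewrite -!gmulfV -!gmulfM; congr (tact _ _).
  by rewrite [tact b _^-1]gmulfV mulVKg -E3 !mulgA.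
- by rewrite sdp_mulr0; congr Sdp; grp.
- by rewrite sdp_mulr0; congr Sdp; grp.
- by congr Sdp; grp.
Qed.

(** This is where boundaries become trivial: with three trivial faces all
    parameters are trivial. *)
Lemma filler_inj c0 : filler c0 1 1 1 -> c0 = 1.
Proof.
case=> a [b [y [l1 [l2 [l3 [-> [<- <- _] [<- _ _] [<- <- _]]]]]]].
by rewrite !gmulf1; congr Sdp; grp.
Qed.

End SemidirectModel.

(** * Wreath products *)

Section Wreath.
Variables (S : finGroupType) (Q : groupType).

(** Functions on S with values in Q, extended by S acting by right
    translation of the argument. *)
Definition wreath : Type := ({ffun S -> Q} * S)%type.
HB.instance Definition _ := Choice.on wreath.

Definition Wreath (f : {ffun S -> Q}) (g : S) : wreath := (f, g).
Definition wreath_one := Wreath [ffun=> 1] 1.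
Definition wreath_mul (a b : wreath) :=
  Wreath [ffun k => a.1 k * b.1 (k * a.2)] (a.2 * b.2).
Definition wreath_inv (a : wreath) :=
  Wreath [ffun k => (a.1 (k * a.2^-1))^-1] a.2^-1.

Lemma wreath_mulA : associative wreath_mul.
Proof.
move=> [f g] [f' g'] [f'' g'']; congr (_, _); rewrite /=; last exact: mulgA.
by apply/ffunP=> k; rewrite !ffunE !mulgA.
Qed.

Lemma wreath_mul1 : left_id wreath_one wreath_mul.
Proof.
move=> [f g]; congr (_, _); rewrite /= ?mul1g //.
by apply/ffunP=> k; rewrite !ffunE mul1g mulg1.
Qed.

Lemma wreath_mulr1 : right_id wreath_one wreath_mul.
Proof.
move=> [f g]; congr (_, _); rewrite /= ?mulg1 //.
by apply/ffunP=> k; rewrite !ffunE mulg1.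
Qed.

Lemma wreath_mulV : left_inverse wreath_one wreath_inv wreath_mul.
Proof.
move=> [f g]; congr (_, _); rewrite /= ?mulVg //.
by apply/ffunP=> k; rewrite !ffunE mulVg.
Qed.

Lemma wreath_mulrV : right_inverse wreath_one wreath_inv wreath_mul.
Proof.
move=> [f g]; congr (_, _); rewrite /= ?mulgV //.
by apply/ffunP=> k; rewrite !ffunE mulgK mulgV.
Qed.

HB.instance Definition _ := isGroup.Build wreath
  wreath_mulA wreath_mul1 wreath_mulr1 wreath_mulV wreath_mulrV.

Lemma wreathM1 (a b : wreath) k : (a * b).1 k = a.1 k * b.1 (k * a.2).
Proof. by rewrite ffunE. Qed.

Lemma wreathM2 (a b : wreath) : (a * b).2 = a.2 * b.2.
Proof. by []. Qed.

Lemma wreathV1 (a : wreath) k : (a^-1).1 k = (a.1 (k * a.2^-1))^-1.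
Proof. by rewrite ffunE. Qed.

Lemma wreathV2 (a : wreath) : (a^-1).2 = a.2^-1.
Proof. by []. Qed.

Lemma wreath11 k : (1 : wreath).1 k = 1.
Proof. by rewrite ffunE. Qed.

End Wreath.

(** * From a braiding to the tensor square *)

Section Braiding.
Variables (F Q : groupType) (s0 s1 : F ---> Q) (d0 d1 d2 : Q ---> F).
Hypotheses (d0s0 : forall x, d0 (s0 x) = x) (d0s1 : forall x, d0 (s1 x) = 1).
Hypotheses (d1s0 : forall x, d1 (s0 x) = x) (d1s1 : forall x, d1 (s1 x) = x).
Hypotheses (d2s0 : forall x, d2 (s0 x) = 1) (d2s1 : forall x, d2 (s1 x) = x).

(** The elements on which both d_1 and d_2 vanish: the Moore group in
    dimension 2 of a simplicial group truncated to dimensions 1 and 2. *)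
Definition moore (m : Q) : Prop := d1 m = 1 /\ d2 m = 1.

(** In a simplicial group modulo boundaries, these commutations come from
    commutators of 3-simplices (commute_faces). They make the Moore group a
    braided crossed module over F, the braiding being braid. *)
Hypothesis s1_trivial : forall m b, moore m -> commute m (s1 b).
Hypothesis peiffer : forall l m, moore l -> moore m ->
  commute l (m * (s0 (d0 m))^-1).
Hypothesis hexagon_l : forall m b, moore m ->
  commute (m^-1 * s0 (d0 m)) ((s1 b)^-1 * s0 b).
Hypothesis hexagon_r : forall m a, moore m ->
  commute (m^-1 * s0 (d0 m) * (s1 (d0 m))^-1) (s0 a).

(** The commutator-like element comparing s_1(b) s_0(a) with s_0(bab^-1)
    s_1(b); its face d_0 is the commutator of a and b. *)
Definition braid a b : Q := s1 b * s0 a * (s1 b)^-1 * (s0 (b * a * b^-1))^-1.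

Definition s0act x m : Q := s0 x * m * (s0 x)^-1.

Lemma s0actM x y m : s0act (x * y) m = s0act x (s0act y m).
Proof. by rewrite /s0act gmulfM; grp. Qed.

Lemma s0act1 m : s0act 1 m = m.
Proof. by rewrite /s0act gmulf1; grp. Qed.

Lemma s0act_mul x m m' : s0act x (m * m') = s0act x m * s0act x m'.
Proof. by rewrite /s0act; grp. Qed.

Lemma s0act_inv x m : s0act x m^-1 = (s0act x m)^-1.
Proof. by rewrite /s0act; grp. Qed.

Lemma s0act_id x : s0act x 1 = 1.
Proof. by rewrite /s0act; grp. Qed.

Lemma moore1 : moore 1. Proof. by split; rewrite gmulf1. Qed.

Lemma mooreM m m' : moore m -> moore m' -> moore (m * m').
Proof. by case=> e1 e2 [e1' e2']; split; rewrite gmulfM ?e1 ?e2 ?e1' ?e2' mulg1. Qed.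

Lemma mooreV m : moore m -> moore m^-1.
Proof. by case=> e1 e2; split; rewrite gmulfV ?e1 ?e2 invg1. Qed.

Lemma mooreJ u m : moore m -> moore (u * m * u^-1).
Proof. by case=> e1 e2; split; rewrite !gmulfM gmulfV ?e1 ?e2; grp. Qed.

Lemma moore_s0act x m : moore m -> moore (s0act x m).
Proof. exact: mooreJ. Qed.

Lemma moore_braid a b : moore (braid a b).
Proof.
split; rewrite /braid !(gmulfM, gmulfV) /=; rewrite ?d1s1 ?d1s0 ?d2s1 ?d2s0; grp.
Qed.

Lemma d0_braid a b : d0 (braid a b) = a * b * a^-1 * b^-1.
Proof. rewrite /braid !(gmulfM, gmulfV) /= !d0s1 !d0s0; grp. Qed.

Lemma peifferE m l : moore m -> moore l -> s0act (d0 m) l = m * l * m^-1.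
Proof.
move=> Mm Ml; have := peiffer (moore_s0act (d0 m) Ml) Mm; rewrite /commute /s0act => e.
have : s0 (d0 m) * l * (s0 (d0 m))^-1 * m = m * l.
  by apply: (mulIg (s0 (d0 m))^-1); rewrite -[LHS]mulgA e; grp.
by move <-; rewrite mulgK.
Qed.

(** Every element is a Moore element times degenerate ones, as s_0 and s_1
    split the pair of faces (d_1, d_2). *)
Lemma s0act_decomp u : exists m x y, moore m /\ u = m * s0 x * s1 y.
Proof.
exists (u * (s0 (d1 u * (d2 u)^-1) * s1 (d2 u))^-1).
exists (d1 u * (d2 u)^-1), (d2 u); split; last by grp.
by split; rewrite !(gmulfM, gmulfV) /= ?d1s0 ?d1s1 ?d2s0 ?d2s1; grp.
Qed.

Lemma braidMl a a' b : braid (a * a') b = s0act a (braid a' b) * braid a b.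
Proof.
have -> : s0act a (braid a' b) = s0act (a * b * a^-1 * b^-1) (s0act (b * a * b^-1) (braid a' b)).
  by rewrite -s0actM; congr s0act; grp.
rewrite -d0_braid peifferE; [|exact: moore_braid|exact/moore_s0act/moore_braid].
by rewrite /braid /s0act !(gmulfM, gmulfV) /=; grp.
Qed.

Lemma braidMr_swap a b b' :
  braid a (b * b') = braid a b' * braid (b' * a * b'^-1) b.
Proof.
have -> : braid a b' * braid (b' * a * b'^-1) b =
  s1 b * braid a b' * (s1 b)^-1 * braid (b' * a * b'^-1) b.
  congr (_ * _); have e := s1_trivial b (moore_braid a b').
  by rewrite -e; grp.
by rewrite /braid !(gmulfM, gmulfV) /=; grp.
Qed.

(** The first hexagon hypothesis is used here: writing s_0(d_0 m) = m c,
    conjugation by s_1(b) fixes m and acts on c as s_0(b) does. *)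
Lemma braid_d0l m b : moore m -> braid (d0 m) b = m * (s0act b m)^-1.
Proof.
move=> Mm; rewrite /braid.
have c1 := s1_trivial b Mm; have c2 := hexagon_l b Mm.
have [c ec] : exists c, c = m^-1 * s0 (d0 m) by eexists.
rewrite -ec /commute in c1 c2.
have -> : s0 (d0 m) = m * c by rewrite ec mulVKg.
have -> : s1 b * (m * c) * (s1 b)^-1 = m * (s0 b * c * (s0 b)^-1).
  rewrite mulgA -c1 -!mulgA; congr (_ * _).
  by apply: (mulIg (s0 b)); rewrite -!mulgA c2; grp.
by rewrite /s0act ec !(gmulfM, gmulfV) /=; grp.
Qed.

Lemma braid_conjl a b x : braid (x * a * x^-1) b =
  (braid a x)^-1 * braid a b * s0act b (braid a x).
Proof.
have -> : x * a * x^-1 = d0 (braid a x)^-1 * a.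
  by rewrite gmulfV d0_braid; grp.
have Mt := mooreV (moore_braid a x).
rewrite braidMl peifferE //; last exact: moore_braid.
by rewrite braid_d0l // s0act_inv; grp.
Qed.

Lemma braidMr a b b' : braid a (b * b') = braid a b * s0act b (braid a b').
Proof. by rewrite braidMr_swap braid_conjl; grp. Qed.

Lemma braid_conjr a b x : braid a (x * b * x^-1) =
  braid a x * s0act x (braid a b) * (s0act (x * b * x^-1) (braid a x))^-1.
Proof.
apply: (mulIg (s0act (x * b * x^-1) (braid a x))); rewrite -braidMr.
have -> : x * b * x^-1 * x = x * b by grp.
by rewrite braidMr; grp.
Qed.

Lemma braid_conj x a b :
  braid (x * a * x^-1) (x * b * x^-1) = s0act x (braid a b).
Proof.
rewrite braid_conjl braid_conjr.
by move: (braid a x) (s0act x (braid a b)) (s0act _ (braid a x)) => X Y Z; grp.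
Qed.

(** The second hexagon hypothesis says that d commutes with s_0(F); by the
    Peiffer identity it also commutes with the Moore group, and what remains
    of the braiding is a conjugation by m. *)
Lemma braid_d0r m a : moore m -> braid a (d0 m) = s0act a m * m^-1.
Proof.
move=> Mm; pose d := m^-1 * s0 (d0 m) * (s1 (d0 m))^-1.
have c2 x : commute d (s0 x) by apply: hexagon_r.
have c3 l : moore l -> commute d l.
  move=> Ml; apply/commute_sym/commuteM; last first.
    exact/commuteV/s1_trivial.
  apply: (mulgI m); rewrite /commute !mulgA mulgV mul1g.
  apply: (mulIg (s0 (d0 m))^-1); rewrite mulgK -/(s0act (d0 m) l).
  by rewrite peifferE.
pose w := d0 m * a * (d0 m)^-1.
have -> : braid a (d0 m) = d^-1 * (m^-1 * s0 w * m) * (d * (s0 w)^-1).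
  by rewrite /braid /d /w !(gmulfM, gmulfV) /=; grp.
have -> : d * (s0 w)^-1 = (s0 w)^-1 * d by apply/commuteV.
have -> : d^-1 * (m^-1 * s0 w * m) * ((s0 w)^-1 * d) =
   d^-1 * (m^-1 * s0act w m * d) by rewrite /s0act; grp.
have -> : m^-1 * s0act w m * d = d * (m^-1 * s0act w m).
  by apply/esym/c3/mooreM; [apply: mooreV|apply: moore_s0act].
have em : s0act (d0 m)^-1 m = m.
  by rewrite -gmulfV peifferE; [grp | apply: mooreV | by []].
rewrite mulKg /w !s0actM em peifferE //; last exact: moore_s0act.
by move: (s0act a m) => X; grp.
Qed.

Lemma commute_eps m l : moore m -> moore l -> commute ((s0 (d0 m))^-1 * m) l.
Proof.
move=> Mm Ml; have := peiffer Ml (mooreV Mm); rewrite homV homV invgK => /commuteV.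
by rewrite invgM invgK => /commute_sym.
Qed.

(** The equation in the hypothesis is the vanishing in Q of the boundary of
    a 3-simplex, with the degenerate parts written out. Peiffer commutations
    turn it into the cocycle identity among Moore elements. *)
Lemma cocycle_of_filler k r r1 r2 r3 t t1 t2 t3 :
  moore t -> moore t1 -> moore t2 -> moore t3 ->
  d0 t = r -> d0 t1 = r1 -> d0 t2 = r2 -> d0 t3 = r3 ->
  k * r * k^-1 = r1 * r2 * r3^-1 ->
  let eps (x : F) (u : Q) := (s0 x)^-1 * u in
  eps r1 t1 * (s1 k * s0 r * (s1 k)^-1) * (eps r3 t3)^-1 * eps r2 t2 =
    eps r t * s0 r ->
  s0act k t = t1 * t2 * t3^-1.
Proof.
move=> Mt M1 M2 M3 dt dt1 dt2 dt3 er /=.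
have fix_d0 u : moore u -> s0act (d0 u) u = u by move=> Mu; rewrite peifferE ?mulgK.
have fix_d0V u : moore u -> s0act (d0 u)^-1 u = u.
  by move=> Mu; rewrite -{2}[u](fix_d0 u Mu) -s0actM mulVg s0act1.
have -> : (s0 r)^-1 * t * s0 r = t.
  by rewrite -[RHS](fix_d0V t Mt) dt /s0act gmulfV invgK.
have -> : s1 k * s0 r * (s1 k)^-1 = t * (s0act k t)^-1 * s0 (k * r * k^-1).
  by rewrite -braid_d0l // dt /braid mulgVK.
have c1 := commute_eps M1 Mt; rewrite dt1 /commute in c1.
rewrite !mulgA c1 => e.
have c2 := commute_eps M1 (mooreV (moore_s0act k Mt)); rewrite dt1 /commute in c2.
have {}e : (s0 r1)^-1 * t1 * (s0act k t)^-1 * s0 (k * r * k^-1) *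
   ((s0 r3)^-1 * t3)^-1 * (s0 r2)^-1 * t2 = 1.
  by apply: (mulgI t); rewrite mulg1 -[RHS]e !mulgA.
rewrite c2 er -!mulgA in e; move/mulg1_eq: e; rewrite invgK => ->.
rewrite !gmulfM invgM invgK !mulgA.
have e1 : (s0 r1)^-1 * t1 * s0 r1 = t1.
  by rewrite -[RHS](fix_d0V t1 M1) dt1 /s0act gmulfV invgK.
rewrite e1 gmulfV.
have -> : t1 * s0 r2 * (s0 r3)^-1 * t3^-1 * s0 r3 * (s0 r2)^-1 * t2 =
    t1 * s0act r2 (s0act r3^-1 t3^-1) * t2.
  by rewrite /s0act !gmulfV; grp.
rewrite [s0act r3^-1 _]s0act_inv -dt3 fix_d0V // -dt2 peifferE //; last exact: mooreV.
by grp.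
Qed.

(** From here on F is free on the elements e g with g other than 1, over S
    by q, and the tau(g, h) are the generators of Q that are not degenerate. *)
Variables (S : finGroupType) (q : F ---> S) (e : S -> F) (tau : S -> S -> Q).
Hypotheses (qe : forall g, q (e g) = g) (e1 : e 1 = 1).
Hypothesis F_lift : forall (H : groupType) (f : S -> H), f 1 = 1 ->
  exists psi : F ---> H, forall g, psi (e g) = f g.
Hypothesis F_rind : forall P : F -> Prop, P 1 ->
  (forall g x, P x -> P (x * e g)) -> (forall g x, P x -> P (x * (e g)^-1)) ->
  forall x, P x.
Hypotheses (moore_tau : forall g h, moore (tau g h)).
Hypotheses (d0_tau : forall g h, d0 (tau g h) = e g * e h * (e (g * h))^-1).
Hypotheses (tau1g : forall g, tau 1 g = 1).
Hypothesis tau_cocycle : forall k g h,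
  s0act (e k) (tau g h) = tau k g * tau (k * g) h * (tau k (g * h))^-1.

Inductive tau_span : Q -> Prop :=
| TauSpan1 : tau_span 1
| TauSpanM t t' : tau_span t -> tau_span t' -> tau_span (t * t')
| TauSpanV t : tau_span t -> tau_span t^-1
| TauSpanGen g h : tau_span (tau g h).

Lemma moore_span t : tau_span t -> moore t.
Proof.
elim=> [|? ? _ ? _ ?|? _ ?|g h]; [exact: moore1|exact: mooreM|exact: mooreV|].
exact: moore_tau.
Qed.

(** Conjugation by s_0(e k) preserves the span by the cocycle identity. For
    the inverse of e k, note that it agrees with e(k^-1) up to d_0 of an
    element of the span, whose action is inner by the Peiffer identity. *)
Lemma span_s0act x t : tau_span t -> tau_span (s0act x t).
Proof.
have step g u : tau_span u -> tau_span (s0act (e g) u).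
  elim=> [|a b _ IHa _ IHb|a _ IHa|k h].
  - by rewrite s0act_id; apply: TauSpan1.
  - by rewrite s0act_mul; apply: TauSpanM.
  - by rewrite s0act_inv; apply: TauSpanV.
  - rewrite tau_cocycle; apply: TauSpanM; last exact/TauSpanV/TauSpanGen.
    by apply: TauSpanM; apply: TauSpanGen.
elim/F_rind: x t => [|g x IHx|g x IHx] t Tt; first by rewrite s0act1.
  by rewrite s0actM; apply/IHx/step.
rewrite s0actM; apply: IHx.
have -> : (e g)^-1 = d0 (tau g^-1 g)^-1 * e g^-1.
  by rewrite gmulfV d0_tau mulVg e1; grp.
rewrite s0actM peifferE; [|exact/mooreV/moore_tau|exact/moore_span/step].
by apply: TauSpanM; [apply: TauSpanM|]; rewrite ?invgK;
   [apply/TauSpanV/TauSpanGen|apply: step|apply: TauSpanGen].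
Qed.

Lemma span_conj u t : tau_span t -> tau_span (u * t * u^-1).
Proof.
move=> Tt; have [m [x [y [Mm ->]]]] := s0act_decomp u.
have Mt := moore_span Tt.
have -> : m * s0 x * s1 y * t * (m * s0 x * s1 y)^-1 = s0act (d0 m) (s0act x t).
  rewrite peifferE //; last exact: moore_s0act.
  have ey := s1_trivial y Mt; rewrite /commute in ey.
  by rewrite -[_ * s1 y * t]mulgA -ey /s0act; grp.
by do 2! apply: span_s0act.
Qed.

(** Since the elements e g e h e(gh)^-1 are values of d_0 on the span, every
    element of F can be collected into such a value times a single e g. *)
Lemma span_section w : exists2 t, tau_span t & w = d0 t * e (q w).
Proof.
elim/F_rind: w => [|g w [t Tt ew]|g w [t Tt ew]].
- by exists 1; [apply: TauSpan1 | rewrite !gmulf1 e1 mulg1].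
- exists (t * tau (q w) g); first by apply: TauSpanM => //; apply: TauSpanGen.
  by rewrite !gmulfM d0_tau qe {1}ew; grp.
- exists (t * (tau (q w * g^-1) g)^-1).
    by apply: TauSpanM => //; apply/TauSpanV/TauSpanGen.
  rewrite !gmulfM !gmulfV d0_tau qe {1}ew.
  by rewrite mulgVK; grp.
Qed.

Lemma span_kernel w : q w = 1 -> exists2 t, tau_span t & w = d0 t.
Proof.
by have [t Tt ew] := span_section w => qw; exists t; rewrite // ew qw e1 mulg1.
Qed.

(** The kernel of F -> S is free on the nontrivial elements e g e h
    e(gh)^-1, so a homomorphism from it sending them to tau(g, h) must
    exist. The morphism into the wreath product sending e k to (j |-> tau(j,
    k), k) provides it (this is the Reidemeister-Schreier rewriting
    process); its first component at 1 recovers t from d_0 t. *)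
Lemma span_inj t : tau_span t -> d0 t = 1 -> t = 1.
Proof.
(* The function j |-> tau j k is the Schreier cocycle of the transversal e. *)
pose f k : wreath S Q := Wreath [ffun j => tau j k] k.
have tauk1 k : tau k 1 = 1.
  have := tau_cocycle k 1 1; rewrite !mulg1 mulgK tau1g s0act_id => <- //.
have [|psi psiE] := @F_lift (wreath S Q) f.
  by congr (_, _); apply/ffunP=> k; rewrite !ffunE.
have psi2 w : (psi w).2 = q w.
  elim/F_rind: w => [|g w IHw|g w IHw]; first by rewrite !gmulf1.
  - by rewrite !gmulfM wreathM2 psiE IHw qe.
  - by rewrite !gmulfM !gmulfV wreathM2 wreathV2 psiE IHw qe.
suff key u : tau_span u -> q (d0 u) = 1 /\ (psi (d0 u)).1 1 = u.
  by move=> Tt dt; case: (key t Tt) => _; rewrite dt gmulf1 wreath11.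
elim=> [|a b _ [qa IHa] _ [qb IHb]|a _ [qa IHa]|g h].
- by rewrite !gmulf1 wreath11.
- rewrite !gmulfM wreathM1 /= psi2 IHa mul1g qa qb IHb; grp.
- by rewrite !gmulfV wreathV1 psi2 qa; split; grp; rewrite ?IHa; grp.
- rewrite d0_tau !(gmulfM, gmulfV) !qe; split; first by grp.
  rewrite !wreathM1 wreathV1 !wreathM2 !psiE /= !ffunE.
  by rewrite !mul1g !mulgV tau1g; grp; rewrite !tau1g; grp.
Qed.

Definition tau_normal : normal_subgroup Q := NormalSubgroup
  TauSpan1 TauSpanM TauSpanV (fun t u => @span_conj u t).

Notation Qt := (quo tau_normal).
Notation pit := (quo_pi tau_normal : Q ---> Qt).

Lemma pit_eq1 x : pit x = 1 <-> tau_span x.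
Proof. exact: quo_pi_eq1. Qed.

Lemma pit_s0act_d0 t m : tau_span t -> moore m -> pit (s0act (d0 t) m) = pit m.
Proof.
move=> Tt Mm; rewrite peifferE //; last exact: moore_span.
by rewrite !gmulfM gmulfV /= (pit_eq1 t).2 //; grp.
Qed.

(** Changing a by d_0 of an element of the span changes the braiding by an
    element of the span, and q has no other kernel (span_kernel). *)
Lemma pit_braid a a' b b' : q a = q a' -> q b = q b' ->
  pit (braid a b) = pit (braid a' b').
Proof.
move=> qa qb.
have redl c : pit (braid a c) = pit (braid a' c).
  have [t Tt et] : exists2 t, tau_span t & a * a'^-1 = d0 t.
    by apply: span_kernel; rewrite gmulfM gmulfV qa mulgV.
  have -> : a = d0 t * a' by rewrite -et mulgVK.
  rewrite braidMl gmulfM pit_s0act_d0 //; last exact: moore_braid.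
  rewrite braid_d0l; last exact: moore_span.
  rewrite [X in _ * X](_ : _ = 1) ?mulg1 //; apply/pit_eq1.
  by apply: TauSpanM => //; apply/TauSpanV/span_s0act.
rewrite redl.
have [t Tt et] : exists2 t, tau_span t & b * b'^-1 = d0 t.
  by apply: span_kernel; rewrite gmulfM gmulfV qb mulgV.
have -> : b = d0 t * b' by rewrite -et mulgVK.
rewrite braidMr gmulfM pit_s0act_d0 //; last exact: moore_braid.
rewrite braid_d0r; last exact: moore_span.
rewrite [X in X * _](_ : _ = 1) ?mul1g //; apply/pit_eq1.
by apply: TauSpanM; [apply: span_s0act|apply: TauSpanV].
Qed.

Lemma Theta_crossed :
  crossed_pairing (fun g h : S => pit (braid (e g) (e h))).
Proof.
split=> [g g' h|g h h'].
- have -> : pit (braid (e (g * g')) (e h)) = pit (braid (e g * e g') (e h)).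
    by apply: pit_braid; rewrite // gmulfM !qe.
  rewrite braidMl gmulfM -braid_conj; congr (_ * _).
  by apply: pit_braid; rewrite !gmulfM !gmulfV !qe.
- have -> : pit (braid (e g) (e (h * h'))) = pit (braid (e g) (e h * e h')).
    by apply: pit_braid; rewrite // gmulfM !qe.
  rewrite braidMr gmulfM -braid_conj; congr (_ * _).
  by apply: pit_braid; rewrite !gmulfM !gmulfV !qe.
Qed.

Definition Theta : tsq S ---> Qt := tsq_lift Theta_crossed.

Lemma ThetaE g h : Theta (tens g h) = pit (braid (e g) (e h)).
Proof. exact: tsq_liftE. Qed.

Hypothesis Q_rind : forall P : Q -> Prop, P 1 ->
  (forall x u, P u -> P (u * s0 x)) -> (forall x u, P u -> P (u * s1 x)) ->
  (forall g h u, P u -> P (u * tau g h)) ->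
  (forall g h u, P u -> P (u * (tau g h)^-1)) -> forall u, P u.

(** Q is generated by s_0(F), s_1(F) and the tau(g, h). Multiplying a
    product m s_0(x) s_1(y) by s_0(a) adds a braiding to the Moore part, and
    multiplying it by tau(g, h) does not change that part modulo the span. *)
Lemma Theta_decomp u : exists m x y t,
  [/\ moore m, pit m = Theta t & u = m * s0 x * s1 y].
Proof.
have tau_step m x y t v : moore m -> pit m = Theta t -> tau_span v ->
    exists m' x' y' t', [/\ moore m', pit m' = Theta t' &
      m * s0 x * s1 y * v = m' * s0 x' * s1 y'].
  move=> Mm mt Tv; exists (m * s0act x v), x, y, t; split.
  - by apply: mooreM => //; apply/moore_s0act/moore_span.
  - by rewrite gmulfM (pit_eq1 (s0act x v)).2 ?mulg1 //; apply: span_s0act.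
  - have ev := s1_trivial y (moore_span Tv); rewrite /commute in ev.
    by rewrite -[LHS]mulgA -ev /s0act; grp.
elim/Q_rind: u => [|a u IHu|b u IHu|g h u IHu|g h u IHu].
- by exists 1, 1, 1, 1; split; rewrite ?gmulf1 ?mulg1 //; apply: moore1.
- case: IHu => m [x [y [t [Mm mt ->]]]].
  exists (m * s0act x (braid a y)), (x * (y * a * y^-1)), y.
  exists (t * tens (q (x * a * x^-1)) (q (x * y * x^-1))); split.
  + by apply: mooreM => //; apply/moore_s0act/moore_braid.
  + rewrite gmulfM mt -braid_conj [RHS]gmulfM ThetaE; congr (_ * _).
    by apply: pit_braid; rewrite qe !gmulfM.
  + by rewrite /s0act /braid !(gmulfM, gmulfV); grp.
- case: IHu => m [x [y [t [Mm mt ->]]]].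
  by exists m, x, (y * b), t; split=> //; rewrite gmulfM mulgA.
- case: IHu => m [x [y [t [Mm mt ->]]]].
  by apply: (tau_step _ _ _ t) => //; apply: TauSpanGen.
- case: IHu => m [x [y [t [Mm mt ->]]]].
  by apply: (tau_step _ _ _ t) => //; apply/TauSpanV/TauSpanGen.
Qed.

Lemma Theta_moore u : moore u -> exists t, pit u = Theta t.
Proof.
have [m [x [y [t [[m1 m2] mt ->]]]]] := Theta_decomp u.
case; rewrite !gmulfM m1 m2 !mul1g d1s0 d1s1 d2s0 d2s1 mul1g => xy y1.
have x1 : x = 1 by rewrite -xy y1 mulg1.
by exists t; rewrite x1 y1 !gmulf1 !mulg1.
Qed.

Variable phi : Q ---> sdp S.
Hypotheses (phi_s0 : forall g, phi (s0 (e g)) = sdp0 g).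
Hypotheses (phi_s1 : forall g, phi (s1 (e g)) = sdp1 g).
Hypothesis phi_tau : forall g h, phi (tau g h) = 1.

Lemma phi_s0q x : phi (s0 x) = sdp0 (q x).
Proof.
elim/F_rind: x => [|g x IHx|g x IHx]; first by rewrite !gmulf1.
- by rewrite !gmulfM IHx phi_s0 qe.
- by rewrite !gmulfM !gmulfV IHx phi_s0 qe.
Qed.

Lemma phi_s1q x : phi (s1 x) = sdp1 (q x).
Proof.
elim/F_rind: x => [|g x IHx|g x IHx]; first by rewrite !gmulf1.
- by rewrite !gmulfM IHx phi_s1 qe.
- by rewrite !gmulfM !gmulfV IHx phi_s1 qe.
Qed.

Lemma phi_span t : tau_span t -> phi t = 1.
Proof.
elim=> [|? ? _ e2 _ e3|? _ e2|g h]; rewrite ?gmulf1 ?gmulfM ?gmulfV ?phi_tau //.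
  by rewrite e2 e3 mulg1.
by rewrite e2 invg1.
Qed.

Lemma phi_braid a b : phi (braid a b) = Sdp (tens (q a) (q b)) 1 1.
Proof.
have -> : phi (braid a b) = sdp1 (q b) * sdp0 (q a) * (sdp1 (q b))^-1 *
    (sdp0 (q b * q a * (q b)^-1))^-1.
  have -> : q b * q a * (q b)^-1 = q (b * a * b^-1) by rewrite !gmulfM gmulfV.
  by rewrite /braid !(homM phi) !(homV phi) !phi_s0q !phi_s1q.
by rewrite sdp10; move: (Sdp _ _ _) (sdp0 _) (sdp1 _) => A B C; grp.
Qed.

Definition sdp_of_tsq (t : tsq S) : sdp S := Sdp t 1 1.

Lemma sdp_of_tsqM : {morph sdp_of_tsq : x y / x * y}.
Proof. by move=> x y; rewrite /sdp_of_tsq sdpM tensg1 mulg1 tact1; congr Sdp; grp. Qed.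

HB.instance Definition _ := isUMagmaMorphism.Build (tsq S) (sdp S) sdp_of_tsq
  (morphM_monoid_morphism sdp_of_tsqM).

(** phi kills the span, and on tensors phi o Theta is the inclusion of the
    tensor square. *)
Lemma phi_Theta u t : pit u = Theta t -> phi u = Sdp t 1 1.
Proof.
pose phit := quo_lift (N := tau_normal) (f := phi) phi_span.
have phitE : (phit \o Theta : tsq S ---> sdp S) =1 sdp_of_tsq.
  by apply: tsq_ext => g h /=; rewrite ThetaE quo_liftE phi_braid !qe.
by move=> ut; have := phitE t; rewrite /= -ut quo_liftE.
Qed.

Lemma phi_inj u : moore u -> d0 u = 1 -> phi u = 1 -> u = 1.
Proof.
move=> Mu du pu; apply: span_inj => //; apply/pit_eq1.
have [t ut] := Theta_moore Mu; rewrite ut.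
by move: (phi_Theta ut); rewrite pu => -[<-]; rewrite gmulf1.
Qed.

Lemma phi_moore u : moore u -> exists2 t, phi u = Sdp t 1 1 & kappa t = q (d0 u).
Proof.
move=> Mu; have [t ut] := Theta_moore Mu; exists t; first exact: phi_Theta.
have: exists2 m, moore m /\ pit m = Theta t & q (d0 m) = kappa t.
  elim/tsq_ind: (t) => [|g h|a b [x [Mx xa] qx] [y [My yb] qy]|a [x [Mx xa] qx]].
  - by exists 1; rewrite !gmulf1; split=> //; apply: moore1.
  - exists (braid (e g) (e h)).
      by rewrite ThetaE; split=> //; apply: moore_braid.
    by rewrite d0_braid kappaE !gmulfM !gmulfV !qe.
  - exists (x * y); first by rewrite !gmulfM xa yb; split=> //; apply: mooreM.
    by rewrite !gmulfM qx qy.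
  - exists x^-1; first by rewrite !gmulfV xa; split=> //; apply: mooreV.
    by rewrite !gmulfV qx.
case=> m [Mm mt] <-; have := pit_eq1 (u * m^-1).
rewrite gmulfM gmulfV ut mt mulgV => -[/(_ erefl) Tum _].
have -> : q (d0 u) = q (d0 (u * m^-1)) * q (d0 m).
  by rewrite -!gmulfM mulgVK.
suff -> : q (d0 (u * m^-1)) = 1 by rewrite mul1g.
elim: Tum => [|? ? _ e2 _ e3|? _ e2|g h]; rewrite ?gmulf1 ?gmulfM ?gmulfV //.
- by rewrite e2 e3 mulg1.
- by rewrite e2 invg1.
- by rewrite d0_tau !gmulfM gmulfV !qe mulgV.
Qed.

(** A Moore element over t is corrected by an element of the span so that
    its d_0, which lies in the kernel of q, becomes trivial. *)
Lemma phi_surj t : kappa t = 1 ->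
  exists2 u, moore u /\ d0 u = 1 & phi u = Sdp t 1 1.
Proof.
move=> kt.
have [m Mm pm] : exists2 m, moore m & phi m = Sdp t 1 1.
  elim/tsq_ind: {kt}t => [|g h|a b [x Mx xa] [y My yb]|a [x Mx xa]].
  - by exists 1; rewrite ?gmulf1 //; apply: moore1.
  - by exists (braid (e g) (e h)); rewrite ?phi_braid ?qe //; apply: moore_braid.
  - exists (x * y); first exact: mooreM.
    by rewrite !gmulfM xa yb -/(sdp_of_tsq _) -gmulfM.
  - exists x^-1; first exact: mooreV.
    by rewrite gmulfV xa -/(sdp_of_tsq _) -gmulfV.
have [t' pt' kt'] := phi_moore Mm.
have tt : t' = t by move: pt'; rewrite pm => -[].
have [v Tv ev] : exists2 v, tau_span v & d0 m = d0 v.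
  by apply: span_kernel; rewrite -kt' tt.
exists (m * v^-1); last by rewrite gmulfM gmulfV pm (phi_span Tv) invg1 mulg1.
split; first by apply: mooreM => //; apply/mooreV/moore_span.
by rewrite gmulfM gmulfV ev mulgV.
Qed.

Theorem phi_classifies :
  [/\ forall u, moore u -> d0 u = 1 ->
        exists2 t, phi u = Sdp t 1 1 & kappa t = 1,
      forall u, moore u -> d0 u = 1 -> phi u = 1 -> u = 1 &
      forall t, kappa t = 1 ->
        exists2 u, moore u /\ d0 u = 1 & phi u = Sdp t 1 1].
Proof.
split=> [u Mu du||]; [|exact: phi_inj|exact: phi_surj].
by have [t pt kt] := phi_moore Mu; exists t; rewrite // kt du gmulf1.
Qed.

End Braiding.

(** * The second homotopy group of Milnor's construction *)

Section SimplicialGroup.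
Variables F1 F2 F3 : groupType.
Variables (d20 d21 d22 : F2 ---> F1) (d30 d31 d32 d33 : F3 ---> F2).
Variables (s10 s11 : F1 ---> F2) (s20 s21 s22 : F2 ---> F3).
Hypotheses (d20s10 : forall u, d20 (s10 u) = u) (d20s11 : forall u, d20 (s11 u) = 1).
Hypotheses (d21s10 : forall u, d21 (s10 u) = u) (d21s11 : forall u, d21 (s11 u) = u).
Hypotheses (d22s10 : forall u, d22 (s10 u) = 1) (d22s11 : forall u, d22 (s11 u) = u).
Hypotheses (d30s20 : forall u, d30 (s20 u) = u) (d31s20 : forall u, d31 (s20 u) = u).
Hypotheses (d32s20 : forall u, d32 (s20 u) = s10 (d21 u)).
Hypotheses (d33s20 : forall u, d33 (s20 u) = s10 (d22 u)).
Hypotheses (d30s21 : forall u, d30 (s21 u) = s10 (d20 u)).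
Hypotheses (d31s21 : forall u, d31 (s21 u) = u) (d32s21 : forall u, d32 (s21 u) = u).
Hypotheses (d33s21 : forall u, d33 (s21 u) = s11 (d22 u)).
Hypotheses (d30s22 : forall u, d30 (s22 u) = s11 (d20 u)).
Hypotheses (d31s22 : forall u, d31 (s22 u) = s11 (d21 u)).
Hypotheses (d32s22 : forall u, d32 (s22 u) = u) (d33s22 : forall u, d33 (s22 u) = u).
Hypotheses (d20d30 : forall u, d20 (d30 u) = d20 (d31 u)).
Hypotheses (d21d30 : forall u, d21 (d30 u) = d20 (d32 u)).
Hypotheses (d22d30 : forall u, d22 (d30 u) = d20 (d33 u)).

Let simplE := (d20s10, d21s10, d22s10, (d20s11, d21s11, d22s11),
  (d30s20, d31s20, d32s20, d33s20), (d30s21, d31s21, d32s21, d33s21),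
  (d30s22, d31s22, d32s22, d33s22)).

Definition boundary2 (u : F2) : Prop :=
  exists2 v : F3, [/\ d31 v = 1, d32 v = 1 & d33 v = 1] & u = d30 v.

Definition cycle2 (u : F2) : Prop := [/\ d20 u = 1, d21 u = 1 & d22 u = 1].

Lemma boundary2_cycle u : boundary2 u -> cycle2 u.
Proof.
case=> v [v1 v2 v3 ->].
by split; [rewrite d20d30 v1|rewrite d21d30 v2|rewrite d22d30 v3]; rewrite gmulf1.
Qed.

Lemma boundary2_1 : boundary2 1.
Proof. by exists 1; rewrite ?gmulf1. Qed.

Lemma boundary2M u v : boundary2 u -> boundary2 v -> boundary2 (u * v).
Proof.
case=> a [a1 a2 a3] -> [b [b1 b2 b3] ->]; exists (a * b); last by rewrite homM.
by split; rewrite homM ?a1 ?a2 ?a3 ?b1 ?b2 ?b3 mulg1.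
Qed.

Lemma boundary2V u : boundary2 u -> boundary2 u^-1.
Proof.
case=> a [a1 a2 a3] ->; exists a^-1; last by rewrite homV.
by split; rewrite homV ?a1 ?a2 ?a3 invg1.
Qed.

Lemma boundary2J u v : boundary2 u -> boundary2 (v * u * v^-1).
Proof.
case=> a [a1 a2 a3] ->; exists (s20 v * a * (s20 v)^-1).
  by split; rewrite !homM homV ?a1 ?a2 ?a3 mulg1 mulgV.
by rewrite !homM homV d30s20.
Qed.

Definition boundaries2 : normal_subgroup F2 := NormalSubgroup
  boundary2_1 boundary2M boundary2V boundary2J.

Definition Q2 : groupType := quo boundaries2.
Definition piQ : F2 ---> Q2 := quo_pi boundaries2.

Lemma piQ_eq1 u : piQ u = 1 <-> boundary2 u.
Proof. exact: quo_pi_eq1. Qed.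

Lemma d20_boundary u : boundary2 u -> d20 u = 1.
Proof. by case/boundary2_cycle. Qed.
Lemma d21_boundary u : boundary2 u -> d21 u = 1.
Proof. by case/boundary2_cycle. Qed.
Lemma d22_boundary u : boundary2 u -> d22 u = 1.
Proof. by case/boundary2_cycle. Qed.

Definition dQ0 : Q2 ---> F1 := quo_lift (N := boundaries2) d20_boundary.
Definition dQ1 : Q2 ---> F1 := quo_lift (N := boundaries2) d21_boundary.
Definition dQ2 : Q2 ---> F1 := quo_lift (N := boundaries2) d22_boundary.
Lemma dQ0E u : dQ0 (piQ u) = d20 u. Proof. exact: quo_liftE. Qed.
Lemma dQ1E u : dQ1 (piQ u) = d21 u. Proof. exact: quo_liftE. Qed.
Lemma dQ2E u : dQ2 (piQ u) = d22 u. Proof. exact: quo_liftE. Qed.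
Definition sQ0 : F1 ---> Q2 := piQ \o s10.
Definition sQ1 : F1 ---> Q2 := piQ \o s11.

Lemma dQ0s0 x : dQ0 (sQ0 x) = x. Proof. by rewrite dQ0E simplE. Qed.
Lemma dQ1s0 x : dQ1 (sQ0 x) = x. Proof. by rewrite dQ1E simplE. Qed.
Lemma dQ2s0 x : dQ2 (sQ0 x) = 1. Proof. by rewrite dQ2E simplE. Qed.
Lemma dQ0s1 x : dQ0 (sQ1 x) = 1. Proof. by rewrite dQ0E simplE. Qed.
Lemma dQ1s1 x : dQ1 (sQ1 x) = x. Proof. by rewrite dQ1E simplE. Qed.
Lemma dQ2s1 x : dQ2 (sQ1 x) = x. Proof. by rewrite dQ2E simplE. Qed.

Lemma moore_lift m : moore dQ1 dQ2 m ->
  exists2 u, d21 u = 1 /\ d22 u = 1 & m = piQ u.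
Proof.
elim/quo_ind: m => u [u1 u2]; exists u => //.
by rewrite -dQ1E -dQ2E.
Qed.

(** The commutator of two 3-simplices, one of which is trivial on each of
    the faces d_1, d_2 and d_3, has the commutator of their faces d_0 as
    boundary. The four relations below arise from products of degenerate
    elements chosen to have complementary trivial faces. *)
Lemma commute_faces (a b : F3) :
  d31 a = 1 \/ d31 b = 1 -> d32 a = 1 \/ d32 b = 1 -> d33 a = 1 \/ d33 b = 1 ->
  commute (piQ (d30 a)) (piQ (d30 b)).
Proof.
have comm1 (f : F3 ---> F2) : f a = 1 \/ f b = 1 -> f (a * b * a^-1 * b^-1) = 1.
  by rewrite !homM !homV => -[] ->; grp.
move=> c1 c2 c3; apply/divg1_eq; rewrite invgM mulgA -!homV -!homM.
apply/piQ_eq1; exists (a * b * a^-1 * b^-1); last by rewrite !homM !homV.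
by split; apply: comm1.
Qed.

Lemma Q_s1_trivial m b : moore dQ1 dQ2 m -> commute m (sQ1 b).
Proof.
case/moore_lift=> u [u1 u2] ->.
have := @commute_faces (s20 u) (s22 (s10 b) * (s22 (s11 b))^-1).
rewrite !homM !homV !simplE u1 u2 !gmulf1 mulgV invg1 mulg1.
by apply; auto.
Qed.

Lemma Q_peiffer l m : moore dQ1 dQ2 l -> moore dQ1 dQ2 m ->
  commute l (m * (sQ0 (dQ0 m))^-1).
Proof.
case/moore_lift=> u [u1 u2] ->; case/moore_lift=> v [v1 v2] ->.
have := @commute_faces (s20 u) (s20 v * (s21 v)^-1).
rewrite dQ0E !homM !homV !simplE u1 u2 !gmulf1 mulgV.
by apply; auto.
Qed.

Lemma Q_hexagon_l m b : moore dQ1 dQ2 m ->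
  commute (m^-1 * sQ0 (dQ0 m)) ((sQ1 b)^-1 * sQ0 b).
Proof.
case/moore_lift=> u [u1 u2] ->.
have := @commute_faces ((s20 u)^-1 * s21 u) ((s22 (s10 b))^-1 * s21 (s10 b)).
rewrite dQ0E !homM !homV !simplE u1 u2 !gmulf1 !mulVg invg1 mulg1.
by apply; auto.
Qed.

Lemma Q_hexagon_r m a : moore dQ1 dQ2 m ->
  commute (m^-1 * sQ0 (dQ0 m) * (sQ1 (dQ0 m))^-1) (sQ0 a).
Proof.
case/moore_lift=> u [u1 u2] ->.
have := @commute_faces ((s20 u)^-1 * s21 u * (s22 u)^-1) (s21 (s10 a)).
rewrite dQ0E !homM !homV !simplE u1 u2 !gmulf1 !mulVg invg1 !mul1g mulgV.
by apply; auto.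
Qed.

Variable S : finGroupType.
Variables (e1 : S -> F1) (e2 : S -> S -> F2) (e3 : S -> S -> S -> F3).
Hypotheses (e11 : e1 1 = 1).
Hypotheses (d20e : forall g h, d20 (e2 g h) = e1 h)
  (d21e : forall g h, d21 (e2 g h) = e1 (g * h))
  (d22e : forall g h, d22 (e2 g h) = e1 g).
Hypotheses (d30e : forall g h k, d30 (e3 g h k) = e2 h k)
  (d31e : forall g h k, d31 (e3 g h k) = e2 (g * h) k)
  (d32e : forall g h k, d32 (e3 g h k) = e2 g (h * k))
  (d33e : forall g h k, d33 (e3 g h k) = e2 g h).
Hypotheses (s10e : forall g, s10 (e1 g) = e2 1 g)
  (s11e : forall g, s11 (e1 g) = e2 g 1).
Hypothesis F1_lift : forall (H : groupType) (f : S -> H), f 1 = 1 ->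
  exists psi : F1 ---> H, forall g, psi (e1 g) = f g.
Hypothesis F2_lift : forall (H : groupType) (f : S -> S -> H), f 1 1 = 1 ->
  exists psi : F2 ---> H, forall g h, psi (e2 g h) = f g h.
Hypothesis F1_rind : forall P : F1 -> Prop, P 1 ->
  (forall g x, P x -> P (x * e1 g)) -> (forall g x, P x -> P (x * (e1 g)^-1)) ->
  forall x, P x.
Hypothesis F2_rind : forall P : F2 -> Prop, P 1 ->
  (forall g h x, P x -> P (x * e2 g h)) ->
  (forall g h x, P x -> P (x * (e2 g h)^-1)) -> forall x, P x.
Hypothesis F3_rind : forall P : F3 -> Prop, P 1 ->
  (forall g h k x, P x -> P (x * e3 g h k)) ->
  (forall g h k x, P x -> P (x * (e3 g h k)^-1)) -> forall x, P x.

(** The free generators of the kernel of F_1 -> S. *)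
Definition rho g h : F1 := e1 g * e1 h * (e1 (g * h))^-1.
(** The generator e_2(g, h) normalised by degenerate elements so that d_0
    and d_2 vanish; tau2 moves it into the Moore group, over rho. *)
Definition eps g h : F2 := e2 g h * (s10 (e1 h))^-1 * (s11 (e1 g))^-1.
Definition tau2 g h : F2 := s10 (rho g h) * eps g h.
Definition tauQ g h : Q2 := piQ (tau2 g h).

Lemma d20_eps g h : d20 (eps g h) = 1.
Proof. by rewrite /eps !homM !homV !simplE d20e; grp. Qed.

Lemma d21_eps g h : d21 (eps g h) = (rho g h)^-1.
Proof. by rewrite /eps /rho !homM !homV !simplE d21e; grp. Qed.

Lemma d22_eps g h : d22 (eps g h) = 1.
Proof. by rewrite /eps !homM !homV !simplE d22e; grp. Qed.

Lemma moore_tauQ g h : moore dQ1 dQ2 (tauQ g h).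
Proof.
by split; rewrite ?dQ1E ?dQ2E /tau2 homM simplE ?d21_eps ?d22_eps; grp.
Qed.

Lemma dQ0_tauQ g h : dQ0 (tauQ g h) = rho g h.
Proof. by rewrite dQ0E /tau2 homM simplE d20_eps; grp. Qed.

Lemma tauQ1 g : tauQ 1 g = 1.
Proof.
rewrite /tauQ /tau2 /rho /eps s10e e11 !mul1g !mulgV.
by rewrite !gmulf1 mul1g invg1 mulg1 gmulf1.
Qed.

Lemma rho_cocycle k g h : e1 k * rho g h * (e1 k)^-1 =
  rho k g * rho (k * g) h * (rho k (g * h))^-1.
Proof. by rewrite /rho; grp. Qed.

(** The 3-simplex e_3(k, g, h), multiplied by degenerate elements that make
    the faces d_1, d_2 and d_3 trivial, has a boundary that expresses eps(g,
    h) through the other normalised generators (key). *)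
Lemma tauQ_cocycle k g h : s0act sQ0 (e1 k) (tauQ g h) =
  tauQ k g * tauQ (k * g) h * (tauQ k (g * h))^-1.
Proof.
have [z zdef] : exists z, z = (eps (k * g) h)^-1 * eps k (g * h) *
  (s11 (e1 k) * (s10 (rho g h))^-1 * (s11 (e1 k))^-1) * (eps k g)^-1 by eexists.
have [z0 [z1 z2]] : d20 z = (rho g h)^-1 /\ (d21 z = 1 /\ d22 z = 1).
  rewrite zdef !(d20_eps, d21_eps, d22_eps, simplE, homM, homV).
  by split; [grp|split; [rewrite /rho|]; grp].
(* The degenerate counterpart of e3 k g h: dividing by it turns the faces of
   e3 k g h into normalised generators eps, up to elements of s_0 F_1. *)
pose D := s22 (s11 (e1 k)) * s22 (s10 (e1 g)) * s21 (s10 (e1 h)).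
pose w := (s21 (eps (k * g) h))^-1 * e3 k g h * D^-1 * (s22 (eps k g))^-1 *
  ((s20 z)^-1 * s21 z)^-1.
have w0 : d30 w = eps g h * (z^-1 * (s10 (rho g h))^-1)^-1.
  rewrite /w /D !(d30e, d20_eps, z0, simplE, gmulf1, homM, homV).
  by rewrite /eps; grp.
have key : piQ (eps g h) = piQ (z^-1 * (s10 (rho g h))^-1).
  apply/divg1_eq; rewrite -homV -homM -w0; apply/piQ_eq1; exists w => //.
  split; rewrite /w /D !(d31e, d32e, d33e, d20_eps, d21_eps, d22_eps, z1, z2,
    simplE, gmulf1, homM, homV).
  - by rewrite /eps; grp.
  - by rewrite zdef /rho /eps !homM !homV; grp.
  - by rewrite /eps; grp.
apply: (@cocycle_of_filler _ _ sQ0 sQ1 dQ0 dQ1 dQ2) => //;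
  try exact: moore_tauQ; rewrite ?dQ0_tauQ.
- exact: Q_s1_trivial.
- exact: Q_peiffer.
- exact: Q_hexagon_l.
- exact: rho_cocycle.
have epsE a b : (sQ0 (rho a b))^-1 * tauQ a b = piQ (eps a b).
  by rewrite /tauQ /tau2 homM; apply: mulKg.
rewrite !epsE key; have -> : sQ1 (e1 k) = piQ (s11 (e1 k)) by [].
have -> : sQ0 (rho g h) = piQ (s10 (rho g h)) by [].
rewrite -!(homV piQ) -!(homM piQ) zdef; congr (piQ _).
by move: (eps _ _) (eps _ _) (eps _ _) (s10 _) (s11 _) => A B C E H; grp.
Qed.

(** Up to degenerate elements, e_2(g, h) is tau(g, h). *)
Lemma Q2_rind (P : Q2 -> Prop) : P 1 ->
  (forall x u, P u -> P (u * sQ0 x)) -> (forall x u, P u -> P (u * sQ1 x)) ->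
  (forall g h u, P u -> P (u * tauQ g h)) ->
  (forall g h u, P u -> P (u * (tauQ g h)^-1)) -> forall u, P u.
Proof.
move=> P1 P_s0 P_s1 P_tau P_tauV; elim/quo_ind; rewrite -/piQ.
have e2E g h : piQ (e2 g h) =
    (sQ0 (rho g h))^-1 * tauQ g h * sQ1 (e1 g) * sQ0 (e1 h).
  rewrite /tauQ /sQ0 /sQ1 /= -!(homV piQ) -!(homM piQ); congr (piQ _).
  by rewrite /tau2 /eps; grp.
elim/F2_rind=> [|g h x Px|g h x Px]; first by rewrite gmulf1.
- rewrite homM e2E !mulgA; apply/P_s0/P_s1/P_tau; rewrite -homV.
  exact: P_s0.
- rewrite homM homV e2E !invgM !mulgA invgK; apply/P_s0/P_tauV.
  by rewrite -(homV sQ0) -(homV sQ1); apply/P_s1/P_s0.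
Qed.

(** The hypotheses describe Milnor's construction on the nerve in dimensions
    1 to 3 through its generators, so that the braiding argument is
    independent of the cells of the suspension. *)
Theorem brown_loday_simplicial : exists Phi : F2 ---> sdp S,
  [/\ forall u, boundary2 u -> Phi u = 1,
      forall u, cycle2 u -> exists2 t, Phi u = Sdp t 1 1 & kappa t = 1,
      forall u, cycle2 u -> Phi u = 1 -> boundary2 u &
      forall t, kappa t = 1 -> exists2 u, cycle2 u & Phi u = Sdp t 1 1].
Proof.
have [q qe] := @F1_lift S id erefl.
have [|Phi PhiE] := @F2_lift (sdp S) (fun g h => sdp1 g * sdp0 h).
  by rewrite !gmulf1 mulg1.
have Phi_filler w : filler (Phi (d30 w)) (Phi (d31 w)) (Phi (d32 w)) (Phi (d33 w)).
  elim/F3_rind: w => [|g h k x IHx|g h k x IHx].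
  - by rewrite !gmulf1; apply: filler1.
  - rewrite !homM d30e d31e d32e d33e !PhiE !gmulfM !mulgA.
    exact/filler_s10/filler_s20/filler_s21.
  - rewrite !(homM, homV) d30e d31e d32e d33e !PhiE !gmulfM !invgM !mulgA.
    by rewrite -!gmulfV; apply/filler_s21/filler_s20/filler_s10.
have Phi_boundary u : boundary2 u -> Phi u = 1.
  case=> w [w1 w2 w3] ->; apply: filler_inj.
  by have := Phi_filler w; rewrite w1 w2 w3 !gmulf1.
pose PhiQ : Q2 ---> sdp S := quo_lift (N := boundaries2) Phi_boundary.
have PhiQE u : PhiQ (piQ u) = Phi u by apply: quo_liftE.
have Phi_s0 g : PhiQ (sQ0 (e1 g)) = sdp0 g.
  by rewrite [LHS]PhiQE s10e PhiE gmulf1 mul1g.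
have Phi_s1 g : PhiQ (sQ1 (e1 g)) = sdp1 g.
  by rewrite [LHS]PhiQE s11e PhiE gmulf1 mulg1.
have Phi_tau g h : PhiQ (tauQ g h) = 1.
  rewrite PhiQE /tau2 /eps /rho !(homM, homV) !s10e s11e !PhiE !gmulf1 !mul1g.
  by rewrite mulg1 gmulfM; grp.
have MooreQ u : cycle2 u -> moore dQ1 dQ2 (piQ u) /\ dQ0 (piQ u) = 1.
  by case=> u0 u1 u2; rewrite dQ0E; split=> //; split; rewrite ?dQ1E ?dQ2E.
have [phi_val phi_inj phi_surj] := phi_classifies dQ0s0 dQ0s1 dQ1s0 dQ1s1
  dQ2s0 dQ2s1 Q_s1_trivial Q_peiffer Q_hexagon_l Q_hexagon_r qe e11 F1_lift
  F1_rind moore_tauQ dQ0_tauQ tauQ1 tauQ_cocycle Q2_rind Phi_s0 Phi_s1 Phi_tau.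
exists Phi; split=> // [u /MooreQ[Mu du]|u /MooreQ[Mu du] pu|t kt].
- by rewrite -PhiQE; apply: phi_val.
- by apply/piQ_eq1; apply: phi_inj; rewrite ?PhiQE.
have [m [Mm dm] pm] := phi_surj t kt.
have [u [u1 u2] um] := moore_lift Mm; exists u; last by rewrite -PhiQE -um.
by split; rewrite // -dm um dQ0E.
Qed.

End SimplicialGroup.

(** * Milnor's construction and the theorem of Brown and Loday *)

Section MilnorConstruction.
Variable X : sset.

(** The loop group of a suspension, where the generators outside the first
    wedge summand are degenerate: they begin with two copies of the vertex. *)
Definition milnor n : groupType := loop_group (susp X) n.

Definition cell n (x : X n) : milnor n := @loop_gen (susp X) n (susp_cell X n x).

Lemma loop_gen_up n z : @loop_gen (susp X) n (susp_up X n z) = 1.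
Proof. by rewrite -susp_degen0; apply: (@loop_gen_degen0 (susp X)). Qed.

Lemma loop_gen_point n : @loop_gen (susp X) n point = 1.
Proof. by rewrite -(pointed_funP (susp_up X n)) loop_gen_up. Qed.

Lemma cell_point n : cell (point : X n) = 1.
Proof. by rewrite /cell pointed_funP loop_gen_point. Qed.

Lemma milnor_rind n (P : milnor n -> Prop) : P 1 ->
  (forall x u, P u -> P (u * cell x)) ->
  (forall x u, P u -> P (u * (cell x)^-1)) -> forall u, P u.
Proof.
move=> P1 Pg PV; elim/presented_gen_rind=> // x u Pu;
  rewrite -/(@loop_gen (susp X) n x); case: (suspP x) => -[y ->].
- exact: Pg.
- by rewrite loop_gen_up mulg1.
- exact: PV.
- by rewrite loop_gen_up invg1 mulg1.
Qed.

Lemma milnor_ext n (H : groupType) (f g : milnor n ---> H) :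
  (forall x, f (cell x) = g (cell x)) -> f =1 g.
Proof.
move=> fg; elim/milnor_rind=> [|x u IHu|x u IHu]; first by rewrite !gmulf1.
- by rewrite !homM fg IHu.
- by rewrite !homM !homV fg IHu.
Qed.

Section Lift.
Variables (n : nat) (H : groupType) (f : X n -> H).
Hypothesis f_point : f point = 1.

Lemma milnor_lift_respects : respects_relators (@loop_relator (susp X) n)
  (fun x : susp_simplex X n.+1 => f (val x).1).
Proof.
move=> w [y ->]; rewrite /word_eval big_seq1 /=.
by have := susp_degen0 y; rewrite /= => ->.
Qed.

Definition milnor_lift : milnor n ---> H := presented_lift milnor_lift_respects.

Lemma milnor_liftE x : milnor_lift (cell x) = f x.
Proof. exact: presented_lift_gen. Qed.

End Lift.

Definition milnor_face n (i : 'I_n.+2) : milnor n.+1 ---> milnor n :=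
  @loop_face (susp X) n i.

(** The twisted face d_0 of the loop group is an ordinary face on these
    generators, since removing the vertex from a cell leads into the base,
    which is collapsed. *)
Lemma milnor_faceE n (i : 'I_n.+2) x : milnor_face i (cell x) = cell (face X n i x).
Proof.
have e0 : face (susp X) n.+1 0 (susp_cell X n.+1 x) = point := susp_face0c x.
have eS j : face (susp X) n.+1 j.+1 (susp_cell X n.+1 x) =
  susp_cell X n (face X n j x) := susp_faceSc j x.
rewrite [LHS]loop_faceE; case: i => -[|i] lin.
- rewrite -[LHS]/(loop_gen (face (susp X) n.+1 1 (susp_cell X n.+1 x)) *
    (loop_gen (face (susp X) n.+1 0 (susp_cell X n.+1 x)))^-1).
  by rewrite e0 eS loop_gen_point invg1 mulg1.
- rewrite -[LHS]/(loop_gen (face (susp X) n.+1 i.+2 (susp_cell X n.+1 x))).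
  by rewrite eS.
Qed.

Lemma milnor_degen_point n i : cell (degen X n i point) = 1.
Proof. by rewrite pointed_funP cell_point. Qed.

Definition milnor_degen n i : milnor n ---> milnor n.+1 :=
  milnor_lift (f := fun x => cell (degen X n i x)) (milnor_degen_point n i).

Lemma milnor_degenE n i x : milnor_degen n i (cell x) = cell (degen X n i x).
Proof. exact: milnor_liftE. Qed.

Lemma milnor_face_degen_id n (i : 'I_n.+2) j u : i = j :> nat -> j <= n ->
  milnor_face i (milnor_degen n j u) = u.
Proof.
move=> ij jn; move: u.
apply: (@milnor_ext _ _ (milnor_face i \o milnor_degen n j) idfun) => x /=.
by rewrite milnor_degenE milnor_faceE ij face_degen_id.
Qed.

Lemma milnor_face_degen_succ n (i : 'I_n.+2) j u : i = j.+1 :> nat -> j <= n ->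
  milnor_face i (milnor_degen n j u) = u.
Proof.
move=> ij jn; move: u.
apply: (@milnor_ext _ _ (milnor_face i \o milnor_degen n j) idfun) => x /=.
by rewrite milnor_degenE milnor_faceE ij face_degen_succ.
Qed.

Lemma milnor_face_degen_lt n (i : 'I_n.+3) (i' : 'I_n.+2) j u :
  i' = i :> nat -> i < j <= n.+1 ->
  milnor_face i (milnor_degen n.+1 j u) = milnor_degen n j.-1 (milnor_face i' u).
Proof.
move=> ii ij; move: u.
apply: (@milnor_ext _ _ (milnor_face i \o milnor_degen n.+1 j)
  (milnor_degen n j.-1 \o milnor_face i')) => x /=.
by rewrite milnor_degenE !milnor_faceE milnor_degenE ii face_degen_lt.
Qed.

Lemma milnor_face_degen_gt n (i : 'I_n.+3) (i' : 'I_n.+2) j u :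
  i' = i.-1 :> nat -> j.+1 < i <= n.+2 ->
  milnor_face i (milnor_degen n.+1 j u) = milnor_degen n j (milnor_face i' u).
Proof.
move=> ii ij; move: u.
apply: (@milnor_ext _ _ (milnor_face i \o milnor_degen n.+1 j)
  (milnor_degen n j \o milnor_face i')) => x /=.
by rewrite milnor_degenE !milnor_faceE milnor_degenE ii face_degen_gt.
Qed.

Lemma milnor_face_face n (i j' : 'I_n.+2) (i' j : 'I_n.+3) u :
  i < j -> i' = i :> nat -> j' = j.-1 :> nat ->
  milnor_face i (milnor_face j u) = milnor_face j' (milnor_face i' u).
Proof. exact: loop_face_face. Qed.

Notation F1 := (milnor 1).
Notation F2 := (milnor 2).
Notation F3 := (milnor 3).

Local Definition o20 : 'I_3 := @Ordinal 3 0 isT.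
Local Definition o21 : 'I_3 := @Ordinal 3 1 isT.
Local Definition o22 : 'I_3 := @Ordinal 3 2 isT.
Local Definition o30 : 'I_4 := @Ordinal 4 0 isT.
Local Definition o31 : 'I_4 := @Ordinal 4 1 isT.
Local Definition o32 : 'I_4 := @Ordinal 4 2 isT.
Local Definition o33 : 'I_4 := @Ordinal 4 3 isT.

Definition d20 : F2 ---> F1 := milnor_face o20.
Definition d21 : F2 ---> F1 := milnor_face o21.
Definition d22 : F2 ---> F1 := milnor_face o22.
Definition d30 : F3 ---> F2 := milnor_face o30.
Definition d31 : F3 ---> F2 := milnor_face o31.
Definition d32 : F3 ---> F2 := milnor_face o32.
Definition d33 : F3 ---> F2 := milnor_face o33.
Definition s10 : F1 ---> F2 := milnor_degen 1 0.
Definition s11 : F1 ---> F2 := milnor_degen 1 1.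
Definition s20 : F2 ---> F3 := milnor_degen 2 0.
Definition s21 : F2 ---> F3 := milnor_degen 2 1.
Definition s22 : F2 ---> F3 := milnor_degen 2 2.

Hypothesis X0 : forall x : X 0, x = point.

Lemma milnor0 (u : milnor 0) : u = 1.
Proof.
elim/milnor_rind: u => // x u ->; rewrite [x]X0 cell_point; grp.
Qed.

Lemma d20s10 u : d20 (s10 u) = u. Proof. exact: milnor_face_degen_id. Qed.
Lemma d21s10 u : d21 (s10 u) = u. Proof. exact: milnor_face_degen_succ. Qed.
Lemma d22s10 u : d22 (s10 u) = 1.
Proof.
rewrite /d22 /s10 (@milnor_face_degen_gt 0 o22 (@Ordinal 2 1 isT)) //.
by rewrite [milnor_face _ _]milnor0 gmulf1.
Qed.
Lemma d20s11 u : d20 (s11 u) = 1.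
Proof.
rewrite /d20 /s11 (@milnor_face_degen_lt 0 o20 (@Ordinal 2 0 isT)) //.
by rewrite [milnor_face _ _]milnor0 gmulf1.
Qed.
Lemma d21s11 u : d21 (s11 u) = u. Proof. exact: milnor_face_degen_id. Qed.
Lemma d22s11 u : d22 (s11 u) = u. Proof. exact: milnor_face_degen_succ. Qed.

Lemma d30s20 u : d30 (s20 u) = u. Proof. exact: milnor_face_degen_id. Qed.
Lemma d31s20 u : d31 (s20 u) = u. Proof. exact: milnor_face_degen_succ. Qed.
Lemma d32s20 u : d32 (s20 u) = s10 (d21 u). Proof. exact: milnor_face_degen_gt. Qed.
Lemma d33s20 u : d33 (s20 u) = s10 (d22 u). Proof. exact: milnor_face_degen_gt. Qed.
Lemma d30s21 u : d30 (s21 u) = s10 (d20 u). Proof. exact: milnor_face_degen_lt. Qed.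
Lemma d31s21 u : d31 (s21 u) = u. Proof. exact: milnor_face_degen_id. Qed.
Lemma d32s21 u : d32 (s21 u) = u. Proof. exact: milnor_face_degen_succ. Qed.
Lemma d33s21 u : d33 (s21 u) = s11 (d22 u). Proof. exact: milnor_face_degen_gt. Qed.
Lemma d30s22 u : d30 (s22 u) = s11 (d20 u). Proof. exact: milnor_face_degen_lt. Qed.
Lemma d31s22 u : d31 (s22 u) = s11 (d21 u). Proof. exact: milnor_face_degen_lt. Qed.
Lemma d32s22 u : d32 (s22 u) = u. Proof. exact: milnor_face_degen_id. Qed.
Lemma d33s22 u : d33 (s22 u) = u. Proof. exact: milnor_face_degen_succ. Qed.

Lemma d20d30 u : d20 (d30 u) = d20 (d31 u). Proof. exact/esym/milnor_face_face. Qed.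
Lemma d21d30 u : d21 (d30 u) = d20 (d32 u). Proof. exact/esym/milnor_face_face. Qed.
Lemma d22d30 u : d22 (d30 u) = d20 (d33 u). Proof. exact/esym/milnor_face_face. Qed.

Local Lemma ord3P (i : 'I_3) : [\/ i = o20, i = o21 | i = o22].
Proof.
by case: i => -[|[|[|i]]] li //; [constructor 1|constructor 2|constructor 3];
  apply: val_inj.
Qed.

Local Lemma ord4P (i : 'I_4) : [\/ i = o30, i = o31, i = o32 | i = o33].
Proof.
by case: i => -[|[|[|[|i]]]] li //;
  [constructor 1|constructor 2|constructor 3|constructor 4]; apply: val_inj.
Qed.

Local Lemma ord0E : ord0 = o30. Proof. exact: val_inj. Qed.

Lemma boundary2P u : boundary2 d30 d31 d32 d33 u <-> loop_boundaries (X := susp X) (n := 2) u.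
Proof.
split=> -[v].
  case=> v1 v2 v3 ->; exists v; last by rewrite ord0E.
  move=> i; case: (ord4P i) => ->; [by []|move=> _..].
  - exact: v1.
  - exact: v2.
  - exact: v3.
move=> v0 ->; exists v; last by rewrite ord0E.
by split; apply: v0.
Qed.

Lemma cycle2P u : cycle2 d20 d21 d22 u <-> loop_cycles (X := susp X) (n := 2) u.
Proof.
split=> [[u0 u1 u2] i|uc]; last by split; apply: uc.
by case: (ord3P i) => ->; [exact: u0|exact: u1|exact: u2].
Qed.

End MilnorConstruction.

Section LoopNerve.
Variable S : finGroupType.
Let X := nerve S.

Definition cell1 (g : S) : milnor X 1%N := cell ([tuple g] : nerve S 1%N).
Definition cell2 (g h : S) : milnor X 2%N := cell ([tuple g; h] : nerve S 2%N).
Definition cell3 (g h k : S) : milnor X 3%N := cell ([tuple g; h; k] : nerve S 3%N).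

Lemma nerve0 (x : X 0%N) : x = point.
Proof. by apply: val_inj; rewrite /= (size0nil (size_tuple x)). Qed.

Lemma nerve1P (x : X 1%N) : exists g, x = [tuple g].
Proof.
case/tupleP: x => g x; exists g; apply: val_inj.
by rewrite /= (size0nil (size_tuple x)).
Qed.

Lemma nerve2P (x : X 2%N) : exists g h, x = [tuple g; h].
Proof.
case/tupleP: x => g; case/tupleP=> h x; exists g, h; apply: val_inj.
by rewrite /= (size0nil (size_tuple x)).
Qed.

Lemma nerve3P (x : X 3%N) : exists g h k, x = [tuple g; h; k].
Proof.
case/tupleP: x => g; case/tupleP=> h; case/tupleP=> k x; exists g, h, k.
by apply: val_inj; rewrite /= (size0nil (size_tuple x)).
Qed.

Lemma cell_eq n (x y : X n) : val x = val y -> cell x = cell y.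
Proof. by move/val_inj->. Qed.

Lemma cell1_1 : cell1 1 = 1.
Proof. by rewrite -(cell_point X 1%N); apply: cell_eq. Qed.

Lemma d20_cell g h : d20 X (cell2 g h) = cell1 h.
Proof. by rewrite [LHS]milnor_faceE; apply: cell_eq. Qed.
Lemma d21_cell g h : d21 X (cell2 g h) = cell1 (g * h).
Proof. by rewrite [LHS]milnor_faceE; apply: cell_eq. Qed.
Lemma d22_cell g h : d22 X (cell2 g h) = cell1 g.
Proof. by rewrite [LHS]milnor_faceE; apply: cell_eq. Qed.
Lemma d30_cell g h k : d30 X (cell3 g h k) = cell2 h k.
Proof. by rewrite [LHS]milnor_faceE; apply: cell_eq. Qed.
Lemma d31_cell g h k : d31 X (cell3 g h k) = cell2 (g * h) k.
Proof. by rewrite [LHS]milnor_faceE; apply: cell_eq. Qed.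
Lemma d32_cell g h k : d32 X (cell3 g h k) = cell2 g (h * k).
Proof. by rewrite [LHS]milnor_faceE; apply: cell_eq. Qed.
Lemma d33_cell g h k : d33 X (cell3 g h k) = cell2 g h.
Proof. by rewrite [LHS]milnor_faceE; apply: cell_eq. Qed.
Lemma s10_cell g : s10 X (cell1 g) = cell2 1 g.
Proof. by rewrite [LHS]milnor_degenE; apply: cell_eq. Qed.
Lemma s11_cell g : s11 X (cell1 g) = cell2 g 1.
Proof. by rewrite [LHS]milnor_degenE; apply: cell_eq. Qed.

Lemma milnor1_lift (H : groupType) (f : S -> H) : f 1 = 1 ->
  exists psi : milnor X 1%N ---> H, forall g, psi (cell1 g) = f g.
Proof.
move=> f1; have fp : f (thead (point : X 1%N)) = 1 by [].
by exists (milnor_lift (f := fun x : X 1%N => f (thead x)) fp) => g; rewrite milnor_liftE.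
Qed.

Lemma milnor2_lift (H : groupType) (f : S -> S -> H) : f 1 1 = 1 ->
  exists psi : milnor X 2%N ---> H, forall g h, psi (cell2 g h) = f g h.
Proof.
move=> f1; pose F (x : X 2%N) := f (tnth x ord0) (tnth x (lift ord0 ord0)).
have fp : F point = 1 by [].
by exists (milnor_lift fp) => g h; rewrite milnor_liftE.
Qed.

Lemma milnor1_rind (P : milnor X 1%N -> Prop) : P 1 ->
  (forall g x, P x -> P (x * cell1 g)) ->
  (forall g x, P x -> P (x * (cell1 g)^-1)) -> forall x, P x.
Proof.
move=> P1 Pg PV; elim/milnor_rind=> // x u Pu; have [g ->] := nerve1P x.
  exact: Pg.
exact: PV.
Qed.

Lemma milnor2_rind (P : milnor X 2%N -> Prop) : P 1 ->
  (forall g h x, P x -> P (x * cell2 g h)) ->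
  (forall g h x, P x -> P (x * (cell2 g h)^-1)) -> forall x, P x.
Proof.
move=> P1 Pg PV; elim/milnor_rind=> // x u Pu; have [g [h ->]] := nerve2P x.
  exact: Pg.
exact: PV.
Qed.

Lemma milnor3_rind (P : milnor X 3%N -> Prop) : P 1 ->
  (forall g h k x, P x -> P (x * cell3 g h k)) ->
  (forall g h k x, P x -> P (x * (cell3 g h k)^-1)) -> forall x, P x.
Proof.
move=> P1 Pg PV; elim/milnor_rind=> // x u Pu; have [g [h [k ->]]] := nerve3P x.
  exact: Pg.
exact: PV.
Qed.

Definition J2 : set (tsq S) := [set t | kappa t = 1]%classic.

Theorem brown_loday : (homotopy_group (susp X) 3 #= J2)%card.
Proof.
have [Phi [PhiB PhiZ Phi_inj Phi_surj]] := brown_loday_simplicial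
  (@d20s10 X) (@d20s11 X nerve0) (@d21s10 X) (@d21s11 X) (@d22s10 X nerve0) (@d22s11 X)
  (@d30s20 X) (@d31s20 X) (@d32s20 X) (@d33s20 X) (@d30s21 X) (@d31s21 X) (@d32s21 X)
  (@d33s21 X) (@d30s22 X) (@d31s22 X) (@d32s22 X) (@d33s22 X) (@d20d30 X) (@d21d30 X)
  (@d22d30 X) cell1_1 d20_cell d21_cell d22_cell d30_cell d31_cell d32_cell
  d33_cell s10_cell s11_cell milnor1_lift milnor2_lift milnor1_rind
  milnor2_rind milnor3_rind.
have cycP u := cycle2P (X := X) u; have bdP u := boundary2P (X := X) u.
pose rep (t : tsq S) : milnor X 2%N :=
  xget 1 [set u | cycle2 (d20 X) (d21 X) (d22 X) u /\ Phi u = Sdp t 1 1]%classic.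
have repP t : kappa t = 1 ->
    cycle2 (d20 X) (d21 X) (d22 X) (rep t) /\ Phi (rep t) = Sdp t 1 1.
  move=> /Phi_surj[u uc up]; rewrite /rep; case: xgetP => [v -> //|].
  by move=> /(_ u)[]; split.
pose coset_of_rep t := [set rep t * b | b in @loop_boundaries (susp X) 2]%classic.
suff -> : homotopy_group (susp X) 3 = (coset_of_rep @` J2)%classic.
  apply: inj_card_eq => t t' /set_mem kt /set_mem kt' ett'.
  have [_ pt] := repP t kt; have [_ pt'] := repP t' kt'.
  have : coset_of_rep t (rep t * 1).
    by exists 1 => //; apply/bdP/(boundary2_1 (d30 X)).
  rewrite mulg1 ett' => -[b /bdP/PhiB pb eb].
  by move: pt; rewrite -eb homM pb mulg1 pt' => -[].
apply/seteqP; split=> [A [u uZ <-]|A [t kt <-]]; last first.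
  by exists (rep t) => //; apply/cycP; have [] := repP t kt.
have uc := (cycP u).2 uZ; have [t pu kt] := PhiZ u uc; exists t => //.
have [rc pr] := repP t kt.
have ur : boundary2 (d30 X) (d31 X) (d32 X) (d33 X) (u^-1 * rep t).
  apply: Phi_inj; last by rewrite homM homV pu pr mulVg.
  case: uc rc => u0 u1 u2 [r0 r1 r2].
  by split; rewrite homM homV; [rewrite u0 r0|rewrite u1 r1|rewrite u2 r2];
    rewrite invg1 mulg1.
apply/seteqP; split=> [v [b /bdP bB <-]|v [b /bdP bB <-]].
- exists ((u^-1 * rep t) * b); first by apply/bdP; apply: boundary2M.
  by rewrite !mulgA mulgV mul1g.
- exists ((u^-1 * rep t)^-1 * b).
    by apply/bdP; apply: boundary2M => //; apply: boundary2V.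
  by rewrite invgM invgK !mulgA mulgV mul1g.
Qed.

End LoopNerve.

(** * Orders of groups given by presentations *)

Section Counting.

(** The tensor square of a finite group is finite, but carries no finite
    type structure; its order is witnessed by a bijection with a finite
    type. *)
Definition has_order (T : Type) (t : nat) : Prop :=
  exists (J : finType) (g : J -> T), bijective g /\ #|J| = t.

(** Choosing preimages identifies T with the elements of I fixed by an
    idempotent. *)
Lemma has_order_surj (T : choiceType) (I : finType) (f : I -> T) :
  (forall y, exists i, f i = y) -> exists2 t, t <= #|I| & has_order T t.
Proof.
move=> /choice[h hK].
pose J := {i : I | h (f i) == i}.
exists #|{: J}|; first by rewrite card_sig max_card.
exists J, (fun j => f (val j)); split=> //.
have hP y : h (f (h y)) == h y by rewrite hK.
exists (fun y => exist _ (h y) (hP y) : J) => [[i hi]|y]; last exact: hK.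
by apply: val_inj; apply/eqP.
Qed.

Lemma card_finType (T : finType) : ([set: T] #= `I_#|T|)%card.
Proof.
have -> : `I_#|T| = ((fun x : T => nat_of_ord (enum_rank x)) @` [set: T])%classic.
  apply/seteqP; split=> [i /= li|_ [x _ <-]]; last exact: ltn_ord.
  by exists (enum_val (Ordinal li)); rewrite // enum_valK.
apply/card_esym/inj_card_eq => x y _ _ /val_inj.
exact: enum_rank_inj.
Qed.

Lemma has_order_inj (T : Type) (I : finType) (f : I -> T) t :
  injective f -> has_order T t -> #|I| <= t.
Proof.
move=> f_inj [J [g [[h hK gK] <-]]]; apply: (@leq_card _ _ (h \o f)).
exact: inj_comp (can_inj gK) f_inj.
Qed.

Lemma has_order_unique (T : Type) t t' : has_order T t -> has_order T t' -> t = t'.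
Proof.
have le u u' : has_order T u -> has_order T u' -> u <= u'.
  by case=> J [g [g_bij <-]]; apply: has_order_inj (bij_inj g_bij).
by move=> ord_t ord_t'; apply/eqP; rewrite eqn_leq !le.
Qed.

End Counting.

Section KappaOrder.
Variable S : finGroupType.
Let D := [set: S]^`(1).

Lemma commutator_kappa (x y : S) : [~ x, y] = kappa (tens x^-1 y^-1).
Proof. by rewrite kappaE commgEl conjgE; grp. Qed.

Lemma kappa_der u : kappa u \in D.
Proof.
elim/tsq_ind: u => [|g h|u v Du Dv|u Du]; first by rewrite gmulf1 group1.
- have := commutator_kappa g^-1 h^-1; rewrite !invgK => <-.
  by apply: mem_commg; rewrite inE.
- by rewrite gmulfM groupM.
- by rewrite gmulfV groupV.
Qed.

Lemma der_kappa x : x \in D -> exists u, kappa u = x.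
Proof.
move=> /gen_prodgP[n [c cP ->]].
elim: n c cP => [|n IHn] c cP; first by exists 1; rewrite big_ord0 gmulf1.
have [u eu] := IHn _ (fun i => cP (widen_ord (leqnSn n) i)).
rewrite big_ord_recr -eu; case/imset2P: (cP ord_max) => x1 x2 _ _ ->.
by exists (u * tens x1^-1 x2^-1); rewrite gmulfM -commutator_kappa.
Qed.

(** kappa maps the tensor square onto the derived subgroup, all its fibres
    being translates of the kernel. *)
Lemma card_J2 t : has_order (tsq S) t ->
  exists2 c, ([set u : tsq S | kappa u = 1]%classic #= `I_c)%card &
             t = (c * #|D|)%N.
Proof.
case=> J [g [[h hK gK] <-]].
pose JJ : finType := {j : J | kappa (g j) == 1}; exists #|{: JJ}|.
  have -> : [set u : tsq S | kappa u = 1]%classic =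
      ((fun j : JJ => g (val j)) @` [set: JJ])%classic.
    apply/seteqP; split=> [u ku|_ [[j /= /eqP kj] _ <-]]; last exact: kj.
    have jP : kappa (g (h u)) == 1 by rewrite gK; apply/eqP.
    by exists (exist _ (h u) jP) => //=; rewrite gK.
  apply: (card_eq_trans (inj_card_eq _)).
    move=> i j _ _ e; apply: val_inj; exact: (can_inj hK).
  exact: card_finType.
pose DD : finType := {s : S | s \in D}.
have /choice[l lP] : forall s : DD, exists u, kappa u = val s.
  by case=> s sD; apply: der_kappa.
have cDD : #|{: DD}| = #|D| by rewrite card_sig.
rewrite -cDD -card_prod; apply/eqP; rewrite eqn_leq; apply/andP; split.
- have kD j : kappa (g j) \in D by apply: kappa_der.
  pose dd j : DD := exist (fun s => s \in D) _ (kD j).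
  have kJ j : kappa (g (h (g j * (l (dd j))^-1))) == 1.
    by rewrite gK homM homV lP mulgV.
  pose jj j : JJ := exist (fun j => kappa (g j) == 1) _ (kJ j).
  apply: (@leq_card _ _ (fun j => (jj j, dd j))) => i j e.
  have ed := congr1 snd e; rewrite /= in ed.
  have := congr1 (fun x => val x.1) e; rewrite /= ed => /(can_inj gK)/mulIg.
  exact: can_inj hK _ _.
- apply: (@leq_card _ _ (fun js : JJ * DD => h (g (val js.1) * l js.2))).
  move=> [[i ki] s] [[j kj] s'] /(can_inj gK) /= e.
  have /eqP ki1 := ki; have /eqP kj1 := kj.
  have es : s = s'.
    apply: val_inj; move: (congr1 kappa e); rewrite !homM ki1 kj1 !mul1g.
    by rewrite !lP.
  move: e; rewrite es => /mulIg /(can_inj hK) eij.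
  by congr pair; apply: val_inj.
Qed.

End KappaOrder.

(** * Tensors with a central element *)

Section CentralTensor.
Variable S : groupType.

Lemma tact_central (z : S) u : (forall g, commute z g) -> tact z u = u.
Proof.
move=> zC; elim/tsq_ind: u => [|g h|u v IHu IHv|u IHu].
- by rewrite gmulf1.
- by rewrite tactE !zC !mulgK.
- by rewrite gmulfM IHu IHv.
- by rewrite gmulfV IHu.
Qed.

Lemma kappa1_central (u v : tsq S) : kappa u = 1 -> commute u v.
Proof.
move=> ku; have := tact_kappa u v; rewrite ku tact1 => e.
by rewrite /commute {2}e mulgVK.
Qed.

Lemma kappa_tens_central (z g : S) : commute z g -> kappa (tens z g) = 1.
Proof. by move=> zg; rewrite kappaE zg mulgK mulgV. Qed.

(** As a acts trivially on x (x) y, this is tens_kappal. *)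
Lemma tens_kappa_centralised (x y a : S) : commute a x -> commute a y ->
  tens (kappa (tens x y)) a = 1.
Proof. by move=> ax ay; rewrite tens_kappal tactE ax ay !mulgK mulgV. Qed.

Variable z : S.
Hypothesis zC : forall g, commute z g.

Lemma tensz_central g u : commute (tens z g) u.
Proof. exact/kappa1_central/kappa_tens_central. Qed.

Lemma tenszM g h : tens z (g * h) = tens z g * tens z h.
Proof.
have e : tens z (g * h * g^-1) = tens z h.
  rewrite tens_conjr tact_central // -(tensz_central h); exact: mulgK.
by rewrite tensDr tactE [g * z * g^-1](_ : _ = z) ?e // -zC mulgK.
Qed.

Lemma tensDl_central x g : tens (z * x) g = tens x g * tens z g.
Proof. by rewrite tensDl tact_central. Qed.

Lemma tenszV g : tens z g^-1 = (tens z g)^-1.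
Proof. by apply: (mulgI (tens z g)); rewrite -tenszM !mulgV tensg1. Qed.

Lemma tenszX g i : tens z (g ^+ i) = tens z g ^+ i.
Proof.
by elim: i => [|i IHi]; rewrite ?expg0 ?tensg1 // !expgS tenszM IHi.
Qed.

Lemma tensXz g i : tens (z ^+ i) g = tens z g ^+ i.
Proof.
elim: i => [|i IHi]; rewrite ?expg0 ?tens1g // expgS tensDl_central IHi.
by rewrite expgSr.
Qed.

(** If z is a value of kappa, both tensors are given by the action of g on
    one and the same element. *)
Lemma tens_der_central g : (exists u, kappa u = z) -> tens g z = (tens z g)^-1.
Proof. by case=> u <-; rewrite tens_kappal tens_kappar invgM invgK. Qed.

(** The values of a homomorphism into the centre do not depend on
    commutators. *)
Lemma tensz_kappa u : tens z (kappa u) = 1.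
Proof.
elim/tsq_ind: u => [|g h|u v IHu IHv|u IHu].
- by rewrite gmulf1 tensg1.
- by rewrite kappaE !tenszM !tenszV (tensz_central g) mulgK mulgV.
- by rewrite gmulfM tenszM IHu IHv mulg1.
- by rewrite gmulfV tenszV IHu invg1.
Qed.

End CentralTensor.

Section CentralQuotient.
Variables (S : finGroupType) (z : S).
Hypotheses (zC : forall g, commute z g) (zD : z \in [set: S]^`(1)).
Let H := <[z]>%G.

(** A subgroup, because tensors with a central element are multiplicative in
    the other entry. *)
Definition tker : {set S} := [set g | tens z g == 1].

Lemma tker_group_set : group_set tker.
Proof.
apply/group_setP; split=> [|g h]; rewrite !inE ?tensg1 //.
by move=> /eqP eg /eqP eh; rewrite tenszM // eg eh mulg1.
Qed.
Canonical tker_group := Group tker_group_set.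

Lemma der_sub_tker : [set: S]^`(1) \subset tker.
Proof.
by apply/fintype.subsetP=> x /der_kappa[u <-]; rewrite inE tensz_kappa.
Qed.

Lemma tker_rcoset g h : h \in tker :* g -> tens z h = tens z g.
Proof. by case/rcosetP=> c; rewrite inE => /eqP ec ->; rewrite tenszM // ec mul1g. Qed.

(** For z central in the derived subgroup, this is the kernel of the map
    from the tensor square of S to that of S / z. *)
Definition tensz_pred (u : tsq S) : Prop := exists g, u = tens z g.

Lemma tensz_pred1 : tensz_pred 1. Proof. by exists 1; rewrite tensg1. Qed.
Lemma tensz_predM u v : tensz_pred u -> tensz_pred v -> tensz_pred (u * v).
Proof. by case=> g -> [h ->]; exists (g * h); rewrite tenszM. Qed.
Lemma tensz_predV u : tensz_pred u -> tensz_pred u^-1.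
Proof. by case=> g ->; exists g^-1; rewrite tenszV. Qed.
Lemma tensz_predJ u v : tensz_pred u -> tensz_pred (v * u * v^-1).
Proof. by case=> g ->; exists g; rewrite -tensz_central // mulgK. Qed.

Definition tensz_normal : normal_subgroup (tsq S) := NormalSubgroup
  tensz_pred1 tensz_predM tensz_predV tensz_predJ.

Notation piD := (quo_pi tensz_normal : tsq S ---> quo tensz_normal).

Lemma in_norm_central x : x \in 'N(H).
Proof.
apply: (fintype.subsetP (cent_sub H)); apply/centP=> y /cycleP[i ->].
exact/commuteX/commute_sym/zC.
Qed.

Lemma cosetM_central x y : coset H (x * y) = coset H x * coset H y.
Proof. by rewrite morphM ?in_norm_central. Qed.

Lemma cosetV_central x : coset H x^-1 = (coset H x)^-1.
Proof. by rewrite morphV ?in_norm_central. Qed.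

Lemma piD_tens g g' h h' : coset H g = coset H g' -> coset H h = coset H h' ->
  piD (tens g h) = piD (tens g' h').
Proof.
have zH x y : coset H x = coset H y -> exists i, x = z ^+ i * y.
  move/(kercoset_rcoset (in_norm_central x) (in_norm_central y)).
  by case=> w /cycleP[i ->] ->; exists i.
have zXC i w : commute (z ^+ i) w by apply/commute_sym/commuteX/commute_sym/zC.
have pi1 u : tensz_pred u -> piD u = 1 by move=> Du; apply/quo_pi_eq1.
move=> /zH[i ->] /zH[j ->]; rewrite tensDl_central // homM.
have -> : piD (tens (z ^+ i) (z ^+ j * h')) = 1.
  by apply: pi1; rewrite tensXz // -tenszX //; exists ((z ^+ j * h') ^+ i).
rewrite mulg1 tensDr homM tact_central //.
have zXD : exists u, kappa u = z ^+ j by apply/der_kappa/groupX.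
rewrite tens_der_central // homV pi1 ?invg1 ?mul1g //.
by rewrite tensXz // -tenszX //; exists (g' ^+ j).
Qed.

(** Modulo the tensors z (x) g the symbol g (x) h only depends on the cosets
    of g and h, so the tensor square of S / z maps onto the quotient, while
    there are as many z (x) g as cosets of tker z. *)
Lemma has_order_central t : has_order (tsq (coset_of H)) t ->
  exists2 t', (t' <= t * #|[set: S] : tker|)%N & has_order (tsq S) t'.
Proof.
have pq : crossed_pairing
    (fun c d : coset_of H => piD (tens (repr c) (repr d))).
  split=> [c c' d|c d d'].
  - rewrite (@piD_tens _ (repr c * repr c') _ (repr d)) //.
      rewrite tensMl homM; congr (_ * _).
      by apply: piD_tens; rewrite !(coset_reprK, cosetM_central, cosetV_central).
    by rewrite !(coset_reprK, cosetM_central).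
  - rewrite (@piD_tens _ (repr c) _ (repr d * repr d')) //.
      rewrite tensMr homM; congr (_ * _).
      by apply: piD_tens; rewrite !(coset_reprK, cosetM_central, cosetV_central).
    by rewrite !(coset_reprK, cosetM_central).
pose Psi : tsq (coset_of H) ---> quo tensz_normal := tsq_lift pq.
have Psi_surj u : exists v, Psi v = piD u.
  elim/tsq_ind: u => [|g h|u v [a ea] [b eb]|u [a ea]].
  - by exists 1; rewrite !gmulf1.
  - exists (tens (coset H g) (coset H h)); rewrite [LHS]tsq_liftE.
    by apply: piD_tens; rewrite coset_reprK.
  - by exists (a * b); rewrite !homM ea eb.
  - by exists a^-1; rewrite !homV ea.
have /choice[sec secK] : forall c : quo tensz_normal, exists u, piD u = c.
  by elim/quo_ind=> u; exists u.
case=> J [g [[g' gK g'K] <-]].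
pose R : finType := {A : {set S} | A \in rcosets tker [set: S]}.
have cR : #|{: R}| = #|[set: S] : tker| by rewrite card_sig.
pose f (jr : J * R) : tsq S := sec (Psi (g jr.1)) * tens z (repr (val jr.2)).
have f_surj u : exists i, f i = u.
  have [v ev] := Psi_surj u.
  have /quo_pi_eq[x ex] : piD (sec (Psi v)) = piD u by rewrite secK.
  have rP : tker :* x \in rcosets tker [set: S].
    by apply/rcosetsP; exists x; rewrite ?inE.
  exists (g' v, exist (fun A => A \in rcosets tker [set: S]) _ rP).
  rewrite /f /= g'K (@tker_rcoset x); last by rewrite mem_repr_rcoset.
  by rewrite -ex mulVKg.
have [t' le_t' ord_t'] := has_order_surj f_surj.
by exists t'; rewrite // -cR -card_prod.
Qed.

End CentralQuotient.

Section AbelianTensor.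
Variable S : finGroupType.
Hypothesis S_abelian : abelian [set: S].

Lemma S_commute (x y : S) : commute x y.
Proof. by apply: (centsP S_abelian); rewrite inE. Qed.

Lemma tsq_abelian (u v : tsq S) : commute u v.
Proof.
apply: kappa1_central; have := kappa_der u.
by rewrite (derG1P S_abelian) => /set1P.
Qed.

Lemma tact_abelian x (u : tsq S) : tact x u = u.
Proof. by apply: tact_central => g; apply: S_commute. Qed.

(** The action is trivial and the tensor square abelian, so tensors are
    bilinear and a product of tensors phi(b) (x) b, one for every generator
    b, reaches every element. *)
Lemma has_order_abelian (B : {set S}) : <<B>> = [set: S] ->
  exists2 t, (t <= #|S| ^ #|B|)%N & has_order (tsq S) t.
Proof.
move=> genB; pose I := {b : S | b \in B}.
pose F (phi : {ffun I -> S}) : tsq S := \prod_(b : I) tens (phi b) (val b).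
have FM phi psi : F (phi * psi) = F phi * F psi.
  rewrite /F -prodgM_commute; last by move=> *; apply: tsq_abelian.
  apply: eq_bigr => b _; rewrite ffunE tensDl tact_abelian.
  exact: tsq_abelian.
have F1 : F 1 = 1 by rewrite /F big1 // => b _; rewrite ffunE tens1g.
have FV phi : F phi^-1 = (F phi)^-1.
  by apply: (mulgI (F phi)); rewrite -FM !mulgV F1.
have F_surj u : exists phi, F phi = u.
  elim/tsq_ind: u => [|g h|u v [a <-] [b <-]|u [a <-]].
  - by exists 1.
  - have : h \in <<B>> by rewrite genB inE.
    case/gen_prodgP=> n [c cB ->]; elim: n c cB => [|n IHn] c cB.
      by exists 1; rewrite big_ord0 tensg1.
    rewrite big_ord_recl tensDr tact_abelian.
    have [phi <-] := IHn _ (fun i => cB (lift ord0 i)).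
    pose b0 : I := exist (fun b => b \in B) _ (cB ord0).
    exists ([ffun b => if b == b0 then g else 1] * phi); rewrite FM; congr (_ * _).
    rewrite /F (big_only1 b0) //=; first by rewrite ffunE eqxx.
    by move=> b nb _; rewrite ffunE (negPf nb) tens1g.
  - by exists (a * b).
  - by exists a^-1.
have [t le_t ord_t] := has_order_surj F_surj.
exists t => //; rewrite card_ffun in le_t.
by rewrite (leq_trans le_t) // card_sig.
Qed.

End AbelianTensor.

(** * Upper bounds for the order of the tensor square *)

Section Gens.
Variables (A : finGroupType) (p d : nat).
Hypotheses (p_pr : prime p) (A_abelian : abelian [set: A]) (cA : #|A| = (p ^ d)%N).

(** The rank of an abelian p-group of order p^d reaches d only when the
    group is elementary. *)
Lemma small_generators : exists B : {set A},
  [/\ <<B>> = [set: A], #|B| <= d & #|B| < d \/ p.-abelem [set: A]].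
Proof.
have pA : p.-group [set: A] by rewrite /pgroup cardsT cA pnatX pnat_id.
have [B genB cB] := grank_witness [set: A]; exists B.
rewrite cB grank_abelian // (rank_pgroup pA).
have le_d : 'r_p([set: A]) <= d.
  by apply: leq_trans (p_rank_le_logn _ _) _; rewrite cardsT cA pfactorK.
split=> //; have [lt_d|ge_d] := ltnP 'r_p([set: A]) d; first by left.
right; have [E /pnElemP[sEA abE logE]] := p_rank_witness p [set: A].
have pE : p.-group E by case/and3P: abE.
suff <- : E :=: [set: A] by [].
apply/eqP; rewrite eqEcard sEA cardsT cA (card_pgroup pE) logE.
by rewrite leq_exp2l ?prime_gt1.
Qed.

End Gens.

Lemma exists_noncommuting (S : finGroupType) :
  ~~ abelian [set: S] -> exists x y : S, [~ x, y] != 1.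
Proof.
rewrite /abelian => /fintype.subsetPn[x _ /centP nxy]; apply: contrapT => H.
apply: nxy => y _; apply/commgP; apply: contrapT => /negP nxy.
by apply: H; exists x, y.
Qed.

Section Index.
Variables (S : finGroupType) (z : S).
Hypotheses (zC : forall g, commute z g) (defD : [set: S]^`(1) = <[z]>).

Lemma index_tker_der : #|[set: S] : tker z| <= #|[set: S] : [set: S]^`(1)|.
Proof.
have := indexgS [set: S]%G (der_sub_tker zC : _ \subset tker_group zC).
by move=> /dvdn_leq; apply.
Qed.

(** The conjugates of x are among the x u with u in the derived subgroup. *)
Lemma index_cent_der (x : S) : #|[set: S] : 'C_[set: S][x]| <= #|[set: S]^`(1)|.
Proof.
rewrite index_cent1.
have sub : x ^: [set: S] \subset [set x * u | u in [set: S]^`(1)].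
  apply/fintype.subsetP=> _ /imsetP[g _ ->]; apply/imsetP.
  exists [~ x, g]; first by rewrite mem_commg ?inE.
  by rewrite commgEl mulVKg.
exact: leq_trans (subset_leq_card sub) (leq_imset_card _ _).
Qed.

Lemma index_setI (A B : {group S}) :
  #|[set: S] : A :&: B| <= #|[set: S] : A| * #|[set: S] : B|.
Proof.
have [[iA iB] iAB] := (Lagrange (finset.subsetT A), Lagrange (finset.subsetT B),
  Lagrange (finset.subsetT (A :&: B))).
have cS : 0 < #|[set: S]| by rewrite cardG_gt0.
have cAB : 0 < #|A :&: B| by rewrite cardG_gt0.
rewrite -(leq_pmul2l cAB) iAB -(leq_pmul2l cS).
have -> : (#|[set: S]| * #|[set: S]| = (#|(A * B)%g| * #|A :&: B|) *
    (#|[set: S] : A| * #|[set: S] : B|))%N.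
  by rewrite -{1}iA -{1}iB mulnACA mul_cardG.
by rewrite -mulnA leq_mul2r subset_leq_card ?finset.subsetT ?orbT.
Qed.

(** The commutator [x, y] generates <z>, so z (x) a is a power of [x, y] (x)
    a. *)
Lemma cent2_sub_tker x y : [~ x, y] != 1 -> prime #[z] ->
  'C_[set: S][x] :&: 'C_[set: S][y] \subset tker z.
Proof.
move=> nxy z_pr; apply/fintype.subsetP=> a /setIP[/setIP[_ /cent1P ax] /setIP[_ /cent1P ay]].
have cD : [~ x, y] \in <[z]> by rewrite -defD mem_commg ?inE.
have [k ez] : exists k, z = [~ x, y] ^+ k.
  apply/cycleP; rewrite -cycle_subG.
  have [//|ti] := prime_subgroupVti <[[~ x, y]]>%G (z_pr : prime #|<[z]>|).
  have : [~ x, y] \in <[[~ x, y]]>%G :&: <[z]> by rewrite inE cycle_id.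
  by rewrite ti => /set1P exy; rewrite exy eqxx in nxy.
have xyC g : commute [~ x, y] g.
  by case/cycleP: cD => i ->; apply/commute_sym/commuteX/commute_sym/zC.
rewrite inE {1}ez tensXz // commutator_kappa tens_kappa_centralised ?expg1n //;
  exact/commuteV.
Qed.

Lemma index_tker_le2 : prime #[z] -> #|[set: S] : tker z| <= #[z] ^ 2.
Proof.
move=> z_pr; have [x [y nxy]] : exists x y : S, [~ x, y] != 1.
  apply: exists_noncommuting; apply: contraTN z_pr => /derG1P; rewrite defD => ez.
  by rewrite orderE ez cards1.
have sub := cent2_sub_tker nxy z_pr.
apply: leq_trans (_ : #|[set: S] : 'C_[set: S][x] :&: 'C_[set: S][y]| <= _).
  have := indexgS [set: S]%G (sub : _ \subset tker_group zC).
  by move=> /dvdn_leq; apply.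
apply: leq_trans (index_setI _ _) _.
by rewrite -mulnn leq_mul // orderE -defD index_cent_der.
Qed.

End Index.

Lemma central_prime_order (S : finGroupType) (p : nat) :
  prime p -> p.-group [set: S] -> [set: S]^`(1) != 1 ->
  exists z : S, [/\ z \in [set: S]^`(1), forall g, commute z g & #[z] = p].
Proof.
move=> p_pr pS ntD; pose Z := ([set: S]^`(1) :&: 'Z([set: S]))%G.
have ntZ : Z :!=: 1 by apply: meet_center_nil (pgroup_nil pS) (der_normal 1 _) ntD.
have pZ : p.-group Z by apply: pgroupS pS; apply: finset.subsetT.
have [_ pdvd _] := pgroup_pdiv pZ ntZ.
have [z /setIP[zD /setIP[_ /centP zZ]] oz] := Cauchy p_pr pdvd.
by exists z; split=> // g; apply: zZ; rewrite inE.
Qed.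

Lemma card_coset_cycle (S : finGroupType) (p n : nat) (z : S) :
  (forall g, commute z g) -> prime p -> #|S| = (p ^ n)%N -> #[z] = p ->
  #|{: coset_of <[z]>}| = (p ^ n.-1)%N.
Proof.
move=> zC p_pr cS oz.
have nzS : [set: S] \subset 'N(<[z]>).
  by apply/fintype.subsetP=> x _; apply: in_norm_central.
rewrite -cardsT -(quotientT <[z]>) card_quotient ?nzS // -divgS ?finset.subsetT //.
rewrite cardsT cS -orderE oz; case: n cS => [|n] cS; last by rewrite expnS mulKn ?prime_gt0.
have : #[z] %| #|[set: S]| by apply: order_dvdG; rewrite inE.
by rewrite cardsT cS oz dvdn1 => /eqP p1; rewrite p1 in p_pr.
Qed.

(** Here k counts generators of the abelian group S / z; keeping track of it
    shows what equality in the bound forces. *)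
Lemma has_order_central_der (S : finGroupType) (p n : nat) (z : S)
    (zC : forall g, commute z g) :
  prime p -> #|S| = (p ^ n)%N -> [set: S]^`(1) = <[z]> -> #[z] = p ->
  exists k t, [/\ has_order (tsq S) t, k <= n.-1,
    k < n.-1 \/ p.-abelem ([set: S] / <[z]>) &
    t <= p ^ (n.-1 * k) * #|[set: S] : tker z|].
Proof.
move=> p_pr cS defD oz; pose A : finGroupType := coset_of <[z]>.
have nzS : [set: S] \subset 'N(<[z]>).
  by apply/fintype.subsetP=> x _; apply: in_norm_central.
have fullA : [set: S] / <[z]> = [set: A] := quotientT _.
have cA : #|A| = (p ^ n.-1)%N by apply: card_coset_cycle.
have abA : abelian [set: A] by rewrite -fullA sub_der1_abelian ?defD.
have [B [genB cB abB]] := small_generators p_pr abA cA.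
have [t le_t ord_t] := has_order_abelian abA genB.
have zD' : z \in [set: S]^`(1) by rewrite defD cycle_id.
have [t' le_t' ord_t'] := has_order_central zC zD' ord_t.
exists #|B|, t'; split=> //; first by rewrite fullA.
apply: leq_trans le_t' _; rewrite leq_mul2r; apply/orP; right.
by rewrite expnM -cA.
Qed.

(** Induction on the order of the derived subgroup, dividing by a central
    element z of prime order inside it. In the base case the index of tker z
    is at most p^2 (index_tker_le2), in the induction step at most |S : S'|. *)
Theorem has_order_bound (p m n : nat) (S : finGroupType) :
  prime p -> #|S| = (p ^ n)%N -> #|[set: S]^`(1)| = (p ^ m.+1)%N ->
  exists2 t, (t <= p ^ ((n - m.+1) * n.-1 + 2))%N & has_order (tsq S) t.
Proof.
move=> p_pr; elim: m n S => [|m IHm] n S cS cD.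
all: have pS : p.-group [set: S] by rewrite /pgroup cardsT cS pnatX pnat_id.
all: have ntD : [set: S]^`(1) != 1.
1,3: by rewrite -cardG_gt1 cD -{1}(expn0 p) ltn_exp2l ?prime_gt1.
all: have [z [zD zC oz]] := central_prime_order p_pr pS ntD.
  have defD : [set: S]^`(1) = <[z]>.
    by apply/esym/eqP; rewrite eqEcard cycle_subG zD cD -orderE oz expn1 leqnn.
  have [k [t [ord_t le_k _ le_t]]] := has_order_central_der zC p_pr cS defD oz.
  exists t => //; apply: leq_trans le_t _; rewrite subn1 expnD leq_mul //.
    by rewrite leq_pexp2l ?prime_gt0 // leq_mul.
  by rewrite -oz index_tker_le2 // oz.
pose A : finGroupType := coset_of <[z]>.
have nzS : [set: S] \subset 'N(<[z]>).
  by apply/fintype.subsetP=> x _; apply: in_norm_central.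
have fullA : [set: S] / <[z]> = [set: A] := quotientT _.
have cA : #|A| = (p ^ n.-1)%N by apply: card_coset_cycle.
have cDA : #|[set: A]^`(1)| = (p ^ m.+1)%N.
  rewrite -fullA -quotient_der // card_quotient; last first.
    exact: fintype.subset_trans (der_sub 1 _) nzS.
  by rewrite -divgS ?cycle_subG // cD -orderE oz expnS mulKn ?prime_gt0.
have [t le_t ord_t] := IHm _ _ cA cDA.
have [t' le_t' ord_t'] := has_order_central zC zD ord_t.
exists t' => //; apply: leq_trans le_t' _.
have le_i : #|[set: S] : tker z| <= p ^ (n - m.+2).
  apply: leq_trans (index_tker_der zC) _.
  rewrite -divgS ?der_sub // cardsT cS cD.
  have le_mn : m.+2 <= n.
    rewrite -(leq_exp2l _ _ (prime_gt1 p_pr)) -cS -cD -cardsT.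
    exact/subset_leq_card/finset.subsetT.
  by rewrite -{1}(subnK le_mn) expnD mulnK // expn_gt0 prime_gt0.
apply: leq_trans (leq_mul le_t le_i) _; rewrite -expnD leq_pexp2l ?prime_gt0 //.
have -> : (n.-1 - m.+1 = n - m.+2)%N by case: (n).
rewrite addnAC leq_add2r -[X in _ + X]muln1 -mulnDr leq_mul2l.
by case: n {cS cA le_t le_i} => [|[|n]] //; rewrite ?addn1 ?leqnn ?orbT.
Qed.

(** * Groups with large tensor square are direct products *)

Section Structure.
Variables (S : finGroupType) (p : nat) (z : S).
Hypotheses (p_pr : prime p) (pS : p.-group [set: S]).
Hypotheses (zC : forall g, commute z g) (defD : [set: S]^`(1) = <[z]>) (oz : #[z] = p).
Hypothesis abSz : p.-abelem ([set: S] / <[z]>).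
Hypothesis index_ge : p ^ 2 <= #|[set: S] : tker z|.

Let zD : z \in [set: S]^`(1). Proof. by rewrite defD cycle_id. Qed.
Let Z := 'Z([set: S]).

Lemma central_in_Z c : (forall g, commute c g) -> c \in Z.
Proof. by move=> cC; apply/setIP; split; [by rewrite inE|apply/centP=> g _; apply: cC]. Qed.

Lemma in_Z_central c : c \in Z -> forall g, commute c g.
Proof. by case/setIP=> _ /centP cC g; apply: cC; rewrite inE. Qed.

Let S_nonabelian : ~~ abelian [set: S].
Proof.
apply: contraTN p_pr => /derG1P; rewrite defD => ez.
by rewrite -oz orderE ez cards1.
Qed.

(** The centralisers have index at most p, so their intersection, which lies
    in tker z, has index at most p^2, while the index of tker z is at least
    p^2. *)
Lemma tker_cent2 x y : [~ x, y] != 1 ->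
  tker z = 'C_[set: S][x] :&: 'C_[set: S][y].
Proof.
move=> nxy; have oz_pr : prime #[z] by rewrite oz.
have sub := cent2_sub_tker zC defD nxy oz_pr.
apply/eqP; rewrite eq_sym eqEcard sub.
set C := _ :&: _ in sub *.
have le_i : #|[set: S] : C| <= p ^ 2.
  apply: leq_trans (index_setI _ _) _; rewrite -mulnn.
  by apply: leq_mul; rewrite -oz orderE -defD index_cent_der.
have iC := Lagrange (finset.subsetT C); have iK := Lagrange (finset.subsetT (tker_group zC)).
rewrite -(leq_pmul2r (indexg_gt0 [set: S]%G (tker_group zC))) iK -iC.
by rewrite leq_mul2l (leq_trans le_i) ?orbT.
Qed.

(** An element of tker z noncommuting with some g would lie in the
    centraliser of g by the preceding lemma. *)
Lemma tkerE : tker z = Z.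
Proof.
have [x0 [y0 nxy0]] := exists_noncommuting S_nonabelian.
apply/eqP; rewrite finset.eqEsubset; apply/andP; split; apply/fintype.subsetP=> c.
  move=> cK; apply: central_in_Z => g; apply/commgP; apply: contraT => ncg.
  have := tker_cent2 ncg; move: cK => /[swap] -> /setIP[_ /setIP[_ /cent1P cg]].
  by rewrite (introT commgP) // in ncg; apply/commute_sym.
move=> /in_Z_central cC; rewrite (tker_cent2 nxy0).
by apply/setIP; split; (apply/setIP; split; [by rewrite inE|apply/cent1P; apply: cC]).
Qed.

Lemma index_Z : #|[set: S] : Z| = (p ^ 2)%N.
Proof.
apply/eqP; rewrite eqn_leq; apply/andP; split; last by rewrite -tkerE.
by rewrite -tkerE -oz index_tker_le2 // oz.
Qed.

Lemma expgp_in_z x : x ^+ p \in <[z]>.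
Proof.
have xN y : y \in 'N(<[z]>) by apply: in_norm_central.
apply: coset_idr; first exact: xN.
rewrite morphX ?xN //; have [_ /(_ (coset <[z]> x))] := abelemP p_pr abSz.
by apply; rewrite mem_quotient ?inE.
Qed.

Lemma z_of_pow x : x ^+ p != 1 -> exists k, z = x ^+ (p * k).
Proof.
move=> nx; have pz : prime #|<[z]>| by rewrite -orderE oz.
have [|ti] := prime_subgroupVti <[x ^+ p]>%G pz.
- by rewrite cycle_subG => /cycleP[k ->]; exists k; rewrite expgnA.
- have : x ^+ p \in <[x ^+ p]>%G :&: <[z]> by rewrite inE cycle_id expgp_in_z.
  by rewrite ti => /set1P xp; rewrite xp eqxx in nx.
Qed.

(** If z is a power u^(pk) of a central element u, then z (x) g is u (x)
    g^(pk), and g^(pk) lies in <z>; as u (x) z = (z (x) u)^-1 = 1, tker z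
    would be all of S. *)
Lemma Z_expgp u : u \in Z -> u ^+ p = 1.
Proof.
move=> uZ; have uC := in_Z_central uZ.
apply/eqP; apply: contraT => /z_of_pow[k ez].
have zg1 g : tens z g = 1.
  rewrite ez tensXz // -tenszX //.
  have /cycleP[j ->] : g ^+ (p * k) \in <[z]>.
    by rewrite expgnA groupX // expgp_in_z.
  rewrite tens_der_central; last exact/der_kappa/groupX.
  rewrite tensXz //; have : u \in tker z by rewrite tkerE.
  by rewrite inE => /eqP ->; rewrite expg1n invg1.
have : #|[set: S] : tker z| = 1%N.
  by rewrite (_ : tker z = [set: S]) ?indexgg //; apply/setP=> g; rewrite !inE zg1 eqxx.
move: index_ge => /[swap] ->; rewrite leqNgt.
by rewrite -{1}(expn0 p) ltn_exp2l ?prime_gt1.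
Qed.

Lemma Z_abelem : p.-abelem Z.
Proof.
apply/abelemP => //; split; first exact: center_abelian.
by move=> x; apply: Z_expgp.
Qed.

Lemma tens_self_X (x : S) i : tens (x ^+ i) x = tens x x ^+ i.
Proof.
elim: i => [|i IHi]; first by rewrite expg0 tens1g.
by rewrite expgS tensDl IHi gmulfXn tactE !mulgK -expgSr.
Qed.

Lemma tens_self_Xr (x : S) i : tens x (x ^+ i) = tens x x ^+ i.
Proof.
elim: i => [|i IHi]; first by rewrite expg0 tensg1.
by rewrite expgS tensDr IHi gmulfXn tactE !mulgK -expgS.
Qed.

Lemma tens_zp (g : S) : tens z g ^+ p = 1.
Proof. by rewrite -tensXz // -oz expg_order tens1g. Qed.

(** If z = x^(pk), then z (x) x = x (x) z = (z (x) x)^-1, so z (x) x has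
    order dividing both 2 and p, and x is central. *)
Lemma odd_expgp (x : S) : odd p -> x ^+ p = 1.
Proof.
move=> p_odd; apply/eqP; apply: contraT => nxp.
have [k ez] := z_of_pow nxp.
have e1 : tens z x = (tens z x)^-1.
  rewrite -[RHS]tens_der_central //; last exact: der_kappa.
  by rewrite ez tens_self_X tens_self_Xr.
have e2 : tens z x ^+ 2 = 1 by rewrite expg2 {2}e1 mulgV.
have e3 : tens z x = 1.
  have := tens_zp x; rewrite -(odd_double_half p) p_odd add1n -muln2 mulnC expgS expgnA.
  by rewrite e2 expg1n mulg1.
have : x \in Z by rewrite -tkerE inE e3.
by move/Z_expgp => xp; rewrite xp eqxx in nxp.
Qed.

(** If x^2 = 1 with x outside the centre, choose y not commuting with x;
    replacing y by xy if necessary, y^2 = 1 too. Expanding x^2 (x) y and x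
    (x) y^2, where x and y act on x (x) y through tensors with z, gives z
    (x) x = (x (x) y)^2 = z (x) y, whence xy lies in tker z, the centre, and
    x commutes with y. *)
Lemma two_sq (x : S) : p = 2 -> x \notin Z -> x ^+ 2 = z.
Proof.
move=> p2 nxZ.
have sqz w : w ^+ 2 = 1 \/ w ^+ 2 = z.
  have := expgp_in_z w; rewrite p2 => /cycleP[i ->].
  have z2 : z ^+ 2 = 1 by rewrite -p2 -oz expg_order.
  rewrite -(odd_double_half i) -muln2 mulnC expgnDr expgnA z2 expg1n mulg1.
  by case: (odd i); [right|left].
case: (sqz x) => // x2; case/negP: nxZ.
have z2 : z ^+ 2 = 1 by rewrite -p2 -oz expg_order.
have zkappa u v : [~ u^-1, v^-1] != 1 -> kappa (tens u v) = z.
  have -> : kappa (tens u v) = [~ u^-1, v^-1] by rewrite commutator_kappa !invgK.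
  move=> nuv.
  have : [~ u^-1, v^-1] \in <[z]> by rewrite -defD mem_commg ?inE.
  case/cycleP=> i ei; move: nuv; rewrite ei.
  rewrite -(odd_double_half i) -muln2 mulnC expgnDr expgnA z2 expg1n mulg1.
  by case: (odd i); rewrite ?eqxx.
have commV (u v : S) : commute u^-1 v^-1 -> commute u v.
  move=> c; have := commuteV (commute_sym (commuteV c)); rewrite !invgK.
  exact: commute_sym.
have key y : ~ commute x y -> y ^+ 2 = 1 -> False.
  move=> nxy y2.
  have kz : kappa (tens x y) = z.
    by apply: zkappa; apply/eqP=> /eqP/commgP/commV.
  have actz g : tact g (tens x y) = (tens z g)^-1 * tens x y.
    have := tens_kappal (tens x y) g; rewrite kz => ->.
    by rewrite invgM invgK mulgVK.
  have tx : tens z x = tens x y * tens x y.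
    have : tens (x * x) y = 1 by rewrite -expg2 x2 tens1g.
    by rewrite tensDl actz -mulgA => /mulg1_eq; rewrite invgK.
  have ty : tens z y = tens x y * tens x y.
    have : tens x (y * y) = 1 by rewrite -expg2 y2 tensg1.
    rewrite tensDr actz mulgA (commuteV (commute_sym (tensz_central zC y _))).
    by rewrite -mulgA => /mulg1_eq; rewrite invgK.
  have : x * y \in Z.
    rewrite -tkerE inE tenszM // tx -ty -expg2 -tensXz // z2 tens1g.
    exact: eqxx.
  move=> /in_Z_central xyC; apply: nxy.
  by apply: (mulgI x); rewrite -[LHS](xyC x) mulgA.
apply: central_in_Z => y; apply: contrapT => nxy.
case: (sqz y) => y2; first exact: (key y).
apply: (key (x * y)).
  move=> xxy; apply: nxy; apply: (mulgI x).
  by rewrite [LHS]xxy mulgA.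
have zyx : x * y = z * (y * x).
  have <- : kappa (tens x y) = z.
    by apply: zkappa; apply/eqP=> /eqP/commgP/commV.
  by rewrite kappaE; grp.
have -> : (x * y) ^+ 2 = z * (y * x) * (x * y) by rewrite expg2 {1}zyx.
have -> : z * (y * x) * (x * y) = z * (y * (x * x) * y) by rewrite !mulgA.
by rewrite -expg2 x2 mulg1 -expg2 y2 -expg2.
Qed.

Lemma cycle_prime_sub c (K : {group S}) : c \in <[z]> -> c != 1 -> c \in K -> <[z]> \subset K.
Proof.
move=> cz nc cK; have pz : prime #|<[z]>| by rewrite -orderE oz.
have [//|ti] := prime_subgroupVti K pz.
have : c \in K :&: <[z]> by rewrite inE cK.
by rewrite ti => /set1P c1; rewrite c1 eqxx in nc.
Qed.

(** Two noncommuting elements generate H, of order at most p^3 as S / z is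
    elementary. As the centre Z has index p^2, S = HZ; a complement E of <z>
    in the elementary group Z then satisfies S = H x E. *)
Lemma structure_dprod : exists (H E : {group S}) (x y : S),
  [/\ H \x E = [set: S], #|H| = (p ^ 3)%N, p.-abelem E,
      H :=: <[x]> <*> <[y]> & ~~ abelian H /\ [~ x, y] != 1].
Proof.
have [x [y nxy]] := exists_noncommuting S_nonabelian.
pose H := (<[x]> <*> <[y]>)%G.
have xH : x \in H by rewrite mem_gen // inE cycle_id.
have yH : y \in H by rewrite mem_gen // inE cycle_id orbT.
have nabH (K : {group S}) : x \in K -> y \in K -> ~~ abelian K.
  move=> xK yK; apply: contra nxy => /centsP abK.
  by apply/commgP; apply: abK.
have zN (A : {set S}) : A \subset 'N(<[z]>).
  by apply/fintype.subsetP=> g _; apply: in_norm_central.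
have sz_xy : [~ x, y] \in <[z]> by rewrite -defD mem_commg ?inE.
have szH : <[z]> \subset H by apply: (cycle_prime_sub sz_xy) => //; rewrite groupR.
have zZ : <[z]> \subset Z by rewrite cycle_subG; apply: central_in_Z.
have leH : #|H| <= p ^ 3.
  rewrite -(Lagrange szH) -orderE oz expnS leq_mul2l; apply/orP; right.
  have gN g : g \in 'N(<[z]>) by apply: in_norm_central.
  rewrite -card_quotient ?zN // quotientY ?zN // !quotient_cycle ?gN //.
  have [abel_q expq] := abelemP p_pr abSz.
  have ord_q g : #[coset <[z]> g] <= p.
    rewrite dvdn_leq ?prime_gt0 // order_dvdn expq //.
    by rewrite mem_quotient ?inE.
  rewrite comm_joingE; last first.
    apply: centC; apply: sub_abelian_cent2 abel_q _ _;
      by rewrite cycle_subG mem_quotient ?inE.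
  apply: leq_trans (_ : #[coset <[z]> x] * #[coset <[z]> y] <= _)%N.
    by rewrite !orderE mul_cardG leq_pmulr ?cardG_gt0.
  by rewrite expnS expn1 leq_mul.
have cS : (#|[set: S]| = p ^ 2 * #|Z|)%N.
  by rewrite -index_Z mulnC Lagrange ?finset.subsetT.
have HZ : H * Z = [set: S].
  have cHZ : H \subset 'C(Z).
    by apply/centsP=> h _ c cZ; apply/commute_sym/in_Z_central.
  pose K := (H <*> 'Z([set: S]))%G.
  have KE : K :=: H * Z by rewrite /= comm_joingE //; apply: centC.
  have sZK : Z \subset K by rewrite joing_subr.
  have nZK : K \subset 'N('Z([set: S])%G).
    by apply: cents_norm; apply/centsP=> h _ c cZ; apply/commute_sym/in_Z_central.
  rewrite -KE; apply/eqP; rewrite eqEcard finset.subsetT cS.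
  have := indexSg sZK (finset.subsetT K); rewrite index_Z.
  case/(dvdn_pfactor _ _ p_pr) => -[|[|[|k]]] // _ iK.
  1,2: case/negP: (nabH K (fintype.subsetP (joing_subl _ _) _ xH)
                          (fintype.subsetP (joing_subl _ _) _ yH)).
  1,2: apply: (@cyclic_factor_abelian _ 'Z([set: S])%G).
  1,3: apply/fintype.subsetP=> c cZ; apply/centerP; split=> [|h _];
    [exact: (fintype.subsetP sZK)|exact: in_Z_central].
  - have -> : K / 'Z([set: S])%G = 1.
      by apply/eqP; rewrite trivg_card1 card_quotient //; apply/eqP.
    exact: cyclic1.
  - by apply: prime_cyclic; rewrite card_quotient //; move: iK => /= ->.
  by rewrite -(Lagrange sZK) iK mulnC leqnn.
have [E dE] := abelem_split_dprod Z_abelem zZ.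
have [_ zE0 cEz tiE] := dprodP dE.
have zE : <[z]> * E = Z by exact: zE0.
have sEZ : E \subset Z by rewrite -zE mulG_subr.
have cHZcard : (#|[set: S]| * #|H :&: Z| = #|H| * #|Z|)%N.
  by rewrite -HZ (mul_cardG H 'Z([set: S])%G).
have cZ0 : 0 < #|Z| by rewrite cardG_gt0.
have szHZ : <[z]> \subset H :&: Z by rewrite finset.subsetI szH.
have tHZ : H :&: Z = <[z]>.
  apply/esym/eqP; rewrite eqEcard szHZ -orderE oz.
  rewrite -(leq_pmul2l (cardG_gt0 [set: S]%G)) cHZcard cS.
  by rewrite mulnAC -expnSr leq_mul2r leH orbT.
exists H, E, x, y; split=> //; last by split=> //; apply: nabH.
- rewrite dprodE.
  + apply/eqP; rewrite finset.eqEsubset finset.subsetT /= -HZ -zE mulgA.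
    by rewrite mulSg // mul_subG.
  + by apply/centsP=> c cE h _; apply/in_Z_central/(fintype.subsetP sEZ).
  + apply/trivgP; rewrite -tiE.
    rewrite finset.subsetI finset.subsetIr andbT /= -tHZ.
    exact: finset.setIS.
- apply/eqP; rewrite -(eqn_pmul2r cZ0) -cHZcard tHZ -orderE oz cS.
  by rewrite mulnAC -expnSr.
- by apply: abelemS Z_abelem.
Qed.

(** The exponent and, for p = 2, the quaternion relations come from
    odd_expgp and two_sq. *)
Theorem structure_isog : exists (hT eT : finGroupType) (H : {group hT}) (E : {group eT}),
  [/\ [/\ #|H| = (p ^ 3)%N, extraspecial H & exponent H = p] \/ H \isog 'Q_8,
      p.-abelem E & [set: S] \isog setX_group H E].
Proof.
have [H [E [x [y [dHE cH abE HE [nabH nxy]]]]]] := structure_dprod.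
exists S, S, H, E; split=> //; last first.
  exact: isog_dprod dHE (setX_dprod H E) (isog_setX1 _ H) (isog_set1X _ E).
have pH : p.-group H by apply: pgroupS pS; apply: finset.subsetT.
have esH : extraspecial H.
  by apply: (p3group_extraspecial pH nabH); rewrite cH pfactorK.
have [p_odd|p_even] := boolP (odd p).
  left; split=> //; apply/(prime_nt_dvdP p_pr).
    rewrite -dvdn1 -trivg_exponent; apply: contra nabH => /eqP ->.
    exact: abelian1.
  by apply/exponentP=> u _; apply: odd_expgp.
have p2 : p = 2 by apply/(prime_oddPn p_pr).
right; apply/(isoGrpP H (Grp_quaternion (isT : 2 < 3))).
rewrite card_quaternion // cH p2; split=> //.
have z2 : z ^+ 2 = 1 by rewrite -p2 -oz expg_order.
have nZ u v : [~ u, v] != 1 -> u \notin Z.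
  by apply: contra => /in_Z_central uC; apply/commgP; apply: uC.
have x2 : x ^+ 2 = z by apply: two_sq; rewrite ?(nZ _ _ nxy).
have y2 : y ^+ 2 = z by apply: two_sq; rewrite ?(nZ y x) // commg1_sym.
have xyz : [~ x, y] = z.
  have : [~ x, y] \in <[z]> by rewrite -defD mem_commg ?inE.
  case/cycleP=> i ei; move: nxy; rewrite ei.
  rewrite -(odd_double_half i) -muln2 mulnC expgnDr expgnA z2 expg1n mulg1.
  by case: (odd i); rewrite ?eqxx.
apply/existsP; exists (x, y); rewrite /= !xpair_eqE HE eqxx /=.
rewrite (expgnA x 2 2) x2 y2 z2 !eqxx /=.
rewrite conjg_mulR xyz; apply/eqP/(mulgI x); rewrite mulgV mulgA -expg2 x2.
by rewrite -expg2.
Qed.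

End Structure.

(** * A lower bound for the order of the tensor square *)

Section BilinearQuotient.
Variables (S : finGroupType) (F : finFieldType) (d : nat) (v : S -> 'rV[F]_d).
Hypotheses (vM : forall g h, v (g * h) = (v g + v h)%R).
Hypothesis v_surj : forall u, exists g, v g = u.

Lemma v1 : v 1 = 0%R.
Proof. by apply: (@GRing.addrI _ (v 1)); rewrite -vM mulg1 GRing.addr0. Qed.

Lemma vV g : v g^-1 = (- v g)%R.
Proof. by apply: (@GRing.addrI _ (v g)); rewrite -vM mulgV v1 GRing.subrr. Qed.

Lemma vJ g h : v (g * h * g^-1) = v h.
Proof. by rewrite !vM vV GRing.addrC GRing.addrA GRing.addNr GRing.add0r. Qed.

(** A pairing into matrices that factors through the tensor square of the
    vector space S / z. *)
Definition outer g h : 'M[F]_d := ((v g)^T *m v h)%R.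

Lemma outer_crossed : crossed_pairing outer.
Proof.
split=> *; rewrite /outer !vJ vM.
- by rewrite GRing.linearD /= mulmxDl FinRing.zmodMgE GRing.addrC.
- by rewrite mulmxDr.
Qed.

Definition tsq_outer : tsq S ---> 'M[F]_d := tsq_lift outer_crossed.

Lemma tsq_outer_surj (M : 'M[F]_d) : exists t, tsq_outer t = M.
Proof.
rewrite (matrix_sum_delta M).
have imD (A B : 'M[F]_d) : (exists t, tsq_outer t = A) -> (exists t, tsq_outer t = B) ->
    exists t, tsq_outer t = (A + B)%R.
  by move=> [a <-] [b <-]; exists (a * b); rewrite homM.
have im0 : exists t, tsq_outer t = 0%R by exists 1; rewrite gmulf1.
apply: (big_ind (fun A : 'M[F]_d => exists t, tsq_outer t = A)) => // i _.
apply: (big_ind (fun A : 'M[F]_d => exists t, tsq_outer t = A)) => // j _.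
have [g eg] := v_surj (M i j *: delta_mx 0%R i)%R.
have [h eh] := v_surj (delta_mx 0%R j).
exists (tens g h); rewrite [LHS]tsq_liftE /outer eg eh.
by rewrite GRing.linearZ /= -scalemxAl trmx_delta mul_delta_mx.
Qed.

(** The outer products fill the whole matrix space, and elements z (x) g, of
    which there are as many as cosets of tker z, all lie in the kernel of
    this map. *)
Lemma has_order_ge (z : S) t : (forall g, commute z g) -> v z = 0%R ->
  has_order (tsq S) t -> #|F| ^ (d * d) * #|[set: S] : tker z| <= t.
Proof.
move=> zC vz ord_t; have /choice[sec secK] := tsq_outer_surj.
pose R : finType := {A : {set S} | A \in rcosets (tker z) [set: S]}.
have cR : #|{: R}| = #|[set: S] : tker z| by rewrite card_sig.
pose f (x : 'M[F]_d * R) := sec x.1 * tens z (repr (val x.2)).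
rewrite -cR -card_mx -card_prod; apply: (has_order_inj (f := f)) ord_t.
have outz g : tsq_outer (tens z g) = 0%R.
  by rewrite [LHS]tsq_liftE /outer vz trmx0 mul0mx.
move=> [M A] [M' A'] /= eq_f.
have eM : M = M'.
  have := congr1 tsq_outer eq_f; rewrite /f /= !homM !secK !outz.
  by rewrite !FinRing.zmodMgE !GRing.addr0.
rewrite -eM in eq_f *; congr pair; apply: val_inj.
move: eq_f; rewrite /f /= => /mulgI.
case: A A' => _ /= /rcosetsP[x _ ->] [_ /= /rcosetsP[y _ ->]].
rewrite !(tker_rcoset zC (mem_repr_rcoset (tker_group zC) _)) => exy.
apply/rcoset_eqP; rewrite mem_rcoset inE tenszM // tenszV // exy mulgV.
exact: eqxx.
Qed.

End BilinearQuotient.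

Theorem has_order_ge_abelem (S : finGroupType) (p n : nat) (z : S) t :
  prime p -> (forall g, commute z g) -> #[z] = p -> #|S| = (p ^ n)%N ->
  1 < n -> p.-abelem ([set: S] / <[z]>) -> has_order (tsq S) t ->
  p ^ (n.-1 * n.-1) * #|[set: S] : tker z| <= t.
Proof.
move=> p_pr zC oz cS n1 abV ord_t.
have gN g : g \in 'N(<[z]>) by apply: in_norm_central.
have nzS : [set: S] \subset 'N(<[z]>) by apply/fintype.subsetP=> g _.
have cV : #|[set: S] / <[z]>| = (p ^ n.-1)%N.
  by rewrite quotientT cardsT; apply: card_coset_cycle.
have ntV : [set: S] / <[z]> != 1.
  rewrite -cardG_gt1 cV -{1}(expn0 p) ltn_exp2l ?prime_gt1 //.
  by case: (n) n1 => [|[|]].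
pose v g := abelem_rV abV ntV (coset <[z]> g).
have vM g h : v (g * h) = (v g + v h)%R.
  by rewrite /v morphM ?gN // abelem_rV_M ?mem_quotient ?inE.
have v_surj u : exists g, v g = u.
  have : u \in abelem_rV abV ntV @* ([set: S] / <[z]>) by rewrite im_abelem_rV inE.
  case/morphimP=> c _ _ ->; exists (repr c).
  by rewrite /v coset_reprK.
have vz : v z = 0%R by rewrite /v coset_id ?cycle_id // abelem_rV_1.
have := has_order_ge vM v_surj zC vz ord_t.
have -> : 'dim ([set: S] / <[z]>) = n.-1.
  by rewrite (dim_abelemE abV ntV) cV pfactorK.
by rewrite card_Fp.
Qed.

(** * Detecting central tensors on quotients of order p^3 *)

Section Detection.
Variables (S P : finGroupType) (p : nat) (z : S) (K : {set P}).
Hypotheses (p_pr : prime p) (zC : forall g, commute z g).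
Hypotheses (defD : [set: S]^`(1) = <[z]>) (homP : [set: P] \homg [set: S]).
Hypotheses (cP : #|P| = (p ^ 3)%N) (nabP : ~~ abelian [set: P]) (cK : #|K| <= p).
Hypothesis detect : forall c g : P, c \in [set: P]^`(1) -> c != 1 ->
  (forall (H : groupType) (f : P -> P -> H), crossed_pairing f -> f c g = 1) ->
  g \in K.

(** Under a morphism onto P, z goes to a nontrivial commutator c. If g lies
    in the small set K as soon as all crossed pairings of P vanish at (c,
    g), then tker z is mapped into K. *)
Lemma index_tker_ge : p ^ 2 <= #|[set: S] : tker z|.
Proof.
have [th th_onto] := homgP homP.
have thM : {morph th : g h / g * h} by move=> g h; rewrite morphM ?inE.
have thV g : th g^-1 = (th g)^-1 by rewrite morphV ?inE.
have imD : th @* [set: S]^`(1) = [set: P]^`(1).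
  by have := morphim_der th 1 (subxx [set: S]%G); rewrite /= th_onto.
have thz : th z \in [set: P]^`(1).
  by rewrite -imD defD mem_morphim ?inE // cycle_id.
have thz1 : th z != 1.
  apply: contra nabP => /eqP tz1; apply/derG1P; rewrite -imD defD.
  by rewrite morphim_cycle ?inE // tz1 cycle1.
have imK : th @* tker_group zC \subset K.
  apply/fintype.subsetP=> _ /morphimP[g _ gK ->]; apply: detect thz thz1 _.
  move=> H f [fl fr].
  have fth : crossed_pairing (fun a b : S => f (th a) (th b)).
    by split=> [a a' b|a b b']; rewrite !thM !thV (fl, fr).
  have := tsq_liftE fth z g; move: gK; rewrite inE => /eqP ->.
  by rewrite gmulf1.
have ord_im := leq_trans (subset_leq_card imK) cK.
have := index_morphim th (G := [set: S]%G) (H := tker_group zC) (finset.subsetT _).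
rewrite th_onto => /dvdn_leq; rewrite indexg_gt0 => /(_ isT); apply: leq_trans.
have := Lagrange (finset.subsetT (th @* tker_group zC)); rewrite cardsT cP => LP.
by rewrite -(leq_pmul2l (prime_gt0 p_pr)) -expnS -LP leq_mul2r ord_im orbT.
Qed.

End Detection.

(** * Heisenberg groups *)

Section Heisenberg.
Variable F : finFieldType.

(** The triple (a, b, c) stands for the unitriangular matrix with a and b
    next to the diagonal and c in the corner. *)
Definition heis : Type := (F * F * F)%type.
HB.instance Definition _ := Finite.on heis.

Definition Heis (a b c : F) : heis := (a, b, c).
Definition heis_mul (u v : heis) :=
  Heis (u.1.1 + v.1.1)%R (u.1.2 + v.1.2)%R (u.2 + v.2 + u.1.1 * v.1.2)%R.
Definition heis_inv (u : heis) :=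
  Heis (- u.1.1)%R (- u.1.2)%R (- u.2 + u.1.1 * u.1.2)%R.

Lemma heis_mulA : associative heis_mul.
Proof. by move=> [[a b] c] [[a' b'] c'] [[a'' b''] c'']; congr (_, _, _); rewrite /=; ring. Qed.
Lemma heis_mul1 : left_id (Heis 0 0 0)%R heis_mul.
Proof. by move=> [[a b] c]; congr (_, _, _); rewrite /=; ring. Qed.
Lemma heis_mulV : left_inverse (Heis 0 0 0)%R heis_inv heis_mul.
Proof. by move=> [[a b] c]; congr (_, _, _); rewrite /=; ring. Qed.

HB.instance Definition _ := Finite_isGroup.Build heis heis_mulA heis_mul1 heis_mulV.

Lemma heisM a b c a' b' c' :
  Heis a b c * Heis a' b' c' = Heis (a + a')%R (b + b')%R (c + c' + a * b')%R.
Proof. by []. Qed.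

Lemma heisV a b c : (Heis a b c)^-1 = Heis (- a)%R (- b)%R (- c + a * b)%R.
Proof. by []. Qed.

Lemma heisX a b c n : (a * b = 0)%R ->
  Heis a b c ^+ n = Heis (a *+ n)%R (b *+ n)%R (c *+ n)%R.
Proof.
move=> ab; elim: n => [|n IHn]; first by rewrite expg0.
rewrite expgS IHn heisM !GRing.mulrS; congr Heis.
by rewrite GRing.mulrnAr ab GRing.mul0rn GRing.addr0.
Qed.

Lemma heis_der c : c \in [set: heis]^`(1) -> c.1.1 = 0%R /\ c.1.2 = 0%R.
Proof.
case/der_kappa=> u <-.
elim/tsq_ind: u => [|[[a b] c1] [[a' b'] c2]|u v [u1 u2] [v1 v2]|u [u1 u2]].
- by rewrite gmulf1.
- by rewrite kappaE; split; rewrite /=; ring.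
- by rewrite gmulfM /= u1 u2 v1 v2 GRing.addr0.
- by rewrite gmulfV /= u1 u2 GRing.oppr0.
Qed.

(** A pairing with value -2ca' at the central (0, 0, c) and (a', b', c'):
    the antisymmetric form 2(ac' - a'c) is corrected by cubic terms to be
    crossed. The second pairing is obtained from it by the automorphism (a,
    b, c) |-> (b, a, ab - c). *)
Definition heis_pair (u v : heis) : F :=
  (2 * u.1.1 * v.2 - 2 * v.1.1 * u.2 + u.1.1 * (u.1.1 - 1) * v.1.2 -
   v.1.1 * (v.1.1 - 1) * u.1.2)%R.

Definition heis_pair' (u v : heis) : F :=
  (2 * u.1.2 * (v.1.1 * v.1.2 - v.2) - 2 * v.1.2 * (u.1.1 * u.1.2 - u.2) +
   u.1.2 * (u.1.2 - 1) * v.1.1 - v.1.2 * (v.1.2 - 1) * u.1.1)%R.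

Lemma heis_pair_crossed : crossed_pairing heis_pair.
Proof.
by split=> [[[a b] c] [[a' b'] c'] [[a'' b''] c'']|[[a b] c] [[a' b'] c'] [[a'' b''] c'']];
  rewrite /heis_pair !FinRing.zmodMgE /=; ring.
Qed.

Lemma heis_pair'_crossed : crossed_pairing heis_pair'.
Proof.
by split=> [[[a b] c] [[a' b'] c'] [[a'' b''] c'']|[[a b] c] [[a' b'] c'] [[a'' b''] c'']];
  rewrite /heis_pair' !FinRing.zmodMgE /=; ring.
Qed.

Definition heis_center : {set heis} := [set u : heis | (u.1.1 == 0%R) && (u.1.2 == 0%R)].

Lemma card_heis_center : #|heis_center| <= #|F|.
Proof.
have sub : heis_center \subset [set Heis 0%R 0%R c | c : F].
  apply/fintype.subsetP=> -[[a b] c]; rewrite inE /= => /andP[/eqP -> /eqP ->].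
  by apply/imsetP; exists c.
by apply: leq_trans (subset_leq_card sub) _; apply: leq_imset_card.
Qed.

Lemma heis_detect (c g : heis) : (2 : F)%R != 0%R ->
  c \in [set: heis]^`(1) -> c != 1 ->
  (forall (H : groupType) (f : heis -> heis -> H), crossed_pairing f -> f c g = 1) ->
  g \in heis_center.
Proof.
move=> two_nz /heis_der[c1 c2] nc fcg.
have c3 : c.2 != 0%R.
  apply: contra nc => /eqP c3; apply/eqP.
  by rewrite [c]surjective_pairing [c.1]surjective_pairing c1 c2 c3.
have := fcg F heis_pair heis_pair_crossed; have := fcg F heis_pair' heis_pair'_crossed.
rewrite /heis_pair /heis_pair' c1 c2 !FinRing.zmod1gE => e1 e2.
have e1' : (2 * g.1.2 * c.2 = 0)%R by rewrite -[RHS]e1; ring.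
have e2' : (2 * g.1.1 * c.2 = 0)%R by rewrite -[LHS]GRing.opprK -[RHS]GRing.oppr0 -[in RHS]e2; ring.
rewrite inE; move/eqP: e1'; move/eqP: e2'.
by rewrite !GRing.mulf_eq0 (negPf two_nz) (negPf c3) !orbF /= => -> ->.
Qed.

End Heisenberg.

Section HeisenbergPrime.
Variable p : nat.
Hypothesis p_pr : prime p.

Lemma card_heis : #|[set: heis 'F_p]| = (p ^ 3)%N.
Proof.
have -> : #|[set: heis 'F_p]| = #|{: 'F_p * 'F_p * 'F_p}| by rewrite cardsT.
by rewrite !card_prod !card_Fp // !expnSr expn0 mul1n.
Qed.

Lemma heis_nonabelian : ~~ abelian [set: heis 'F_p].
Proof.
apply/negP=> /centsP ab; have := ab (Heis 1 0 0)%R _ (Heis 0 1 0)%R _.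
rewrite !inE => /(_ isT isT) /(congr1 (fun u : heis 'F_p => u.2)) /eqP.
by rewrite !heisM /= !GRing.add0r GRing.mulr1 GRing.mulr0 GRing.oner_eq0.
Qed.

Lemma two_Fp_neq0 : odd p -> (2 : 'F_p)%R != 0%R.
Proof.
move=> p_odd; rewrite -(GRing.dvdn_pcharf (pchar_Fp p_pr)).
by apply/negP=> /dvdn_leq-/(_ isT); case: p p_pr p_odd => [|[|[|]]].
Qed.

(** The presentation of extraspecial groups of exponent p is satisfied by
    the unit vectors. *)
Lemma heis_homg (hT : finGroupType) (H : {group hT}) :
  #|H| = (p ^ 3)%N -> extraspecial H -> exponent H = p -> [set: heis 'F_p] \homg H.
Proof.
move=> cH esH eH.
have iso : H \isog p^{1+2} by apply: isog_pX1p2; rewrite ?eH.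
rewrite (isoGrp_trans iso (Grp_pX1p2 p_pr)).
have pF : (p%:R = 0 :> 'F_p)%R by apply: GRing.pcharf0; apply: pchar_Fp.
pose x : heis 'F_p := Heis 1%R 0%R 0%R; pose y : heis 'F_p := Heis 0%R 1%R 0%R.
have xX k : x ^+ k = Heis (k%:R)%R 0%R 0%R by rewrite heisX ?GRing.mulr0 // GRing.mul0rn.
have yX k : y ^+ k = Heis 0%R (k%:R)%R 0%R by rewrite heisX ?GRing.mul0r // GRing.mul0rn.
have xy : [~ x, y] = Heis 0%R 0%R 1%R.
  by rewrite /x /y commgEl conjgE !heisV !heisM; congr Heis; rewrite /=; ring.
have zX k : [~ x, y] ^+ k = Heis 0%R 0%R (k%:R)%R by rewrite xy heisX ?GRing.mul0r // !GRing.mul0rn.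
have zC g : [~ [~ x, y], g] = 1.
  apply/eqP/commgP; rewrite xy; case: g => -[a b] c.
  by rewrite /commute !heisM; congr Heis; rewrite /=; ring.
apply/existsP; exists (x, y); rewrite /= -/(commg (commg x y) x).
rewrite -/(commg (commg x y) y) !zC xX yX pF !xpair_eqE !eqxx !andbT.
apply/eqP; apply/setP=> -[[a b] c]; rewrite inE.
have Kx : x \in <[x]> <*> <[y]> by rewrite -cycle_subG joing_subl.
have Ky : y \in <[x]> <*> <[y]> by rewrite -cycle_subG joing_subr.
have -> : (a, b, c) = y ^+ b * x ^+ a * [~ x, y] ^+ c.
  rewrite xX yX zX !natr_Zp !heisM; congr Heis; rewrite /=; ring.
by rewrite !groupM ?groupX ?groupR.
Qed.

End HeisenbergPrime.

(** * The quaternion group *)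

(** The bits (a, b, c) stand for (-1)^(c + ab) i^a j^b, so that the cocycle
    of the central extension is the quadratic aa' + bb' + ab'. *)
Definition quat : Type := (bool * bool * bool)%type.
HB.instance Definition _ := Finite.on quat.

Definition Quat (a b c : bool) : quat := (a, b, c).
Definition quat_mul (u v : quat) :=
  Quat (u.1.1 (+) v.1.1) (u.1.2 (+) v.1.2)
    (u.2 (+) v.2 (+) (u.1.1 && v.1.1) (+) (u.1.2 && v.1.2) (+) (u.1.1 && v.1.2)).
Definition quat_inv (u : quat) :=
  Quat u.1.1 u.1.2 (u.2 (+) u.1.1 (+) u.1.2 (+) (u.1.1 && u.1.2)).

Lemma quat_mulA : associative quat_mul.
Proof. by do 3 case=> -[[] [] []]. Qed.
Lemma quat_mul1 : left_id (Quat false false false) quat_mul.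
Proof. by case=> -[[] [] []]. Qed.
Lemma quat_mulV : left_inverse (Quat false false false) quat_inv quat_mul.
Proof. by case=> -[[] [] []]. Qed.

HB.instance Definition _ := Finite_isGroup.Build quat quat_mulA quat_mul1 quat_mulV.

Lemma card_quat : #|[set: quat]| = 8.
Proof.
have -> : #|[set: quat]| = #|{: bool * bool * bool}| by rewrite cardsT.
by rewrite !card_prod !card_bool.
Qed.

Lemma quat_homg (hT : finGroupType) (H : {group hT}) : H \isog 'Q_8 -> [set: quat] \homg H.
Proof.
move=> iso; rewrite (isoGrp_trans iso (Grp_quaternion (isT : 2 < 3))).
pose x := Quat true false false; pose y := Quat false true false.
apply/existsP; exists (x, y); rewrite /= !xpair_eqE.
apply/and4P; split=> //.
apply/eqP; apply/setP=> u; rewrite inE.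
have Kx : x \in <[x]> <*> <[y]> by rewrite -cycle_subG joing_subl.
have Ky : y \in <[x]> <*> <[y]> by rewrite -cycle_subG joing_subr.
have -> : u = x ^+ u.1.1 * y ^+ u.1.2 * (x ^+ 2) ^+ (u.2 (+) (u.1.1 && u.1.2)).
  by case: u => -[[] []] [].
by rewrite !groupM ?groupX.
Qed.

Lemma quat_nonabelian : ~~ abelian [set: quat].
Proof.
apply/negP=> /centsP ab; have := ab (Quat true false false) _ (Quat false true false) _.
by rewrite !inE => /(_ isT isT).
Qed.

Lemma quat_der c : c \in [set: quat]^`(1) -> c.1.1 = false /\ c.1.2 = false.
Proof.
case/der_kappa=> u <-.
elim/tsq_ind: u => [|g h|u v [u1 u2] [v1 v2]|u [u1 u2]].
- by rewrite gmulf1.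
- by rewrite kappaE; case: g h => -[[] []] [] [[[] []] []].
- by rewrite gmulfM /= u1 u2 v1 v2.
- by rewrite gmulfV /= u1 u2.
Qed.

(** Crossed pairings into Z/4, as polynomials in the bits; at the central
    involution they take the values 2a' and 2b'. *)
Definition quat_pairn (u v : quat) : nat :=
  2 * u.2 * v.1.1 + 2 * u.1.1 * v.2 + 3 * u.1.2 * v.1.1 + 3 * u.1.1 * v.1.2 + u.1.1 * v.1.1.

Definition quat_pairn' (u v : quat) : nat :=
  2 * u.2 * v.1.2 + 2 * u.1.2 * v.2 + 3 * u.1.2 * v.1.2 + 3 * u.1.2 * v.1.1 +
  3 * u.1.1 * v.1.2 + 2 * u.1.2 * v.1.1 * v.1.2 + 2 * u.1.1 * u.1.2 * v.1.2.

Definition mod4_crossed (f : quat -> quat -> nat) :=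
  (forall a a' b, f (a * a')%g b =
    f (a * a' * a^-1)%g (a * b * a^-1)%g + f a b %[mod 4]) /\
  (forall a b b', f a (b * b')%g =
    f a b + f (b * a * b^-1)%g (b * b' * b^-1)%g %[mod 4]).

Lemma mod4_crossed_pairing f : mod4_crossed f ->
  crossed_pairing (fun a b => (f a b)%:R%R : 'Z_4).
Proof.
have mod4 i j : i = j %[mod 4] -> (i%:R = j%:R :> 'Z_4)%R.
  by move=> e; rewrite -[LHS]Zp_nat_mod // e Zp_nat_mod.
by move=> [fl fr]; split=> *; rewrite FinRing.zmodMgE -GRing.natrD; apply: mod4.
Qed.

Lemma quat_pairn_crossed : mod4_crossed quat_pairn.
Proof. by split; do 3 case=> -[[] [] []]. Qed.

Lemma quat_pairn'_crossed : mod4_crossed quat_pairn'.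
Proof. by split; do 3 case=> -[[] [] []]. Qed.

Definition quat_center : {set quat} := [set u : quat | ~~ u.1.1 && ~~ u.1.2].

Lemma card_quat_center : #|quat_center| <= 2.
Proof.
have sub : quat_center \subset [set Quat false false c | c : bool].
  apply/fintype.subsetP=> -[[[] []] c]; rewrite inE //= => _.
  by apply/imsetP; exists c.
by apply: leq_trans (subset_leq_card sub) _; rewrite -card_bool leq_imset_card.
Qed.

Lemma quat_detect (c g : quat) :
  c \in [set: quat]^`(1) -> c != 1 ->
  (forall (H : groupType) (f : quat -> quat -> H), crossed_pairing f -> f c g = 1) ->
  g \in quat_center.
Proof.
move=> /quat_der[c1 c2] nc fcg.
have c3 : c = Quat false false true by move: c1 c2 nc; case: c {fcg} => -[[] []] [].
have := fcg 'Z_4 _ (mod4_crossed_pairing quat_pairn_crossed).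
have := fcg 'Z_4 _ (mod4_crossed_pairing quat_pairn'_crossed).
by rewrite c3 inE; case: g {fcg} => -[[] []] [].
Qed.

(** * The direct products attain the bound *)

Section Converse.
Variables (S hT eT : finGroupType) (p : nat) (z : S) (H : {group hT}) (E : {group eT}).
Hypotheses (p_pr : prime p) (pS : p.-group [set: S]) (zC : forall g, commute z g).
Hypothesis defD : [set: S]^`(1) = <[z]>.
Hypothesis caseH : [/\ #|H| = (p ^ 3)%N, extraspecial H & exponent H = p] \/ H \isog 'Q_8.
Hypotheses (abE : p.-abelem E) (iso : [set: S] \isog setX_group H E).

Lemma factor_homg : H \homg [set: S].
Proof.
apply: homg_trans (isog_hom (isog_symr iso)).
by rewrite -[X in X \homg _](morphim_fstX H E) morphim_homg ?finset.subsetT.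
Qed.

Lemma pgroup_factor : p.-group H.
Proof. by have [f <-] := homgP factor_homg; apply: morphim_pgroup. Qed.

Lemma quaternion_prime : H \isog 'Q_8 -> p = 2.
Proof.
move=> isoH; have := pgroup_factor.
rewrite /pgroup (card_isog isoH) (@card_quaternion 3) // => /pnatP.
by move=> /(_ isT 2 isT isT); rewrite inE => /eqP.
Qed.

Lemma factor_extraspecial : extraspecial H.
Proof.
case: caseH => [[]//|isoH]; apply: (p3group_extraspecial pgroup_factor).
  have [f imf] := homgP (quat_homg isoH).
  by apply: contra quat_nonabelian; rewrite -imf; apply: morphim_abelian.
by rewrite (card_isog isoH) (@card_quaternion 3) // (quaternion_prime isoH).
Qed.

(** Frattini subgroups of p-groups are compatible with central products and
    surjections; Phi(H) = H' for H extraspecial and Phi(E) = 1. *)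
Lemma Phi_sub_der : 'Phi([set: S]) \subset [set: S]^`(1).
Proof.
have homX : [set: S] \homg setX_group H E by apply: isog_hom.
have pX : p.-group (finset.setX H E).
  by rewrite /pgroup -(card_isog iso).
have PhiX : 'Phi(setX_group H E) \subset (finset.setX H E)^`(1).
  have [_ <- _] := cprodP (Phi_cprod pX (dprodWcp (setX_dprod H E))).
  have [[PhiH dH] _] := factor_extraspecial.
  rewrite /= -morphim_pairg1 -morphim_pair1g.
  rewrite -(morphim_Phi _ pgroup_factor) ?finset.subsetT //.
  rewrite -(morphim_Phi _ (abelem_pgroup abE)) ?finset.subsetT //.
  rewrite PhiH -dH morphim_der ?finset.subsetT // morphim_pairg1.
  rewrite (eqP (_ : 'Phi(E) == 1)) ?(trivg_Phi (abelem_pgroup abE)) // morphim1 mulg1.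
  by apply/dergS/finset.setXS; rewrite ?sub1G.
have [f imf] := homgP homX.
rewrite -imf -(morphim_Phi _ pX) ?subxx // -morphim_der ?subxx //.
exact: morphimS PhiX.
Qed.

Lemma abelem_quotient : p.-abelem ([set: S] / <[z]>).
Proof.
have -> : <[z]> = 'Phi([set: S]).
  apply/eqP; rewrite -defD finset.eqEsubset Phi_sub_der andbT.
  by rewrite (Phi_joing pS) joing_subl.
exact: Phi_quotient_abelem.
Qed.

(** S maps onto H, which in turn maps onto the Heisenberg group or onto the
    quaternion group, where the detecting pairings live. *)
Lemma index_tker_factor : p ^ 2 <= #|[set: S] : tker z|.
Proof.
case: caseH => [[cH esH eH]|isoH].
  have homH := homg_trans (heis_homg p_pr cH esH eH) factor_homg.
  have two_nz : (2 : 'F_p)%R != 0%R.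
    apply: (two_Fp_neq0 p_pr).
    have [p2|//] := even_prime p_pr; have := extraspecial_nonabelian esH.
    by rewrite (abelem_abelian (exponent2_abelem _)) ?eH ?p2.
  apply: (index_tker_ge p_pr zC defD homH _ (heis_nonabelian p) (K := heis_center 'F_p)).
  - by rewrite -cardsT card_heis.
  - by rewrite -[X in _ <= X](card_Fp p_pr); apply: card_heis_center.
  - by move=> c g; apply: heis_detect.
have p2 := quaternion_prime isoH.
apply: (index_tker_ge p_pr zC defD (homg_trans (quat_homg isoH) factor_homg) _
   quat_nonabelian _ quat_detect); rewrite p2 ?card_quat_center //.
by rewrite -cardsT card_quat.
Qed.

End Converse.

(** * The order of the third homotopy group *)

Section Equality.
Variables (S : finGroupType) (p n t : nat).
Hypotheses (p_pr : prime p) (cS : #|S| = (p ^ n)%N) (cD : #|[set: S]^`(1)| = p).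
Hypothesis ord_t : has_order (tsq S) t.

Let pS : p.-group [set: S].
Proof. by rewrite /pgroup cardsT cS pnatX pnat_id. Qed.

Lemma central_der_generator :
  exists z : S, [/\ forall g, commute z g, [set: S]^`(1) = <[z]> & #[z] = p].
Proof.
have ntD : [set: S]^`(1) != 1 by rewrite -cardG_gt1 cD prime_gt1.
have [z [zD zC oz]] := central_prime_order p_pr pS ntD.
exists z; split=> //; apply/esym/eqP.
by rewrite eqEcard cycle_subG zD cD -orderE oz leqnn.
Qed.

Hypothesis n_gt1 : 1 < n.

(** With k as in has_order_central_der, the bound p^((n - 1) k) |S : tker z|
    reaches this value only for k = n - 1 and index p^2, the hypotheses of
    structure_isog. For a direct product the lower bound has_order_ge_abelem
    reaches it too. *)
Theorem order_extremal : t = (p ^ (n.-1 * n.-1 + 2))%N <->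
  exists (hT eT : finGroupType) (H : {group hT}) (E : {group eT}),
  [/\ [/\ #|H| = (p ^ 3)%N, extraspecial H & exponent H = p] \/ H \isog 'Q_8,
      p.-abelem E & [set: S] \isog setX_group H E].
Proof.
have [z [zC defD oz]] := central_der_generator; have p_gt1 := prime_gt1 p_pr.
have [k [t' [ord_t' le_k k_lt le_t]]] := has_order_central_der zC p_pr cS defD oz.
have le_i : #|[set: S] : tker z| <= p ^ 2 by rewrite -oz index_tker_le2 // oz.
rewrite (has_order_unique ord_t' ord_t) in le_t.
split=> [et|[hT [eT [H [E [caseH abE iso]]]]]].
  have ge : p ^ (n.-1 * n.-1 + 2) <= p ^ (n.-1 * k) * #|[set: S] : tker z| by rewrite -et.
  apply: (structure_isog p_pr pS zC defD oz).
    case: k_lt => // k_lt.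
    have := leq_trans ge (leq_mul (leqnn _) le_i).
    have n1_gt0 : 0 < n.-1 by rewrite -subn1 subn_gt0.
    by rewrite -expnD (leq_exp2l _ _ p_gt1) leq_add2r (leq_pmul2l n1_gt0) leqNgt k_lt.
  rewrite -(leq_pmul2l (_ : 0 < p ^ (n.-1 * n.-1))) ?expn_gt0 ?prime_gt0 // -expnD.
  by apply: leq_trans ge _; rewrite leq_mul2r leq_exp2l // leq_mul2l le_k !orbT.
have abSz := abelem_quotient pS defD caseH abE iso.
have ge_i := index_tker_factor p_pr pS zC defD caseH iso.
have ge_t := has_order_ge_abelem p_pr zC oz cS n_gt1 abSz ord_t.
apply/eqP; rewrite eqn_leq; apply/andP; split.
  apply: leq_trans le_t _; rewrite expnD leq_mul // leq_exp2l // leq_mul2l le_k orbT //.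
by apply: leq_trans ge_t; rewrite expnD leq_mul2l ge_i orbT.
Qed.

End Equality.

Section ThirdHomotopy.
Variables (p n m : nat) (S : finGroupType).
Hypotheses (p_pr : prime p) (cS : #|S| = (p ^ n)%N) (cD : #|[set: S]^`(1)| = (p ^ m)%N).
Hypothesis m_gt0 : 0 < m.

Lemma der_exponent_lt : m < n.
Proof.
rewrite -(ltn_exp2l _ _ (prime_gt1 p_pr)) -cS -cD -cardsT; apply: proper_card.
have pS : p.-group [set: S] by rewrite /pgroup cardsT cS pnatX pnat_id.
apply: (sol_der1_proper (pgroup_sol pS)) => //.
apply/eqP=> S1; move: cD; rewrite S1 derg1 commG1 cards1 => /eqP.
by rewrite eq_sym -(expn0 p) eqn_exp2l ?prime_gt1 // eqn0Ngt m_gt0.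
Qed.

(** By the theorem of Brown and Loday the third homotopy group is the kernel
    of kappa. *)
Lemma pi3_order : exists2 c, (homotopy_group (susp (nerve S)) 3 #= `I_c)%card &
  has_order (tsq S) (c * p ^ m) /\ c <= p ^ (n * (n - m - 1) + 2).
Proof.
have [m' em] : exists m', m = m'.+1 by case: (m) m_gt0 => // m' _; exists m'.
have cD' := cD; rewrite em in cD'.
have [t le_t ord_t] := has_order_bound p_pr cS cD'.
have [c card_c et] := card_J2 ord_t; rewrite cD in et.
exists c; first exact: card_eq_trans (brown_loday S) card_c.
rewrite -et; split=> //.
rewrite -(leq_pmul2r (_ : 0 < p ^ m)) ?expn_gt0 ?prime_gt0 // -et -expnD.
apply: leq_trans le_t _; rewrite leq_exp2l ?prime_gt1 // -em.
have [d ->] : exists d, n = m + d.+1.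
  by exists (n - m.+1)%N; rewrite addnS -addSn subnKC ?der_exponent_lt.
rewrite addnS -addnS addKn subn1 /= addnAC leq_add2r addnS /= mulSn.
by rewrite mulSn (mulnC d) [X in _ <= X]addnC addnA.
Qed.

End ThirdHomotopy.

Theorem corollary2p8 (p n m : nat) (gT : finGroupType) (G : {group gT})
    (p_pr : prime p) (G_nonabelian : ~~ abelian G)
    (G_order : #|G| = (p ^ n)%N) (G'_order : #|G^`(1)| = (p ^ m)%N) :
  (pi3SK G #<= `I_(p ^ (n * (n - m - 1) + 2))%N)%card
  /\ (m = 1%N ->
      (pi3SK G #<= `I_(p ^ (n * (n - 2) + 2))%N)%card
      /\ ((pi3SK G #= `I_(p ^ (n * (n - 2) + 2))%N)%card <->
          exists (hT eT : finGroupType) (H : {group hT}) (E : {group eT}),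
            [/\ [/\ #|H| = (p ^ 3)%N, extraspecial H & exponent H = p]
                \/ H \isog 'Q_8,
                p.-abelem E &
                G \isog setX_group H E])).
Proof.
pose S : finGroupType := subg_of G.
have iso : G \isog [set: S] := isog_subg G.
have cS : #|S| = (p ^ n)%N by rewrite -cardsT -(card_isog iso).
have cD : #|[set: S]^`(1)| = (p ^ m)%N by rewrite -(card_isog (gFisog _ iso)).
have m_gt0 : 0 < m.
  rewrite lt0n; apply: contra G_nonabelian => /eqP m0.
  by apply/derG1P/eqP; rewrite trivg_card1 G'_order m0.
have lt_mn := der_exponent_lt p_pr cS cD m_gt0.
have [c card_c [ord_c le_c]] := pi3_order p_pr cS cD m_gt0.
have le_pi3 : (pi3SK G #<= `I_(p ^ (n * (n - m - 1) + 2))%N)%card.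
  by rewrite (card_le_eql card_c) card_le_II.
split=> // m1; rewrite m1 -subnDA in le_pi3; split=> //.
rewrite m1 in cD ord_c lt_mn.
have := order_extremal p_pr cS cD ord_c lt_mn.
have en : (n.-1 * n.-1 + 2 = n * (n - 2) + 2 + 1)%N.
  case: (n) lt_mn => [|[|k]] //= _; rewrite subn2 /= !mulSn mulnS.
  by rewrite addn1 !addSn.
rewrite en expnD => ext.
have card_pi3 : (pi3SK G #= `I_(p ^ (n * (n - 2) + 2)))%card <-> c = (p ^ (n * (n - 2) + 2))%N.
  split=> [e|<-]; last exact: card_c.
  by apply/card_eq_II; apply: card_eq_trans e; apply: card_esym.
split=> [/card_pi3 ec|[hT [eT [H [E [caseH abE isoG]]]]]].
  have [hT [eT [H [E [caseH abE isoS]]]]] := ext.1 (congr1 (muln^~ (p ^ 1)%N) ec).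
  by exists hT, eT, H, E; split=> //; apply: isog_trans iso isoS.
apply/card_pi3/eqP; rewrite -(eqn_pmul2r (_ : 0 < p ^ 1)) ?expn_gt0 ?prime_gt0 //.
apply/eqP/ext.2; exists hT, eT, H, E; split=> //.
exact: isog_trans (isog_symr iso) isoG.
Qed.
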